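(* Under the bivariate normal model with parameters $(\mu_1,\mu_2,\beta,\theta,\eta)$ and prior $\pi(\mu_1,\mu_2,\beta,\theta,\eta)\propto(\theta\eta)^{-1}$, the prior $\pi$ is a likelihood ratio matching prior for each of $\beta$, $\theta$ and $\eta$ individually. That is, for each choice of interest parameter $\psi\in\{\beta,\theta,\eta\}$ and each $\alpha\in(0,1)$, let $R_{\psi,\alpha}(X)=\{\psi: M_{LR}^*(\psi,X)\le k\}$, where $M_{LR}^*(\psi,X)$ is the likelihood ratio statistic for $\psi$ and $k=k_{\psi,\alpha}(X)$ is chosen so that $R_{\psi,\alpha}(X)$ has posterior probability $1-\alpha$ under $\pi$. Then for each fixed value $\omega=(\mu_1,\mu_2,\beta,\theta,\eta)$ of the parameter, as $n\to\infty$, $$P_\omega\{\psi\in R_{\psi,\alpha}(X)\}=1-\alpha+o(n^{-1}).$$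
   Context: Data: $X=\{(X_{1i},X_{2i}):i=1,\dots,n\}$ ($n\ge 3$) are i.i.d. bivariate normal with means $\mu_1,\mu_2$, variances $\sigma_1^2,\sigma_2^2>0$ and correlation $\rho$, $|\rho|<1$. Reparameterize by $$\beta=\rho\sigma_2/\sigma_1,\qquad \theta=\sigma_1\sigma_2(1-\rho^2)^{1/2},\qquad \eta=\sigma_2(1-\rho^2)^{1/2}/\sigma_1,$$ so that $(\mu_1,\mu_2,\beta,\theta,\eta)$ ranges over $\mathbb{R}^3\times(0,\infty)^2$, and the density of one observation is $$f(x_1,x_2)=(2\pi\theta)^{-1}\exp\Big\{-\tfrac12\Big[\frac{(x_2-\mu_2-\beta(x_1-\mu_1))^2}{\theta\eta}+\frac{\eta(x_1-\mu_1)^2}{\theta}\Big]\Big\}$$ (in this display only, $\pi$ is the usual constant). The improper prior $\pi\propto(\theta\eta)^{-1}$ is a density with respect to Lebesgue measure $d\mu_1\,d\mu_2\,d\beta\,d\theta\,d\eta$; the posterior is obtained by normalizing likelihood times prior. Let $l(\omega)$ be the log-likelihood of the data at $\omega=(\mu_1,\mu_2,\beta,\theta,\eta)$ and $\hat\omega$ the maximum likelihood estimator of $\omega$. For an interest parameter $\psi$, the profile log-likelihood $l^*(\psi)$ is the maximum of $l$ over the remaining four parameters with $\psi$ held fixed, and the likelihood ratio statistic is $M_{LR}^*(\psi,X)=2[l(\hat\omega)-l^*(\psi)]$. $P_\omega$ denotes the sampling probability of the data when the true parameter is $\omega$; $\psi$ inside $P_\omega$ is the corresponding component of $\omega$. 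*)

(* Defs.v *)
From HB Require Import structures.
From mathcomp Require Import all_boot all_order all_algebra.
From mathcomp Require Import all_classical all_reals all_analysis.

Set Implicit Arguments.
Unset Strict Implicit.
Unset Printing Implicit Defensive.

Import Order.TTheory GRing.Theory Num.Theory.
Import numFieldNormedType.Exports.

Local Open Scope classical_set_scope.
Local Open Scope ring_scope.

(* [measurableTypeR R] is R with the sigma-algebra that [lebesgue_measure] is  *)
(* declared on; the products below then have the sigma-algebra of the product  *)
(* of Lebesgue measures.                                                       *)
Definition obs (R : realType) : Type :=
  (measurableTypeR R * measurableTypeR R)%type.

(* A parameter is omega = (mu1, mu2, beta, theta, eta); the constraints        *)
(* theta > 0 and eta > 0 are in [param_space].                                 *)
Definition param (R : realType) : Type :=
  (measurableTypeR R * measurableTypeR R * measurableTypeR R *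
   measurableTypeR R * measurableTypeR R)%type.

Definition par_mu1 (R : realType) (w : param R) : R := w.1.1.1.1.
Definition par_mu2 (R : realType) (w : param R) : R := w.1.1.1.2.
Definition par_beta (R : realType) (w : param R) : R := w.1.1.2.
Definition par_theta (R : realType) (w : param R) : R := w.1.2.
Definition par_eta (R : realType) (w : param R) : R := w.2.

Definition param_space (R : realType) : set (param R) :=
  [set w | 0 < par_theta w /\ 0 < par_eta w].

Definition lebesgue2 (R : realType) : set (obs R) -> \bar R :=
  (@lebesgue_measure R \x @lebesgue_measure R)%E.

Definition lebesgue5 (R : realType) : set (param R) -> \bar R :=
  (@lebesgue_measure R \x @lebesgue_measure R \x @lebesgue_measure R
   \x @lebesgue_measure R \x @lebesgue_measure R)%E.

(* With beta = rho sigma2 / sigma1, theta = sigma1 sigma2 sqrt (1 - rho^2) and *)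
(* eta = sigma2 sqrt (1 - rho^2) / sigma1, we have theta * eta =               *)
(* sigma2^2 (1 - rho^2) and eta / theta = sigma1^-2, so this is the usual      *)
(* bivariate normal density.                                                   *)
Definition density (R : realType) (w : param R) (x : obs R) : R :=
  (2 * pi * par_theta w)^-1 *
  expR (- 2^-1 *
    ((x.2 - par_mu2 w - par_beta w * (x.1 - par_mu1 w)) ^+ 2
       / (par_theta w * par_eta w)
     + par_eta w * (x.1 - par_mu1 w) ^+ 2 / par_theta w)).

Definition likelihood (R : realType) (n : nat) (x : 'I_n -> obs R)
    (w : param R) : R :=
  \prod_(i < n) density w (x i).

Definition loglik (R : realType) (n : nat) (x : 'I_n -> obs R)
    (w : param R) : R :=
  ln (likelihood x w).

Definition is_mle (R : realType) (n : nat) (x : 'I_n -> obs R)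
    (w : param R) : Prop :=
  param_space w /\
  forall w', param_space w' -> loglik x w' <= loglik x w.

Definition is_restricted_mle (R : realType) (n : nat) (psi : param R -> R)
    (v : R) (x : 'I_n -> obs R) (w : param R) : Prop :=
  [/\ param_space w, psi w = v &
      forall w', param_space w' -> psi w' = v -> loglik x w' <= loglik x w].

(* The statistic is 2 (l(hat omega) - l^*(v)), where l^*(v) is the maximum of  *)
(* l under psi = v. As these maxima need not exist (e.g. for collinear data),  *)
(* "m is the value of the statistic at v" is a relation; m is unique.          *)
Definition is_lr_stat (R : realType) (n : nat) (psi : param R -> R)
    (v : R) (x : 'I_n -> obs R) (m : R) : Prop :=
  exists what wv, [/\ is_mle x what, is_restricted_mle psi v x wv &
    m = 2 * (loglik x what - loglik x wv)].

Definition lr_region (R : realType) (n : nat) (psi : param R -> R) (k : R)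
    (x : 'I_n -> obs R) : set R :=
  [set v | exists2 m, is_lr_stat psi v x m & m <= k].

(* Posterior probability of A: the (possibly improper) prior density is taken  *)
(* with respect to d mu1 d mu2 d beta d theta d eta, so that its scale cancels *)
(* in the normalization.                                                       *)
Definition posterior (R : realType) (n : nat) (prior : param R -> R)
    (x : 'I_n -> obs R) (A : set (param R)) : \bar R :=
  ((\int[@lebesgue5 R]_(w in @param_space R `&` A)
      (likelihood x w * prior w)%:E) /
   (\int[@lebesgue5 R]_(w in @param_space R)
      (likelihood x w * prior w)%:E))%E.

Definition is_cutoff (R : realType) (n : nat) (prior psi : param R -> R)
    (alpha : R) (x : 'I_n -> obs R) (k : R) : Prop :=
  posterior prior x [set w | lr_region psi k x (psi w)] = (1 - alpha)%:E.

Definition mutually_independent (R : realType) (d d' : measure_display)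
    (Omega : measurableType d) (T : measurableType d')
    (P : probability Omega R) (n : nat) (X : 'I_n -> Omega -> T) : Prop :=
  forall (J : {set 'I_n}) (A : 'I_n -> set T),
    (forall i, measurable (A i)) ->
    P (\bigcap_(i in [set` J]) (X i @^-1` A i)) =
      (\prod_(i in J) P (X i @^-1` A i))%E.

(* X is a sample of size n whose sampling law is P_w.                          *)
Definition iid_sample (R : realType) (w : param R) (d : measure_display)
    (Omega : measurableType d) (P : probability Omega R)
    (n : nat) (X : 'I_n -> Omega -> obs R) : Prop :=
  [/\ forall i, measurable_fun setT (X i),
      forall i (A : set (obs R)), measurable A ->
        P (X i @^-1` A) = (\int[@lebesgue2 R]_(x in A) (density w x)%:E)%E
    & mutually_independent P X].

(* The first clause records that the cutoff k "chosen so that" the region has  *)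
(* posterior probability 1 - alpha can be chosen; the second concerns every    *)
(* such choice k(X). Both are restricted to data for which the maximum         *)
(* likelihood estimator exists, as the statistic is not defined otherwise.     *)
(* A sample of each size n lives on its own probability space.                 *)
Definition lr_matching (R : realType) (prior psi : param R -> R) : Prop :=
  forall alpha : R, 0 < alpha < 1 ->
  (forall (n : nat) (x : 'I_n -> obs R), (3 <= n)%N ->
     (exists w, is_mle x w) -> exists k, is_cutoff prior psi alpha x k) /\
  forall k : forall n : nat, ('I_n -> obs R) -> R,
    (forall (n : nat) (x : 'I_n -> obs R), (3 <= n)%N ->
       (exists w, is_mle x w) -> is_cutoff prior psi alpha x (k n x)) ->
  forall w : param R, param_space w ->
  forall (d : nat -> measure_display)
    (Omega : forall n, measurableType (d n))
    (P : forall n, probability (Omega n) R)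
    (X : forall n, 'I_n -> Omega n -> obs R),
    (forall n, (3 <= n)%N -> iid_sample w (P n) (X n)) ->
    (fun n : nat =>
       fine (P n [set o | lr_region psi (k n (X n ^~ o)) (X n ^~ o) (psi w)])
       - (1 - alpha))
      =o_\oo (fun n : nat => n%:R^-1 : R).

Definition matching_prior (R : realType) (w : param R) : R :=
  (par_theta w * par_eta w)^-1.

(* Main.v *)
Require Import Defs.
From HB Require Import structures.
From mathcomp Require Import all_boot all_order all_algebra.
From mathcomp Require Import all_classical all_reals all_analysis.
From mathcomp Require Import measurable_realfun.
From mathcomp Require Import ring lra.

Set Implicit Arguments.
Unset Strict Implicit.
Unset Printing Implicit Defensive.

Import Order.TTheory GRing.Theory Num.Theory.
Import numFieldNormedType.Exports.

Local Open Scope classical_set_scope.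
Local Open Scope ring_scope.

(** The parameters [omega = (mu1, mu2, beta, theta, eta)] form a group [G] of
    triangular affine maps of the plane: if [Z] has the law of parameter
    [onep = (0, 0, 0, 1, 1)], then [act omega Z] has the law of parameter [omega].
    The prior [1 / (theta eta)] is the right Haar measure of [G], the maximum
    likelihood estimator is a sufficient statistic, it is equivariant and takes
    its values in [G], on which [G] acts simply transitively, and the likelihood
    ratio statistics are invariant.
    Hence, by transitivity, the posterior law of the statistic does not depend on
    the data, and by invariance its sampling law does not depend on [omega].
    These two laws agree: integrate the indicator of a box in [G], evaluated at the
    estimator, times an invariant event, over [omega] (for the prior) and over the
    sample; right invariance of the prior evaluates this integral in terms of the
    sampling law, and reweighting the sample by the likelihood evaluates it in
    terms of the posterior law.
    As this law has no atom and charges every nondegenerate interval of nonnegative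
    reals, the cutoff exists, is unique, and does not depend on the data, so that
    for every [n >= 3] the coverage is exactly [1 - alpha]. *)

(** * Images and densities of measures *)

(** The density of the estimator, hence the Wishart law, is never computed: the two laws are
    compared inside one double integral over parameter and sample. The prior has infinite mass, so
    this integral must be cut down, and a box imposed on the estimator of the moved sample does so
    at the same cost for every sample. Two constants remain, the prior mass of the box and a
    normalizer; the sure event relates them, provided that the estimator exists almost surely, which
    is where three observations come in.

    The group is not unimodular: left translation by [g] expands volumes by (theta eta)^2, right
    translation only by theta eta, and this singles out 1 / (theta eta) as the right Haar density.

    The sample lives on an arbitrary probability space and is known only through its marginal laws
    and its independence. Changes of law are therefore checked on rectangles, and null events are
    obtained by moving one observation along a line. The existence of a cutoff speaks of the data
    alone, so that a sample has to be constructed for it. *)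

Section density_measure.
Local Open Scope ereal_scope.
Context d (T : measurableType d) (R : realType).
Variables (mu : {measure set T -> \bar R}) (w : T -> R).
Hypotheses (mw : measurable_fun [set: T] w) (w0 : forall x, (0 <= w x)%R).

(** The two proofs are arguments of the definition so that the measure structure below can be
    attached to this name. *)
Definition density_measure of measurable_fun [set: T] w &
    (forall x, (0 <= w x)%R) :=
  fun A : set T => \int[mu]_(x in A) (w x)%:E.

Let nu := density_measure mw w0.

Let nu0 : nu set0 = 0. Proof. exact: integral_set0. Qed.

Let nu_ge0 A : 0 <= nu A.
Proof. by apply: integral_ge0 => x _; rewrite lee_fin. Qed.

Let nu_sigma_additive : semi_sigma_additive nu.
Proof.
move=> F mF tF mUF; rewrite /nu /density_measure ge0_integral_bigcup//; last 2 first.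
- by apply: (measurable_funS measurableT) => //; exact/measurable_EFinP.
- by move=> x _; rewrite lee_fin.
by apply: is_cvg_ereal_nneg_natsum_cond => n _ _; exact: nu_ge0.
Qed.

HB.instance Definition _ := isMeasure.Build _ _ _ (density_measure mw w0) nu0 nu_ge0 nu_sigma_additive.

Import HBNNSimple.

(** By monotone convergence both sides are limits of their values at simple functions increasing to
    [f]. For those, linearity reduces the identity to indicators of level sets, where it is the
    definition of the measure. *)
Lemma integral_density_measure (f : T -> \bar R) : measurable_fun [set: T] f ->
  (forall x, 0 <= f x) ->
  \int[density_measure mw w0]_x f x = \int[mu]_x (f x * (w x)%:E).
Proof.
move=> mf f0; pose h := nnsfun_approx measurableT mf.
have hf x : (EFin \o h ^~ x) @ \oo --> f x by exact: cvg_nnsfun_approx.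
have ndh x m n : (m <= n)%N -> (h m x)%:E <= (h n x)%:E.
  by move=> mn; rewrite lee_fin; exact/lefP/nd_nnsfun_approx.
transitivity (limn (fun n => \int[nu]_x (EFin \o h n) x)).
  rewrite -monotone_convergence//=.
  - by apply: eq_integral => x _; apply/esym/cvg_lim => //; exact: hf.
  - by move=> n; apply/measurable_EFinP.
  - by move=> n x _; rewrite lee_fin.
  - by move=> x _ m n; exact: ndh.
transitivity (limn (fun n => \int[mu]_x ((h n x)%:E * (w x)%:E))); last first.
  rewrite -monotone_convergence//=.
  - apply: eq_integral => x _; apply/cvg_lim => //.
    by apply: cvgeZr => //; exact: hf.
  - by move=> n; apply: emeasurable_funM; exact/measurable_EFinP.
  - by move=> n x _; rewrite mule_ge0 ?lee_fin.
  - by move=> x _ m n mn; rewrite lee_wpmul2r ?lee_fin//; exact/lefP/nd_nnsfun_approx.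
congr (limn _); apply/funext => n.
transitivity (\int[nu]_x
   (\sum_(y \in range (h n)) (y * \1_(h n @^-1` [set y]) x)%:E)).
  by apply: eq_integral => t _; rewrite /= fimfunE -fsumEFin.
have indich r : measurable_fun [set: T] (fun x => (r * \1_(h n @^-1` [set r]) x)%:E).
  by apply: (measurable_comp measurableT) => //; exact: measurable_funM.
rewrite ge0_integral_fsum//; last by move=> m y Ey; exact: nnfun_muleindic_ge0.
transitivity (\int[mu]_x (\sum_(y \in range (h n))
    (y * \1_(h n @^-1` [set y]) x)%:E * (w x)%:E)); last first.
  under eq_integral => x xE.
    rewrite -ge0_mule_fsuml => [|y]; last exact: nnfun_muleindic_ge0.
    rewrite fsumEFin // -(fimfunE _ x); over.
  by [].
rewrite ge0_integral_fsum//; last 2 first.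
  - by move=> y; apply: emeasurable_funM => //; exact/measurable_EFinP.
  - by move=> m y Ey; rewrite mule_ge0 ?lee_fin// -lee_fin EFinM nnfun_muleindic_ge0.
apply: eq_fsbigr => r rhn.
under [LHS]eq_integral do rewrite EFinM.
rewrite integralZl_indic_nnsfun => //.
under [RHS]eq_integral do rewrite EFinM -muleA.
rewrite ge0_integralZl//.
- congr (_ * _); rewrite integral_indic// setIT /nu /density_measure.
  rewrite [LHS]integral_mkcond. apply: eq_integral => x _.
  by rewrite /patch indicE; case: (x \in _); rewrite ?mul1e ?mul0e.
- by apply: emeasurable_funM; exact/measurable_EFinP.
- by move=> x _; rewrite mule_ge0 ?lee_fin.
- by move: rhn => /set_mem[x _ <-]; rewrite lee_fin.
Qed.

End density_measure.

Section image_measure.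
Context d d' (T1 : measurableType d) (T2 : measurableType d') (R : realType).
Variables (m : {measure set T1 -> \bar R}) (f : T1 -> T2).
Hypothesis mf : measurable_fun setT f.

Definition image_measure : {measure set T2 -> \bar R}.
Proof. by refine (pushforward m f : {measure set T2 -> \bar R}); exact: mf. Defined.

Lemma image_measureE A : image_measure A = m (f @^-1` A).
Proof. by []. Qed.

Lemma integral_image_measure (F : T2 -> \bar R) : measurable_fun setT F ->
  (forall x, 0 <= F x)%E ->
  (\int[image_measure]_x F x = \int[m]_x F (f x))%E.
Proof. by move=> mF F0; rewrite ge0_integral_pushforward// preimage_setT. Qed.

End image_measure.

Section product_sigma_finite.
Context d1 d2 (T1 : measurableType d1) (T2 : measurableType d2) (R : realType).
Variables (m1 : {sigma_finite_measure set T1 -> \bar R})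
  (m2 : {sigma_finite_measure set T2 -> \bar R}).

(* An alias for [m1 \x m2]: for the latter, canonical inference of a sigma-finite
   structure only succeeds when [m1] and [m2] are the two projections of a pair
   of subprobabilities. *)
Definition product_sfm : set (T1 * T2)%type -> \bar R := (m1 \x m2)%E.

HB.instance Definition _ := Measure.on product_sfm.

Lemma sigma_finite_product_sfm : sigma_finite setT product_sfm.
Proof.
by case: (lebesgue_integral_fubini.measure_function_Measure_isSigmaFinite__to__measure_function_isSigmaFinite m1 m2).
Qed.

HB.instance Definition _ := Measure_isSigmaFinite.Build _ _ _ product_sfm
  sigma_finite_product_sfm.

End product_sigma_finite.

(* The image of [m] under [g] is [k^-1 m]. *)
Definition scales_measure d (T : measurableType d) (R : realType)
    (m : set T -> \bar R) (k : R) (g : T -> T) :=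
  measurable_fun setT g /\
  forall F : T -> \bar R, measurable_fun setT F -> (forall x, 0 <= F x)%E ->
    (k%:E * \int[m]_x F (g x) = \int[m]_x F x)%E.

Section affine.
Local Open Scope ereal_scope.

(** * Jacobians of affine and triangular maps, by Tonelli's theorem *)

Context (R : realType).
Local Notation leb := (@lebesgue_measure R).
Local Notation mR := (measurableTypeR R).

Lemma measurable_affine (a c : R) :
  measurable_fun [set: mR] (fun x : mR => (a * x + c)%R : mR).
Proof. by apply: measurable_funD => //; exact: measurable_funM. Qed.

(** The image of Lebesgue measure under the map, multiplied by [a], gives every interval []u, v]]
    its length, and Lebesgue measure is the only measure that does. *)
Lemma scales_affine (a c : R) : (0 < a)%R ->
  scales_measure leb a (fun x : mR => (a * x + c)%R : mR).
Proof.
move=> a0; split; first exact: measurable_affine.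
move=> F mF F0.
have a0' : (0 <= a)%R by exact: ltW.
pose f := (fun x : mR => (a * x + c)%R : mR).
have mf : measurable_fun setT f := measurable_affine a c.
rewrite -(integral_image_measure leb mf)//.
rewrite -[X in X%:E * _]/((NngNum a0')%:num).
rewrite -ge0_integral_mscale//.
apply: eq_measure_integral => A mA _; apply/esym/lebesgue_measure_unique => //.
move=> _ [[u v]] _ <- /=.
have fE : f @^-1` `]u, v] = `]((u - c) / a)%R, ((v - c) / a)%R]%classic.
  apply/seteqP; split => x /=; rewrite !in_itv/= ltr_pdivrMr// ler_pdivlMr// /f;
    by rewrite ltrBlDr lerBrDr [(x * a)%R]mulrC.
transitivity (a%:E * leb (f @^-1` `]u, v])); last by [].
rewrite fE !lebesgue_measure_itv/= !lte_fin ltr_pM2r ?invr_gt0// ltrD2r.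
case: ifPn => _; last by rewrite mule0.
by rewrite -!EFinD -EFinM; congr EFin; field; rewrite gt_eqF.
Qed.

(** The Jacobian of a triangular map is the product of its diagonal factors. Tonelli's theorem shows
    it without any derivative: for each value of the second coordinate the inner integral absorbs
    [k1], then the outer one absorbs [k2]. *)
Lemma scales_skew d1 d2 (T1 : measurableType d1) (T2 : measurableType d2)
    (m1 : {sigma_finite_measure set T1 -> \bar R})
    (m2 : {sigma_finite_measure set T2 -> \bar R})
    (k1 k2 : R) (g1 : T2 -> T1 -> T1) (g2 : T2 -> T2) : (0 <= k1)%R ->
  measurable_fun setT (fun z : T1 * T2 => (g1 z.2 z.1, g2 z.2)) ->
  (forall y, scales_measure m1 k1 (g1 y)) -> scales_measure m2 k2 g2 ->
  (0 <= k2)%R ->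
  scales_measure (m1 \x m2) (k1 * k2) (fun z => (g1 z.2 z.1, g2 z.2)).
Proof.
move=> k10 mg h1 [mg2 h2] k20; split => // F mF F0.
rewrite fubini_tonelli2//; last exact: measurableT_comp.
rewrite [RHS]fubini_tonelli2//.
rewrite /fubini_G -[RHS]h2//; last 2 first.
- exact: measurable_fun_fubini_tonelli_G.
- by move=> y; exact: integral_ge0.
rewrite mulrC EFinM -muleA; congr (_ * _).
rewrite -ge0_integralZl//; last 2 first.
- apply: (measurable_fun_fubini_tonelli_G
    (fun z : T1 * T2 => F (g1 z.2 z.1, g2 z.2))) => //.
  exact: measurableT_comp.
- by move=> y _; exact: integral_ge0.
apply: eq_integral => y _ /=.
have [_ /(_ (fun x => F (x, g2 y))) ->//] := h1 y.
by apply: measurableT_comp => //; exact: pair2_measurable.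
Qed.

Lemma scales_skew2 d1 d2 (T1 : measurableType d1) (T2 : measurableType d2)
    (m1 : {sigma_finite_measure set T1 -> \bar R})
    (m2 : {sigma_finite_measure set T2 -> \bar R})
    (k1 k2 : R) (g1 : T1 -> T1) (g2 : T1 -> T2 -> T2) : (0 <= k1)%R ->
  measurable_fun setT (fun z : T1 * T2 => (g1 z.1, g2 z.1 z.2)) ->
  scales_measure m1 k1 g1 -> (forall x, scales_measure m2 k2 (g2 x)) ->
  (0 <= k2)%R ->
  scales_measure (m1 \x m2) (k1 * k2) (fun z => (g1 z.1, g2 z.1 z.2)).
Proof.
move=> k10 mg [mg1 h1] h2 k20; split => // F mF F0.
rewrite fubini_tonelli1//; last exact: measurableT_comp.
rewrite [RHS]fubini_tonelli1//.
rewrite /fubini_F -[RHS]h1//; last 2 first.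
- exact: measurable_fun_fubini_tonelli_F.
- by move=> y; exact: integral_ge0.
rewrite EFinM -muleA; congr (_ * _).
rewrite -ge0_integralZl//; last 2 first.
- apply: (measurable_fun_fubini_tonelli_F
    (fun z : T1 * T2 => F (g1 z.1, g2 z.1 z.2))) => //.
  exact: measurableT_comp.
- by move=> y _; exact: integral_ge0.
apply: eq_integral => x _ /=.
have [_ /(_ (fun y => F (g1 x, y))) ->//] := h2 x.
by apply: measurableT_comp => //; exact: pair1_measurable.
Qed.

End affine.

(** * Measurability of elementary expressions *)

Section measurability.
Context (R : realType) d (T : measurableType d).
Implicit Types f g : T -> R.

Lemma measurable_funV f : measurable_fun setT f ->
  measurable_fun setT (fun x => (f x)^-1).
Proof.
(* [powR] with exponent -1 is the inverse on positive reals only, hence the square; at a zero of [f]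
   both sides vanish. *)
move=> mf; have -> : (fun x => (f x)^-1) =
    (fun x => f x * (powR (f x ^+ 2) (-1))).
  apply/funext => x; have [->|fx0] := eqVneq (f x) 0; first by rewrite invr0 mul0r.
  by rewrite powR_inv1 ?sqr_ge0// expr2 invfM mulrA divff// mul1r.
apply: measurable_funM => //.
by apply: (measurableT_comp (measurable_powR _)); exact: measurable_funX.
Qed.

Lemma measurable_fun_sqrt f : measurable_fun setT f ->
  measurable_fun setT (fun x => Num.sqrt (f x)).
Proof.
move=> mf; apply: measurableT_comp => //.
by apply: continuous_measurable_fun; exact: sqrt_continuous.
Qed.

Lemma measurable_fun_expR f : measurable_fun setT f ->
  measurable_fun setT (fun x => expR (f x)).
Proof. by move=> mf; exact: measurableT_comp. Qed.

Lemma measurable_fun_ln f : measurable_fun setT f ->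
  measurable_fun setT (fun x => ln (f x)).
Proof. by move=> mf; apply: measurableT_comp => //; exact: measurable_ln. Qed.

Lemma measurable_fun_prod_ord n (f : 'I_n -> T -> R) :
  (forall i, measurable_fun setT (f i)) ->
  measurable_fun setT (fun x => \prod_(i < n) f i x).
Proof.
move=> mf.
elim: n f mf => [|n ih] f mf.
  by under eq_fun do rewrite big_ord0; exact: measurable_cst.
under eq_fun do rewrite big_ord_recl.
by apply: measurable_funM => //; exact: (ih (fun i => f (lift ord0 i))).
Qed.

Lemma measurable_fun_sum_ord n (f : 'I_n -> T -> R) :
  (forall i, measurable_fun setT (f i)) ->
  measurable_fun setT (fun x => \sum_(i < n) f i x).
Proof. by move=> mf; exact: measurable_sum. Qed.

Lemma measurable_fun_param (f1 f2 f3 f4 f5 : T -> R) :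
  measurable_fun setT f1 -> measurable_fun setT f2 -> measurable_fun setT f3 ->
  measurable_fun setT f4 -> measurable_fun setT f5 ->
  measurable_fun setT (fun t => (f1 t, f2 t, f3 t, f4 t, f5 t) : param R).
Proof.
move=> m1 m2 m3 m4 m5.
by do 4 (apply: measurable_fun_pair => //).
Qed.

Lemma measurable_par (f : T -> param R) : measurable_fun setT f ->
  [/\ measurable_fun setT (fun t => par_mu1 (f t)),
     measurable_fun setT (fun t => par_mu2 (f t)),
     measurable_fun setT (fun t => par_beta (f t)),
     measurable_fun setT (fun t => par_theta (f t)) &
     measurable_fun setT (fun t => par_eta (f t))].
Proof.
move=> mf.
have m1 : measurable_fun setT (fun t => (f t).1) by exact: measurableT_comp.
have m2 : measurable_fun setT (fun t => (f t).1.1) by exact: measurableT_comp.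
have m3 : measurable_fun setT (fun t => (f t).1.1.1) by exact: measurableT_comp.
split.
- exact: (measurableT_comp measurable_fst m3).
- exact: (measurableT_comp measurable_snd m3).
- exact: (measurableT_comp measurable_snd m2).
- exact: (measurableT_comp measurable_snd m1).
- exact: (measurableT_comp measurable_snd mf).
Qed.

End measurability.

Ltac mfun := repeat first
  [ assumption | exact: measurable_cst | exact: measurable_id
  | apply: measurable_fun_param | apply: measurable_fun_pair
  | apply: measurable_funD | apply: measurable_funB | apply: measurable_funM
  | apply: measurable_funN
  | apply: measurable_funX | apply: measurable_funV | apply: measurable_fun_sqrt
  | apply: measurable_fun_expR | apply: measurable_fun_ln
  | apply: measurable_fun_sum_ord => ? | apply: measurable_fun_prod_ord => ? ].

(** * The parameter group and its Haar measures *)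

Section group.
Context (R : realType).
Implicit Types (g w s : param R) (z : obs R).

(** In the usual parameters these are sigma1 and sigma2 (1 - rho^2)^(1/2): the standard deviation of
    the first coordinate, and that of the second given the first. *)
Definition scl1 g : R := Num.sqrt (par_theta g / par_eta g).
Definition scl2 g : R := Num.sqrt (par_theta g * par_eta g).

(** Read off from the composition of [act g] after [act w]. The simple form of the slope comes from
    [scl2 g = par_eta g * scl1 g], valid on [param_space]. *)
Definition mulp g w : param R :=
  (scl1 g * par_mu1 w + par_mu1 g,
   scl2 g * par_mu2 w + (par_beta g * scl1 g * par_mu1 w + par_mu2 g),
   par_eta g * par_beta w + par_beta g,
   par_theta g * par_theta w,
   par_eta g * par_eta w).

(** The regression representation: the first coordinate is mu1 + scl1 z1, and the second is mu2 +
    beta (x1 - mu1) + scl2 z2. *)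
Definition act g z : obs R :=
  (scl1 g * z.1 + par_mu1 g,
   scl2 g * z.2 + (par_beta g * scl1 g * z.1 + par_mu2 g)).

Definition onep : param R := (0, 0, 0, 1, 1).

Lemma measurable_mulp d (T : measurableType d) (f g : T -> param R) :
  measurable_fun setT f -> measurable_fun setT g ->
  measurable_fun setT (fun t => mulp (f t) (g t)).
Proof.
move=> /measurable_par[f1 f2 f3 f4 f5] /measurable_par[g1 g2 g3 g4 g5].
rewrite /mulp /scl1 /scl2; mfun.
Qed.

Lemma measurable_act d (T : measurableType d) (f : T -> param R) (g : T -> obs R) :
  measurable_fun setT f -> measurable_fun setT g ->
  measurable_fun setT (fun t => act (f t) (g t)).
Proof.
move=> /measurable_par[f1 f2 f3 f4 f5] mg.
have g1 : measurable_fun setT (fun t => (g t).1) by exact: measurableT_comp.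
have g2 : measurable_fun setT (fun t => (g t).2) by exact: measurableT_comp.
rewrite /act /scl1 /scl2; mfun.
Qed.

Lemma measurable_density d (T : measurableType d) (f : T -> param R) (g : T -> obs R) :
  measurable_fun setT f -> measurable_fun setT g ->
  measurable_fun setT (fun t => density (f t) (g t)).
Proof.
move=> /measurable_par[f1 f2 f3 f4 f5] mg.
have g1 : measurable_fun setT (fun t => (g t).1) by exact: measurableT_comp.
have g2 : measurable_fun setT (fun t => (g t).2) by exact: measurableT_comp.
rewrite /density; mfun.
Qed.

Lemma scl1_gt0 g : param_space g -> 0 < scl1 g.
Proof. by move=> [t0 e0]; rewrite sqrtr_gt0 divr_gt0. Qed.

Lemma scl2_gt0 g : param_space g -> 0 < scl2 g.
Proof. by move=> [t0 e0]; rewrite sqrtr_gt0 mulr_gt0. Qed.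

Lemma sqr_scl1 g : param_space g -> scl1 g ^+ 2 = par_theta g / par_eta g.
Proof. by move=> [t0 e0]; rewrite sqr_sqrtr// ltW// divr_gt0. Qed.

Lemma sqr_scl2 g : param_space g -> scl2 g ^+ 2 = par_theta g * par_eta g.
Proof. by move=> [t0 e0]; rewrite sqr_sqrtr// ltW// mulr_gt0. Qed.

Lemma scl2E g : param_space g -> scl2 g = par_eta g * scl1 g.
Proof.
move=> g0; have [t0 e0] := g0; rewrite /scl2 /scl1.
rewrite -[X in X * Num.sqrt _](ger0_norm (ltW e0)) -sqrtr_sqr -sqrtrM ?sqr_ge0//.
by congr Num.sqrt; field; rewrite gt_eqF.
Qed.

Lemma scl1M2 g : param_space g -> scl1 g * scl2 g = par_theta g.
Proof.
move=> g0; have [t0 e0] := g0; rewrite scl2E// mulrCA -expr2 sqr_scl1//.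
by field; rewrite gt_eqF.
Qed.

Lemma param_space_mulp g w : param_space g -> param_space w ->
  param_space (mulp g w).
Proof. by move=> [? ?] [? ?]; split; rewrite /mulp/= mulr_gt0. Qed.

Lemma param_space_mulpr g w : param_space w ->
  param_space (mulp g w) -> param_space g.
Proof.
move=> [t0 e0] []; rewrite /mulp/par_theta/par_eta/= => t1 e1; split.
  by rewrite -(pmulr_lgt0 _ t0).
by rewrite -(pmulr_lgt0 _ e0).
Qed.

Lemma param_space_mulpl g w : param_space g ->
  param_space (mulp g w) -> param_space w.
Proof.
move=> [t0 e0] []; rewrite /mulp/par_theta/par_eta/= => t1 e1; split.
  by rewrite -(pmulr_rgt0 _ t0).
by rewrite -(pmulr_rgt0 _ e0).
Qed.

Lemma param_space1 : param_space onep. Proof. by split => /=. Qed.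

Lemma measurable_param_space : measurable (@param_space R).
Proof.
have [_ _ _ m4 m5] := measurable_par (@measurable_id _ (param R) setT).
have -> : @param_space R = [set w | 0 < par_theta w] `&` [set w | 0 < par_eta w].
  by [].
by apply: measurableI; rewrite -[X in measurable X]setTI;
  apply: measurable_fun_ltr.
Qed.

Lemma mulp1 g : param_space g -> mulp g onep = g.
Proof.
by case: g => [[[[a b] c] t] e] g0; rewrite /mulp /=; rewrite !(mulr0, add0r, mulr1).
Qed.

End group.

Section triangular.
Local Open Scope ereal_scope.
Context (R : realType).
Local Notation leb := (@lebesgue_measure R).
Local Notation mR := (measurableTypeR R).

(** [leb2] and [leb5] are convertible to [lebesgue2] and [lebesgue5], but carry the sigma-finite
    structure that Tonelli's theorem asks for. *)
Definition leb2 : {sigma_finite_measure set (obs R) -> \bar R} :=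
  product_sfm leb leb.

Definition leb5 : {sigma_finite_measure set (param R) -> \bar R} :=
  product_sfm (product_sfm (product_sfm (product_sfm leb leb) leb) leb) leb.

Lemma eq_scales_measure d (T : measurableType d) (m : set T -> \bar R)
    (k k' : R) (g g' : T -> T) : k = k' -> g =1 g' ->
  scales_measure m k g -> scales_measure m k' g'.
Proof. by move=> <- /funext <-. Qed.

Lemma scales_triangular2 (k1 k2 : R) (c1 : R) (c2 : mR -> R) :
  (0 < k1)%R -> (0 < k2)%R -> measurable_fun setT c2 ->
  scales_measure (leb2) (k1 * k2)
    (fun z : obs R => (k1 * z.1 + c1, k2 * z.2 + c2 z.1)%R : obs R).
Proof.
move=> k10 k20 mc2.
apply: (@scales_skew2 R _ _ mR mR leb leb k1 k2 (fun x => k1 * x + c1)%R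
  (fun x y => k2 * y + c2 x)%R); [exact: ltW| | |move=> x|exact: ltW].
- have mc2' : measurable_fun setT (fun x : mR * mR => c2 x.1) by exact: measurableT_comp.
  by mfun.
- exact: scales_affine.
- exact: scales_affine.
Qed.

(** The order of dependence is eta and theta, then beta, then mu1, then mu2. It is chosen so that
    left and right translations of the group are both triangular. The later components of the nested
    pair serve as parameters for the earlier ones, which gives one skew product per coordinate. *)
Lemma scales_triangular5 (k1 k2 k3 k4 k5 c4 c5 : R)
    (c1 : mR * mR * mR -> R) (c2 : mR * (mR * mR * mR) -> R)
    (c3 : mR * mR -> R) :
  (0 < k1)%R -> (0 < k2)%R -> (0 < k3)%R -> (0 < k4)%R -> (0 < k5)%R ->
  measurable_fun setT c1 -> measurable_fun setT c2 -> measurable_fun setT c3 ->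
  scales_measure (leb5) (k1 * k2 * k3 * k4 * k5)
    (fun w : param R =>
      (k1 * par_mu1 w + c1 (par_beta w, par_theta w, par_eta w),
       k2 * par_mu2 w + c2 (par_mu1 w, (par_beta w, par_theta w, par_eta w)),
       k3 * par_beta w + c3 (par_theta w, par_eta w),
       k4 * par_theta w + c4, k5 * par_eta w + c5)%R : param R).
Proof.
move=> k10 k20 k30 k40 k50 mc1 mc2 mc3.
have c1m d (T : measurableType d) (f1 f2 f3 : T -> mR) : measurable_fun setT f1 ->
    measurable_fun setT f2 -> measurable_fun setT f3 ->
    measurable_fun setT (fun t => c1 (f1 t, f2 t, f3 t)).
  by move=> ? ? ?; apply: (measurableT_comp mc1); mfun.
have c2m d (T : measurableType d) (f1 f2 f3 f4 : T -> mR) : measurable_fun setT f1 ->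
    measurable_fun setT f2 -> measurable_fun setT f3 -> measurable_fun setT f4 ->
    measurable_fun setT (fun t => c2 (f1 t, (f2 t, f3 t, f4 t))).
  by move=> ? ? ? ?; apply: (measurableT_comp mc2); mfun.
have c3m d (T : measurableType d) (f1 f2 : T -> mR) : measurable_fun setT f1 ->
    measurable_fun setT f2 ->
    measurable_fun setT (fun t => c3 (f1 t, f2 t)).
  by move=> ? ?; apply: (measurableT_comp mc3); mfun.
pose g2 (b t e : R) (z : mR * mR) : mR * mR :=
  (k1 * z.1 + c1 (b, t, e), k2 * z.2 + c2 (z.1, (b, t, e)))%R.
have s2 b t e : scales_measure (leb \x leb) (k1 * k2) (g2 b t e).
  apply: (@scales_triangular2 k1 k2 _ (fun x => c2 (x, (b, t, e)))) => //.
  by apply: c2m; mfun.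
pose g3 (t e : R) (z : mR * mR * mR) : mR * mR * mR :=
  (g2 z.2 t e z.1, k3 * z.2 + c3 (t, e))%R.
have s3 t e : scales_measure (leb \x leb \x leb) (k1 * k2 * k3) (g3 t e).
  apply: (@scales_skew R _ _ (mR * mR)%type mR (product_sfm leb leb) leb _ _ (fun b => g2 b t e)
     (fun b => k3 * b + c3 (t, e))%R).
  - by rewrite ltW ?mulr_gt0.
  - have m1 : measurable_fun setT (fun z : mR * mR * mR => z.1.1) by exact: measurableT_comp.
    have m2 : measurable_fun setT (fun z : mR * mR * mR => z.1.2) by exact: measurableT_comp.
    by rewrite /g2; mfun => //=; [apply: c1m|apply: c2m]; mfun.
  - by move=> b; exact: s2.
  - exact: scales_affine.
  - exact: ltW.
pose g4 (e : R) (z : mR * mR * mR * mR) : mR * mR * mR * mR :=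
  (g3 z.2 e z.1, k4 * z.2 + c4)%R.
have s4 e : scales_measure (leb \x leb \x leb \x leb) (k1 * k2 * k3 * k4) (g4 e).
  apply: (@scales_skew R _ _ (mR * mR * mR)%type mR (product_sfm (product_sfm leb leb) leb) leb _ _ (fun t => g3 t e)
     (fun b => k4 * b + c4)%R).
  - by rewrite ltW ?mulr_gt0.
  - have m0 : measurable_fun setT (fun z : mR * mR * mR * mR => z.1.2) by exact: measurableT_comp.
    have m3 : measurable_fun setT (fun z : mR * mR * mR * mR => z.1.1) by exact: measurableT_comp.
    have m1 : measurable_fun setT (fun z : mR * mR * mR * mR => z.1.1.1) by exact: (measurableT_comp measurable_fst m3).
    have m2 : measurable_fun setT (fun z : mR * mR * mR * mR => z.1.1.2) by exact: (measurableT_comp measurable_snd m3).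
    by rewrite /g3 /g2; mfun => //=; [apply: c1m|apply: c2m|apply: c3m]; mfun.
  - by move=> b; exact: s3.
  - exact: scales_affine.
  - exact: ltW.
apply: (@scales_skew R _ _ (mR * mR * mR * mR)%type mR (product_sfm (product_sfm (product_sfm leb leb) leb) leb) leb _ _ g4
   (fun b => k5 * b + c5)%R).
- by rewrite ltW ?mulr_gt0.
- have [n1 n2 n3 n4 n5] := measurable_par (@measurable_id _ (param R) setT).
  change (measurable_fun setT (fun w : param R => (k1 * par_mu1 w + c1 (par_beta w, par_theta w, par_eta w),
       k2 * par_mu2 w + c2 (par_mu1 w, (par_beta w, par_theta w, par_eta w)),
       k3 * par_beta w + c3 (par_theta w, par_eta w),
       k4 * par_theta w + c4, k5 * par_eta w + c5)%R : param R)).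
  by mfun; [apply: c1m|apply: c2m|apply: c3m]; mfun.
- by move=> b; exact: s4.
- exact: scales_affine.
- exact: ltW.
Qed.

End triangular.

Section invariance.
Local Open Scope ereal_scope.
Context (R : realType).
Local Notation leb := (@lebesgue_measure R).
Local Notation mR := (measurableTypeR R).

(** The diagonal of the translation is (1, 1, 1, theta, eta), taken at [s]. The resulting factor is
    exactly the one that the density 1 / (theta eta) compensates. *)
Lemma scales_mulpr s : param_space s ->
  scales_measure (leb5 R) (par_theta s * par_eta s) (fun w => mulp w s).
Proof.
move=> [t0 e0].
pose a (p : mR * mR) : R := Num.sqrt (p.1 / p.2).
pose b (p : mR * mR) : R := Num.sqrt (p.1 * p.2).
have ma : measurable_fun setT a by rewrite /a; mfun.
have mb : measurable_fun setT b by rewrite /b; mfun.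
have m1 : measurable_fun setT (fun p : mR * mR * mR => p.1.1) by exact: measurableT_comp.
have m2 : measurable_fun setT (fun p : mR * mR * mR => p.1.2) by exact: measurableT_comp.
have ma' : measurable_fun setT (fun p : mR * mR * mR => a (p.1.2, p.2)).
  by apply: (measurableT_comp ma); mfun.
have mb' : measurable_fun setT (fun p : mR * mR * mR => b (p.1.2, p.2)).
  by apply: (measurableT_comp mb); mfun.
pose c1 (q : mR * mR * mR) : R := (a (q.1.2, q.2) * par_mu1 s)%R.
pose c2 (p : mR * (mR * mR * mR)) : R :=
  (b (p.2.1.2, p.2.2) * par_mu2 s +
   p.2.1.1 * a (p.2.1.2, p.2.2) * par_mu1 s)%R.
pose c3 (p : mR * mR) : R := (p.2 * par_beta s)%R.
have mc1 : measurable_fun setT c1 by rewrite /c1; mfun.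
have mc2 : measurable_fun setT c2.
  pose c2' (q : mR * mR * mR) : R :=
    (b (q.1.2, q.2) * par_mu2 s + q.1.1 * a (q.1.2, q.2) * par_mu1 s)%R.
  have mc2' : measurable_fun setT c2' by rewrite /c2'; mfun.
  exact: (measurableT_comp mc2' measurable_snd).
have mc3 : measurable_fun setT c3 by rewrite /c3; mfun.
have H := @scales_triangular5 R 1 1 1 (par_theta s) (par_eta s) 0 0 c1 c2 c3
  ltr01 ltr01 ltr01 t0 e0 mc1 mc2 mc3.
apply: (eq_scales_measure _ _ H).
  by rewrite !mul1r.
move=> [[[[m n] be] t] e]; rewrite /mulp /c2 /c1 /c3 /a /b /scl1 /scl2 /=.
rewrite /par_mu1 /par_mu2 /par_beta /par_theta /par_eta /=.
do ! congr pair; ring.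
Qed.

(** The diagonal is (scl1, scl2, eta, theta, eta), taken at [g], and scl1 scl2 = theta; hence the
    square. *)
Lemma scales_mulpl g : param_space g ->
  scales_measure (leb5 R) ((par_theta g * par_eta g) ^+ 2)%R (mulp g).
Proof.
move=> g0; have [t0 e0] := g0.
pose c1 (q : mR * mR * mR) : R := par_mu1 g.
pose c2 (p : mR * (mR * mR * mR)) : R :=
  (par_beta g * scl1 g * p.1 + par_mu2 g)%R.
pose c3 (p : mR * mR) : R := par_beta g.
have mc1 : measurable_fun setT c1 by rewrite /c1; mfun.
have mc2 : measurable_fun setT c2 by rewrite /c2; mfun.
have mc3 : measurable_fun setT c3 by rewrite /c3; mfun.
have H := @scales_triangular5 R (scl1 g) (scl2 g) (par_eta g) (par_theta g)
  (par_eta g) 0 0 c1 c2 c3 (scl1_gt0 g0) (scl2_gt0 g0) e0 t0 e0 mc1 mc2 mc3.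
apply: (eq_scales_measure _ _ H); first by rewrite scl1M2//; ring.
by move=> w; rewrite !addr0.
Qed.

Lemma scales_act g : param_space g ->
  scales_measure (leb2 R) (par_theta g) (act g).
Proof.
move=> g0.
pose c2 (x : mR) : R := (par_beta g * scl1 g * x + par_mu2 g)%R.
have mc2 : measurable_fun setT c2 by rewrite /c2; mfun.
have H := @scales_triangular2 R (scl1 g) (scl2 g) (par_mu1 g) c2
  (scl1_gt0 g0) (scl2_gt0 g0) mc2.
by apply: (eq_scales_measure _ _ H); first exact: scl1M2.
Qed.

End invariance.

(** * Independent samples *)

Section independence.
Local Open Scope ereal_scope.
Context d (Omega : measurableType d) d' (T : measurableType d') (R : realType).
Variables (P : probability Omega R) (n : nat).

(** All indices occur at once; a subfamily is recovered by taking the whole space for the other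
    sets. *)
Definition box_independent (X : 'I_n -> Omega -> T) :=
  forall A : 'I_n -> set T, (forall i, measurable (A i)) ->
    P [set o | forall i, A i (X i o)] = \prod_(i < n) P (X i @^-1` A i).

Lemma measurable_forall_ord d0 (U : measurableType d0) m (B : 'I_m -> set U) :
  (forall i, measurable (B i)) -> measurable [set u | forall i, B i u].
Proof.
move=> mB; have -> : [set u | forall i, B i u] = \bigcap_(i in [set` finset.setT]) B i.
  by apply/seteqP; split => [u Bu i _|u Bu i]; [exact: Bu|apply: Bu; rewrite /= finset.in_setT].
by apply: fin_bigcap_measurable.
Qed.

(** Indicators are replaced by general functions one index at a time: the induction runs over a list
    containing every index whose function is not yet known to be an indicator, and the empty list is
    the definition of independence. *)
Lemma expectation_prod (X : 'I_n -> Omega -> T) (phi : 'I_n -> T -> R) :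
  (forall i, measurable_fun setT (X i)) -> box_independent X ->
  (forall i, measurable_fun setT (phi i)) -> (forall i x, (0 <= phi i x)%R) ->
  (forall i, \int[P]_o (phi i (X i o))%:E \is a fin_num) ->
  \int[P]_o (\prod_(i < n) phi i (X i o))%:E =
    \prod_(i < n) \int[P]_o (phi i (X i o))%:E.
Proof.
move=> mX iX.
suff main (s : seq 'I_n) : forall phi : 'I_n -> T -> R,
    (forall i, i \notin s -> exists2 A, measurable A & phi i = \1_A) ->
    (forall i, measurable_fun setT (phi i)) -> (forall i x, (0 <= phi i x)%R) ->
    (forall i, \int[P]_o (phi i (X i o))%:E \is a fin_num) ->
    \int[P]_o (\prod_(i < n) phi i (X i o))%:E =
    \prod_(i < n) \int[P]_o (phi i (X i o))%:E.
  by apply: (main (enum 'I_n)) => i; rewrite mem_enum.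
elim: s => [|j s ih] {}phi phis mphi phi0 phiE.
  have /choice[A HA] : forall i, exists A, measurable A /\ phi i = \1_A.
    by move=> i; have [//|A mA ?] := phis i; exists A.
  have mA i := (HA i).1; have phiA i := (HA i).2.
  transitivity (\int[P]_o (\1_[set o | forall i, A i (X i o)] o)%:E).
    apply: eq_integral => o _; congr EFin; rewrite indicE.
    under eq_bigr do rewrite phiA indicE.
    case: (boolP (o \in _)) => [/set_mem/= h|h].
      by rewrite big1// => i _; rewrite mem_set.
    have [i Ai] : exists i, ~ A i (X i o).
      by apply/not_existsP => h'; move/negP: h; apply; apply/mem_set => i; apply: contrapT => /h'.
    by rewrite (bigD1 i)//= memNset// mul0r.
  rewrite integral_indic//; last first.
    apply: (@measurable_forall_ord _ _ _ (fun i => X i @^-1` A i)) => i.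
    by rewrite -[X in measurable X]setTI; exact: (mX _).
  rewrite setIT; transitivity (\prod_(i < n) P (X i @^-1` A i)).
    exact: iX.
  apply: eq_bigr => i _; rewrite phiA.
  have mXA : measurable (X i @^-1` A i).
    by rewrite -[X in measurable X]setTI; exact: (mX _).
  by rewrite -[X i @^-1` A i in LHS]setIT -integral_indic.
pose W o := (\prod_(i < n | i != j) phi i (X i o))%R.
have mW : measurable_fun setT W.
  rewrite /W; under eq_fun do rewrite big_mkcond/=.
  apply: measurable_fun_prod_ord => i; case: (i != j) => //.
  exact: measurableT_comp.
have W0 o : (0 <= W o)%R by exact: prodr_ge0.
pose C : \bar R := \prod_(i < n | i != j) \int[P]_o (phi i (X i o))%:E.
have Cfin : C \is a fin_num by exact: prode_fin_num.
have C0 : 0 <= C.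
  by apply: prode_ge0 => i _; apply: integral_ge0 => o _; rewrite lee_fin.
have c0 : (0 <= fine C)%R by exact: fine_ge0.
have split_prod (f : T -> R) (o : Omega) : f = phi j ->
   (\prod_(i < n) phi i (X i o))%:E = (f (X j o))%:E * (W o)%:E.
  by move=> ->; rewrite (bigD1 j)//= EFinM.
have mc : measurable_fun [set: Omega] (cst (fine C)) by exact: measurable_cst.
(* [m1] is the law of [X j] weighted by the other factors, [m2] its law times the constant [C]. They
   agree on sets by the induction hypothesis, since there the factor of index [j] is an indicator;
   integrating [phi j] against both gives the claim. *)
pose m1 := image_measure (density_measure P mW W0) (mX j).
pose m2 := image_measure (density_measure P mc (fun=> c0)) (mX j).
have m12 A : measurable A -> m1 A = m2 A.
  move=> mA; rewrite /m1 /m2 !image_measureE /density_measure.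
  have mXA : measurable (X j @^-1` A).
    by rewrite -[X in measurable X]setTI; exact: (mX j).
  pose psi i := if i == j then \1_A : T -> R else phi i.
  have mpsi i : measurable_fun setT (psi i).
    by rewrite /psi; case: ifP => // _; exact: measurable_indic.
  have intA : \int[P]_o (\1_A (X j o))%:E = P (X j @^-1` A).
    transitivity (\int[P]_o (\1_(X j @^-1` A) o)%:E).
      by apply: eq_integral => o _.
    by rewrite integral_indic// setIT.
  transitivity (\int[P]_o (\prod_(i < n) psi i (X i o))%:E).
    rewrite [LHS]integral_mkcond; apply: eq_integral => o _.
    rewrite (bigD1 j)//= /psi eqxx indicE /patch.
    have -> : (\prod_(i < n | i != j)
        (if i == j then \1_A else phi i) (X i o))%R = W o.
      by apply: eq_bigr => i /negPf ->.
    have -> : (X j o \in A) = (o \in X j @^-1` A).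
      by apply/idP/idP => /set_mem h; apply/mem_set.
    by case: ifP => _; rewrite ?mul1r ?mul0r.
  rewrite ih//; first last.
  - move=> i; rewrite /psi; case: ifP => [/eqP->|//].
    by rewrite intA fin_num_measure.
  - by move=> i x; rewrite /psi; case: ifP => // _; rewrite indicE.
  - move=> i si; rewrite /psi; case: ifP => [_|ij]; first by exists A.
    by apply: phis; rewrite inE ij.
  rewrite [RHS](integral_cst P mXA (fine C)%:E).
  rewrite (bigD1 j)//= {1}/psi eqxx intA muleC; congr (_ * _).
  by rewrite fineK// /C; apply: eq_bigr => i /negPf ij; rewrite /psi ij.
have mphij : measurable_fun setT (fun x => (phi j x)%:E) by exact/measurable_EFinP.
have phij0 x : 0 <= (phi j x)%:E by rewrite lee_fin.
have mphijX : measurable_fun setT (fun o => (phi j (X j o))%:E).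
  exact: (measurableT_comp mphij (mX j)).
have : \int[m1]_x (phi j x)%:E = \int[m2]_x (phi j x)%:E.
  by apply: eq_measure_integral => A mA _; exact: m12.
rewrite !integral_image_measure// !integral_density_measure// => E.
under eq_integral do rewrite (split_prod (phi j))//.
rewrite E /= ge0_integralZr//.
by rewrite [RHS](bigD1 j)//= fineK.
Qed.

Lemma measurable_box (A : 'I_n -> set T) : (forall i, measurable (A i)) ->
  measurable [set t : n.-tuple T | forall i, A i (tnth t i)].
Proof.
move=> mA.
apply: (@measurable_forall_ord _ _ _ (fun i => (fun t => tnth t i) @^-1` A i)) => i.
by rewrite -[X in measurable X]setTI; exact: measurable_tnth.
Qed.

(** Rectangles are stable under intersection and generate the product sigma-algebra, and the total
    mass is finite. *)
Lemma measure_tuple_unique (m1 m2 : {measure set (n.-tuple T) -> \bar R}) :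
  m1 setT < +oo ->
  (forall A : 'I_n -> set T, (forall i, measurable (A i)) ->
    m1 [set t | forall i, A i (tnth t i)] =
    m2 [set t | forall i, A i (tnth t i)]) ->
  forall B, measurable B -> m1 B = m2 B.
Proof.
move=> m1T m12.
pose G : set (set (n.-tuple T)) := [set B | exists2 A : 'I_n -> set T,
  (forall i, measurable (A i)) & B = [set t | forall i, A i (tnth t i)]].
have GT : G setT.
  exists (fun=> setT); first by move=> ?.
  by apply/seteqP; split.
apply: (measure_unique G (fun=> setT)) => //.
- apply/seteqP; split.
  + apply: smallest_sub; first exact: smallest_sigma_algebra.
    move=> B; rewrite -bigcup_seq/= => -[i _] [C mC <-].
    apply: sub_sigma_algebra.
    exists (fun k => if k == i then C else setT).
      by move=> k; case: ifP.
    apply/seteqP; split=> t /=; first by move=> [_ Ct] k; case: eqP => // ->.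
    by move=> /(_ i); rewrite eqxx.
  + apply: smallest_sub; first exact: sigma_algebra_measurable.
    by move=> B [A mA ->]; exact: measurable_box.
- move=> _ _ [A mA ->] [B mB ->]; exists (fun i => A i `&` B i).
    by move=> i; exact: measurableI.
  by apply/seteqP; split=> t /=; [move=> [a b] i; split; [exact: a|exact: b]
    |move=> ab; split=> i; have [] := ab i].
- by rewrite bigcup_const.
- by move=> _ [A mA ->]; exact: m12.
Qed.

(** If each [Y i] has density [r i] with respect to the law of [X i], independence gives the tuple
    of the [Y i] the product density. On rectangles this is [expectation_prod], and rectangles
    determine the law. *)
Lemma integral_reweight (X Y : 'I_n -> Omega -> T) (r : 'I_n -> T -> R)
    (G : n.-tuple T -> \bar R) :
  (forall i, measurable_fun setT (X i)) -> box_independent X ->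
  (forall i, measurable_fun setT (Y i)) -> box_independent Y ->
  (forall i, measurable_fun setT (r i)) -> (forall i x, (0 <= r i x)%R) ->
  (forall i A, measurable A ->
    P (Y i @^-1` A) = \int[P]_o (\1_A (X i o) * r i (X i o))%:E) ->
  measurable_fun setT G -> (forall t, 0 <= G t) ->
  \int[P]_o G [tuple Y i o | i < n] =
  \int[P]_o (G [tuple X i o | i < n] * (\prod_(i < n) r i (X i o))%:E).
Proof.
move=> mX iX mY iY mr r0 YX mG G0.
have mXt : measurable_fun setT (fun o => [tuple X i o | i < n]).
  apply/measurable_fun_tnthP => i.
  by rewrite [X in measurable_fun _ X](_ : _ = X i)//; apply/funext => o /=;
    rewrite tnth_mktuple.
have mYt : measurable_fun setT (fun o => [tuple Y i o | i < n]).
  apply/measurable_fun_tnthP => i.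
  by rewrite [X in measurable_fun _ X](_ : _ = Y i)//; apply/funext => o /=;
    rewrite tnth_mktuple.
pose W o := (\prod_(i < n) r i (X i o))%R.
have mW : measurable_fun setT W.
  by apply: measurable_fun_prod_ord => i; exact: (measurableT_comp (mr i) (mX i)).
have W0 o : (0 <= W o)%R by exact: prodr_ge0.
pose m1 := image_measure P mYt.
pose m2 := image_measure (density_measure P mW W0) mXt.
have : \int[m1]_x G x = \int[m2]_x G x.
  apply: eq_measure_integral => B mB _; apply: measure_tuple_unique => //.
    apply: (@le_lt_trans _ _ 1%:E); last exact: ltry.
    by rewrite /m1 image_measureE preimage_setT; exact: (probability_le1 P).
  move=> A mA; rewrite /m1 /m2 !image_measureE /density_measure.
  transitivity (P [set o | forall i, A i (Y i o)]).
    by congr (P _); apply/seteqP; split => o /= h i; have := h i; rewrite tnth_mktuple.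
  rewrite iY//.
  under eq_bigr do rewrite YX//.
  rewrite -(@expectation_prod X (fun i x => \1_(A i) x * r i x)%R)//; first last.
  - by move=> i; rewrite -YX// fin_num_measure// -[X in measurable X]setTI; exact: (mY i).
  - by move=> i x; rewrite mulr_ge0// indicE.
  - by move=> i; apply: measurable_funM => //; exact: measurable_indic.
  rewrite [RHS]integral_mkcond; apply: eq_integral => o _.
  rewrite big_split/= EFinM -/(W o) /patch.
  case: ifPn => [/set_mem/= h|h].
    rewrite big1 ?mul1e// => i _; rewrite indicE mem_set//.
    by have := h i; rewrite tnth_mktuple.
  have [i Ai] : exists i, ~ A i (X i o).
    apply/not_existsP => h'; move/negP: h; apply; apply/mem_set => i.
    by rewrite tnth_mktuple; apply: contrapT => /h'.
  by rewrite (bigD1 i)//= indicE memNset// !mul0r mul0e.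
rewrite !integral_image_measure//.
by rewrite integral_density_measure//; exact: (measurableT_comp mG mXt).
Qed.

End independence.

(** * The normal model under the group action *)

Section gaussian.
Local Open Scope ereal_scope.
Context (R : realType).
Implicit Types (w : param R) (z x : obs R).

Lemma density_gt0 w x : param_space w -> (0 < density w x)%R.
Proof.
by move=> [t0 _]; rewrite mulr_gt0 ?expR_gt0// invr_gt0 !mulr_gt0// pi_gt0.
Qed.

(** The exponent is invariant because [act w] scales the two residuals by [scl1 w] and [scl2 w]; the
    factor theta is the Jacobian of [act w]. *)
Lemma density_act w z : param_space w ->
  density (onep R) z = (par_theta w * density w (act w z))%R.
Proof.
move=> w0; have [t0 e0] := w0.
have t1 : par_theta w != 0%R by rewrite gt_eqF.
have e1 : par_eta w != 0%R by rewrite gt_eqF.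
rewrite /density /act /= /par_mu1 /par_mu2 /par_beta /par_theta /par_eta /=.
rewrite -/(par_mu1 w) -/(par_mu2 w) -/(par_beta w) -/(par_theta w) -/(par_eta w).
rewrite [RHS]mulrA; congr (_ * _)%R.
  have p0 : (pi : R) != 0%R by rewrite gt_eqF// pi_gt0.
  by move: (par_theta w) (pi : R) t1 p0 => t p tn pn; field; rewrite tn pn.
congr expR; congr (_ * _)%R.
have -> : (scl2 w * z.2 + (par_beta w * scl1 w * z.1 + par_mu2 w) - par_mu2 w -
   par_beta w * (scl1 w * z.1 + par_mu1 w - par_mu1 w) = scl2 w * z.2)%R.
  by move: (scl1 w) (scl2 w) (par_beta w) (par_mu1 w) (par_mu2 w) z.1 z.2 => *; ring.
rewrite addrK !exprMn sqr_scl1// sqr_scl2//.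
by move: (par_theta w) (par_eta w) z.1 z.2 t1 e1 => t e a b t1 e1; field; rewrite e1 t1.
Qed.

Lemma integral_act_density w (F : obs R -> \bar R) : param_space w ->
  measurable_fun setT F -> (forall x, 0 <= F x) ->
  \int[leb2 R]_z (F (act w z) * (density (onep R) z)%:E) =
  \int[leb2 R]_x (F x * (density w x)%:E).
Proof.
move=> w0 mF F0.
have [mact H] := scales_act w0.
have md v : measurable_fun setT (fun x : obs R => (density v x)%:E).
  by apply/measurable_EFinP; apply: measurable_density; mfun.
rewrite -[RHS]H; last 2 first.
- exact: emeasurable_funM.
- by move=> x; rewrite mule_ge0// lee_fin ltW// density_gt0.
rewrite -ge0_integralZl//; last 3 first.
- apply: emeasurable_funM; first exact: (measurableT_comp mF mact).
  exact: (measurableT_comp (md w) mact).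
- by move=> x _; rewrite mule_ge0// lee_fin ltW// density_gt0.
- by rewrite lee_fin ltW//; case: w0.
apply: eq_integral => z _.
by rewrite (density_act z w0) EFinM !muleA; congr (_ * _); rewrite muleC.
Qed.

Definition actV w x : obs R :=
  ((x.1 - par_mu1 w) / scl1 w,
   (x.2 - par_mu2 w - par_beta w * (x.1 - par_mu1 w)) / scl2 w)%R.

Lemma actK w : param_space w -> cancel (act w) (actV w).
Proof.
move=> w0 [z1 z2]; rewrite /act /actV /=.
have s1 : scl1 w != 0%R by rewrite gt_eqF// scl1_gt0.
have s2 : scl2 w != 0%R by rewrite gt_eqF// scl2_gt0.
by congr pair; move: (scl1 w) (scl2 w) (par_beta w) (par_mu1 w) (par_mu2 w) s1 s2 => a b c m1 m2 s1 s2; field; rewrite ?s1 ?s2.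
Qed.

Lemma actVK w : param_space w -> cancel (actV w) (act w).
Proof.
move=> w0 [z1 z2]; rewrite /act /actV /=.
have s1 : scl1 w != 0%R by rewrite gt_eqF// scl1_gt0.
have s2 : scl2 w != 0%R by rewrite gt_eqF// scl2_gt0.
by congr pair; move: (scl1 w) (scl2 w) (par_beta w) (par_mu1 w) (par_mu2 w) s1 s2 => a b c m1 m2 s1 s2; field; rewrite ?s1 ?s2.
Qed.

Lemma measurable_actV w : measurable_fun setT (actV w).
Proof.
have m1 : measurable_fun setT (fun t : obs R => t.1) by exact: measurable_fst.
have m2 : measurable_fun setT (fun t : obs R => t.2) by exact: measurable_snd.
by rewrite /actV; mfun.
Qed.

Lemma integral_indicM d (T : measurableType d) (m : {measure set T -> \bar R})
    (A : set T) (f : T -> R) :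
  \int[m]_(x in A) (f x)%:E = \int[m]_x ((\1_A x)%:E * (f x)%:E).
Proof.
rewrite integral_mkcond; apply: eq_integral => x _.
by rewrite /patch indicE; case: ifP; rewrite ?mul1e ?mul0e.
Qed.

Lemma density1E (z : obs R) :
  density (onep R) z = (normal_pdf 0 1 z.1 * normal_pdf 0 1 z.2)%R.
Proof.
rewrite /normal_pdf oner_eq0 /normal_peak /normal_fun.
rewrite mulrACA -expRD -invfM -expr2 sqr_sqrtr; last first.
  by rewrite expr1n mul1r mulrn_wge0// pi_ge0.
rewrite /density /par_mu1 /par_mu2 /par_beta /par_theta /par_eta /=.
congr (_^-1 * expR _)%R; first by rewrite expr1n; ring.
by rewrite expr1n; field.
Qed.

Lemma integral_density1 : \int[leb2 R]_z (density (onep R) z)%:E = 1.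
Proof.
have md : measurable_fun setT (fun x : obs R => (density (onep R) x)%:E).
  by apply/measurable_EFinP; apply: measurable_density; mfun.
rewrite /leb2 /product_sfm fubini_tonelli1//; last first.
  by move=> x; rewrite lee_fin ltW// density_gt0//; exact: param_space1.
have mn : measurable_fun setT (fun x : measurableTypeR R => (normal_pdf 0 1 x)%:E).
  by apply/measurable_EFinP; exact: measurable_normal_pdf.
have n0 (x : R) : 0 <= (normal_pdf 0 1 x : R)%:E by rewrite lee_fin normal_pdf_ge0.
rewrite /fubini_F.
under eq_integral => x _.
  under eq_integral do rewrite density1E/= EFinM.
  rewrite ge0_integralZl// integral_normal_pdf mule1.
  over.
exact: integral_normal_pdf.
Qed.

Definition std_law : set (obs R) -> \bar R :=
  fun A => \int[leb2 R]_(z in A) (density (onep R) z)%:E.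

Let md1 : measurable_fun setT (density (onep R)).
Proof. by apply: measurable_density; mfun. Qed.

Let d10 z : (0 <= density (onep R) z)%R.
Proof. by rewrite ltW// density_gt0//; exact: param_space1. Qed.

HB.instance Definition _ := Measure.copy std_law (density_measure (leb2 R) md1 d10).

Let std_lawT : std_law setT = 1.
Proof. exact: integral_density1. Qed.

HB.instance Definition _ := Measure_isProbability.Build _ _ _ std_law std_lawT.

(** A sample at the identity of the group. It arises in two ways: [iid_sample_std] pulls a sample at
    [w] back by [actV w], and [std_sample_exists] builds one when only data are given. *)
Record std_sample d (Omega : measurableType d) (P : probability Omega R) n
    (Z : 'I_n -> Omega -> obs R) : Prop := StdSample {
  std_measurable : forall i, measurable_fun setT (Z i);
  std_lawE : forall i A, measurable A -> P (Z i @^-1` A) = std_law A;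
  std_indep : box_independent P Z }.

(** Induction on the size: the product with one more copy of [std_law] carries the new observation,
    at index [ord0], while [unlift] sends the other indices to the old sample. For the empty family
    any probability space will do. *)
Lemma std_sample_exists n : exists d (Omega : measurableType d)
  (P : probability Omega R) (Z : 'I_n -> Omega -> obs R), std_sample P Z.
Proof.
elim: n => [|n ih].
  exists _, (obs R), std_law, (fun i => fun o => o); split.
  - by case.
  - by case.
  - move=> A mA; rewrite big_ord0 -[RHS]std_lawT; congr (std_law _).
    by apply/seteqP; split => // o _ [].
case: ih => d; case=> Omega; case=> P; case=> Z ZP.
have [mZ lZ iZ] := ZP.
pose Q : probability (Omega * obs R)%type R := (P \x std_law).
have mbox A : (forall i, measurable (A i)) ->
    measurable [set o | forall i, A i (Z i o)].
  move=> mA; apply: (@measurable_forall_ord _ _ _ (fun i => Z i @^-1` A i)) => i.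
  by rewrite -[X in measurable X]setTI; exact: (mZ i).
pose Y (i : 'I_n.+1) (o : Omega * obs R) : obs R :=
  if unlift ord0 i is Some j then Z j o.1 else o.2.
have Y0 : Y ord0 = snd by apply/funext => o; rewrite /Y unlift_none.
have YS j : Y (lift ord0 j) = Z j \o fst by apply/funext => o; rewrite /Y liftK.
have mZA i A : measurable A -> measurable (Z i @^-1` A).
  by move=> mA; rewrite -[X in measurable X]setTI; exact: (mZ i).
have lY i A : measurable A -> Q (Y i @^-1` A) = std_law A.
  move=> mA; case: (unliftP ord0 i) => [j ->|->].
    rewrite YS -(lZ j)//.
    have -> : (Z j \o fst) @^-1` A = (Z j @^-1` A) `*` [set: obs R].
      by apply/seteqP; split => [[u x]|[u x] []].
    rewrite /Q /= product_measure1E//; last exact: mZA.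
    by rewrite [X in _ * X](_ : _ = 1) ?mule1//; exact: std_lawT.
  rewrite Y0; have -> : snd @^-1` A = [set: Omega] `*` A.
    by apply/seteqP; split => [[u x]|[u x] []].
  rewrite /Q /= product_measure1E//.
  by rewrite [X in X * _](_ : _ = 1) ?mul1e//; exact: (probability_setT P).
exists _, (Omega * obs R)%type, Q, Y; split => //.
- move=> i; case: (unliftP ord0 i) => [j ->|->]; last by rewrite Y0.
  by rewrite YS; exact: measurableT_comp.
- move=> A mA; under eq_bigr do rewrite lY//.
  have -> : [set o | forall i, A i (Y i o)] =
      [set o | forall i, A (lift ord0 i) (Z i o)] `*` A ord0.
    apply/seteqP; split => [[u x] /= h|[u x] /= [h1 h2] i].
      by split; [move=> i; have := h (lift ord0 i); rewrite YS|have := h ord0; rewrite Y0].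
    by case: (unliftP ord0 i) => [j ->|->]; [rewrite YS; exact: h1|rewrite Y0].
  rewrite /Q /= product_measure1E//; last exact: (mbox (fun i => A (lift ord0 i))).
  rewrite big_ord_recl muleC; congr (_ * _).
  rewrite [LHS](iZ (fun i => A (lift ord0 i)) (fun i => mA _)).
  by apply: eq_bigr => i _; rewrite lZ.
Qed.

Lemma act_law d (Omega : measurableType d) (P : probability Omega R) n
    (Z : 'I_n -> Omega -> obs R) w i A : std_sample P Z -> param_space w ->
  measurable A ->
  P ((fun o => act w (Z i o)) @^-1` A) = \int[leb2 R]_(x in A) (density w x)%:E.
Proof.
move=> [mZ lZ iZ] w0 mA.
have mact : measurable_fun setT (act w) by apply: measurable_act; mfun.
have mAw : measurable (act w @^-1` A).
  by rewrite -[X in measurable X]setTI; exact: mact.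
transitivity (std_law (act w @^-1` A)); first exact: (lZ i _ mAw).
rewrite [LHS](integral_indicM (leb2 R)) [RHS](integral_indicM (leb2 R)).
rewrite -(@integral_act_density w (fun x => (\1_A x)%:E))//.
exact/measurable_EFinP/measurable_indic.
Qed.

Lemma box_independent_act d (Omega : measurableType d) (P : probability Omega R)
    n (X : 'I_n -> Omega -> obs R) (f : 'I_n -> obs R -> obs R) :
  (forall i, measurable_fun setT (f i)) -> box_independent P X ->
  box_independent P (fun i o => f i (X i o)).
Proof.
move=> mf iX A mA.
apply: (iX (fun i => f i @^-1` A i)) => i.
by rewrite -[X in measurable X]setTI; exact: mf.
Qed.

Lemma iid_sample_std w d (Omega : measurableType d) (P : probability Omega R) n
    (X : 'I_n -> Omega -> obs R) : param_space w -> iid_sample w P X ->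
  std_sample P (fun i o => actV w (X i o)).
Proof.
move=> w0 [mX lX iX]; split.
- by move=> i; apply: measurableT_comp => //; exact: measurable_actV.
- move=> i A mA.
  have mAw : measurable (actV w @^-1` A).
    by rewrite -[X in measurable X]setTI; exact: measurable_actV.
  transitivity (\int[leb2 R]_(x in actV w @^-1` A) (density w x)%:E).
    exact: (lX i _ mAw).
  rewrite [LHS](integral_indicM (leb2 R)) [RHS](integral_indicM (leb2 R)).
  rewrite -(@integral_act_density w (fun x => (\1_(actV w @^-1` A) x)%:E))//.
    apply: eq_integral => z _; congr (_ * _); congr EFin; rewrite !indicE.
    by congr (nat_of_bool _)%:R; apply/idP/idP => /set_mem h; apply/mem_set; move: h; rewrite /= actK.
  exact/measurable_EFinP/measurable_indic.
- apply: (@box_independent_act _ _ _ _ _ (fun=> actV w)).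
    by move=> i; exact: measurable_actV.
  move=> A mA; have := iX finset.setT A mA.
  have -> : \bigcap_(i in [set` finset.setT]) (X i @^-1` A i) =
      [set o | forall i, A i (X i o)].
    by apply/seteqP; split => [u Bu i|u Bu i _]; [apply: Bu; rewrite /= finset.in_setT|exact: Bu].
  by move=> ->; apply: eq_bigl => i; rewrite finset.in_setT.
Qed.

End gaussian.

(** * Sufficient statistics and likelihood ratios *)

Section statistics.
Context (R : realType) (n : nat).
Implicit Types (x : 'I_n -> obs R) (w s g : param R).

Definition mean1 x : R := (\sum_(i < n) (x i).1) / n%:R.
Definition mean2 x : R := (\sum_(i < n) (x i).2) / n%:R.
Definition dev1 x i : R := (x i).1 - mean1 x.
Definition dev2 x i : R := (x i).2 - mean2 x.
Definition ss11 x : R := \sum_(i < n) dev1 x i ^+ 2.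
Definition slope x : R := (\sum_(i < n) dev1 x i * dev2 x i) / ss11 x.
Definition resid x i : R := dev2 x i - slope x * dev1 x i.
Definition rss x : R := \sum_(i < n) resid x i ^+ 2.

(** The first coordinates are not all equal and the points are not on one line. By [is_mle_mle] and
    [nondegenerate_of_mle] this is exactly the existence of a maximum likelihood estimator. *)
Definition nondegenerate x : Prop := 0 < ss11 x /\ 0 < rss x.

(** The last two components solve theta eta = rss / n and theta / eta = ss11 / n, the residual
    variance and the variance of the first coordinate. *)
Definition mle x : param R :=
  (mean1 x, mean2 x, slope x, Num.sqrt (ss11 x * rss x) / n%:R,
   Num.sqrt (rss x / ss11 x)).

Hypothesis n0 : (0 < n)%N.

Let nR : (n%:R : R) != 0. Proof. by rewrite pnatr_eq0 -lt0n. Qed.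

Lemma sum_dev1 x : \sum_(i < n) dev1 x i = 0.
Proof.
rewrite sumrB sumr_const card_ord -[mean1 x *+ n]mulr_natr /mean1 divfK//.
exact: subrr.
Qed.

Lemma sum_dev2 x : \sum_(i < n) dev2 x i = 0.
Proof.
rewrite sumrB sumr_const card_ord -[mean2 x *+ n]mulr_natr /mean2 divfK//.
exact: subrr.
Qed.

Lemma sum_resid x : \sum_(i < n) resid x i = 0.
Proof. by rewrite sumrB -mulr_sumr sum_dev1 sum_dev2 mulr0 subr0. Qed.

Lemma sum_resid_dev1 x : ss11 x != 0 -> \sum_(i < n) resid x i * dev1 x i = 0.
Proof.
move=> s0; under eq_bigr do rewrite /resid mulrBl -mulrA -expr2.
rewrite sumrB -mulr_sumr -/(ss11 x) /slope divfK//.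
by under eq_bigr do rewrite mulrC; rewrite subrr.
Qed.

(** Pythagoras for [v], [u] and the constant vector, which are pairwise orthogonal. *)
Lemma sum_sqr_orthogonal (u v : 'I_n -> R) (k c : R) :
  \sum_(i < n) u i = 0 -> \sum_(i < n) v i = 0 -> \sum_(i < n) v i * u i = 0 ->
  \sum_(i < n) (v i + k * u i + c) ^+ 2 =
    \sum_(i < n) v i ^+ 2 + k ^+ 2 * \sum_(i < n) u i ^+ 2 + n%:R * c ^+ 2.
Proof.
move=> su sv svu.
transitivity (\sum_(i < n) (v i ^+ 2 + k ^+ 2 * u i ^+ 2 + c ^+ 2 +
    2 * k * (v i * u i) + 2 * c * v i + 2 * k * c * u i)).
  by apply: eq_bigr => i _; ring.
rewrite !big_split/= sumr_const card_ord -[c ^+ 2 *+ n]mulr_natr -!mulr_sumr su sv svu.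
by ring.
Qed.

(** By the normal equations, the least squares residuals are orthogonal to the constants and to the
    deviations of the first coordinate. *)
Lemma sum_sqr_resid x (m1 m2 b : R) : ss11 x != 0 ->
  \sum_(i < n) ((x i).2 - m2 - b * ((x i).1 - m1)) ^+ 2 =
  rss x + ss11 x * (b - slope x) ^+ 2 +
    n%:R * (mean2 x - m2 - b * (mean1 x - m1)) ^+ 2.
Proof.
move=> s0.
transitivity (\sum_(i < n) (resid x i + (slope x - b) * dev1 x i +
    (mean2 x - m2 - b * (mean1 x - m1))) ^+ 2).
  apply: eq_bigr => i _; congr (_ ^+ 2); rewrite /resid /dev2 /dev1.
  by move: (slope x) (mean1 x) (mean2 x) (x i).1 (x i).2 => *; ring.
rewrite sum_sqr_orthogonal ?sum_dev1 ?sum_resid ?sum_resid_dev1//.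
by rewrite -/(rss x) -/(ss11 x); ring.
Qed.

Lemma sum_sqr_dev1 x (m1 : R) :
  \sum_(i < n) ((x i).1 - m1) ^+ 2 = ss11 x + n%:R * (mean1 x - m1) ^+ 2.
Proof.
transitivity (\sum_(i < n) (dev1 x i + 0 * 0 + (mean1 x - m1)) ^+ 2).
  apply: eq_bigr => i _; congr (_ ^+ 2); rewrite /dev1.
  by move: (mean1 x) (x i).1 => *; ring.
rewrite (@sum_sqr_orthogonal (fun=> 0) (dev1 x)) ?sum_dev1//.
- by rewrite -/(ss11 x) big1 ?mulr0 ?addr0// => i _; rewrite expr0n.
- by rewrite big1.
- by rewrite big1// => i _; rewrite mulr0.
Qed.

(* Minus twice the exponent of the likelihood, per observation, when the sample
   has maximum likelihood estimate [s]. *)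
Definition deviance s w : R :=
  ((par_mu2 s - par_mu2 w - par_beta w * (par_mu1 s - par_mu1 w)) ^+ 2 +
   par_theta s * par_eta s +
   par_theta s / par_eta s * (par_beta w - par_beta s) ^+ 2) /
    (par_theta w * par_eta w) +
  par_eta w * ((par_mu1 s - par_mu1 w) ^+ 2 + par_theta s / par_eta s) /
    par_theta w.

Definition suff_likelihood s w : R :=
  (2 * pi * par_theta w)^-1 ^+ n * expR (- (n%:R / 2 * deviance s w)).

Lemma param_space_mle x : nondegenerate x -> param_space (mle x).
Proof.
move=> [s0 r0]; split; rewrite /mle/=.
  by rewrite divr_gt0 ?sqrtr_gt0 ?mulr_gt0// ltr0n.
by rewrite sqrtr_gt0 divr_gt0.
Qed.

Lemma mle_thetaM_eta x : nondegenerate x ->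
  par_theta (mle x) * par_eta (mle x) = rss x / n%:R.
Proof.
move=> [s0 r0]; rewrite /par_theta /par_eta /=.
rewrite mulrAC -sqrtrM ?mulr_ge0 ?ltW//.
have -> : ss11 x * rss x * (rss x / ss11 x) = rss x ^+ 2.
  by field; rewrite gt_eqF.
by rewrite sqrtr_sqr ger0_norm// ltW.
Qed.

Lemma mle_theta_div_eta x : nondegenerate x ->
  par_theta (mle x) / par_eta (mle x) = ss11 x / n%:R.
Proof.
move=> nx; have [s0 r0] := nx.
have [t0 e0] := param_space_mle nx.
apply: (mulIf (lt0r_neq0 e0)); rewrite divfK ?gt_eqF//.
rewrite /par_theta /par_eta /= [RHS]mulrAC; congr (_ / _).
rewrite -[X in _ = X * _](ger0_norm (ltW s0)) -sqrtr_sqr -[RHS]sqrtrM ?sqr_ge0//.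
by congr Num.sqrt; field; rewrite gt_eqF.
Qed.

Lemma likelihoodE x w : nondegenerate x -> 
  likelihood x w = suff_likelihood (mle x) w.
Proof.
move=> nx; have [s0 r0] := nx.
rewrite /likelihood /density big_split/= prodr_const card_ord -expR_sum.
congr (_ * expR _).
rewrite -mulr_sumr big_split/= -mulr_suml.
under [X in _ + X]eq_bigr do rewrite mulrAC.
rewrite -mulr_sumr sum_sqr_resid ?gt_eqF// sum_sqr_dev1.
rewrite /deviance mle_thetaM_eta// mle_theta_div_eta//.
rewrite -/(par_mu1 (mle x)).
have -> : par_mu1 (mle x) = mean1 x by [].
have -> : par_mu2 (mle x) = mean2 x by [].
have -> : par_beta (mle x) = slope x by [].
move: (par_theta w) (par_eta w) (par_beta w) (par_mu1 w) (par_mu2 w) => t e b m1 m2.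
(* [w] is arbitrary, so [t] and [e] may vanish; naming the inverses keeps [field] from asking that
   they be nonzero. *)
set i1 := (t * e)^-1; set i2 := t^-1.
move: i1 i2 (mean1 x) (mean2 x) (slope x) (ss11 x) (rss x) => i1 i2 a1 a2 a3 a4 a5.
by field.
Qed.

End statistics.

(** * Equivariance of the estimator and transformation of the likelihood *)

Section equivariance.
Context (R : realType) (n : nat).
Implicit Types (x : 'I_n -> obs R) (w s g : param R).
Hypothesis n0 : (0 < n)%N.

Let nR : (n%:R : R) != 0. Proof. by rewrite pnatr_eq0 -lt0n. Qed.

Lemma mean1_act g x :
  mean1 (fun i => act g (x i)) = scl1 g * mean1 x + par_mu1 g.
Proof.
rewrite /mean1 /act /= big_split/= sumr_const card_ord -[_ *+ n]mulr_natr -mulr_sumr.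
by rewrite mulrDl mulfK// mulrA.
Qed.

Lemma mean2_act g x : mean2 (fun i => act g (x i)) =
  scl2 g * mean2 x + (par_beta g * scl1 g * mean1 x + par_mu2 g).
Proof.
rewrite /mean2 /mean1 /act /= !big_split/= sumr_const card_ord -[_ *+ n]mulr_natr -!mulr_sumr.
by rewrite !mulrDl mulfK// !mulrA.
Qed.

Lemma dev1_act g x i : dev1 (fun i => act g (x i)) i = scl1 g * dev1 x i.
Proof. by rewrite /dev1 mean1_act /act /= mulrBr opprD addrACA subrr addr0. Qed.

Lemma dev2_act g x i : dev2 (fun i => act g (x i)) i =
  scl2 g * dev2 x i + par_beta g * scl1 g * dev1 x i.
Proof.
rewrite /dev2 /dev1 mean2_act /act /=.
by move: (scl1 g) (scl2 g) (par_beta g) (par_mu2 g) (mean1 x) (mean2 x)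
   (x i).1 (x i).2 => *; ring.
Qed.

Lemma ss11_act g x : ss11 (fun i => act g (x i)) = scl1 g ^+ 2 * ss11 x.
Proof.
rewrite /ss11 mulr_sumr; apply: eq_bigr => i _.
by rewrite dev1_act exprMn.
Qed.

Lemma slope_act g x : param_space g -> ss11 x != 0 ->
  slope (fun i => act g (x i)) = par_eta g * slope x + par_beta g.
Proof.
move=> g0 s0; have a0 : scl1 g != 0 by rewrite gt_eqF// scl1_gt0.
rewrite /slope ss11_act.
under eq_bigr do rewrite dev1_act dev2_act.
transitivity ((scl1 g * scl2 g * (\sum_(i < n) dev1 x i * dev2 x i) +
  par_beta g * scl1 g ^+ 2 * ss11 x) / (scl1 g ^+ 2 * ss11 x)).
  congr (_ / _); rewrite mulr_sumr /ss11 mulr_sumr -big_split/=.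
  apply: eq_bigr => i _; ring.
rewrite scl2E//.
move: (ss11 x) s0 (scl1 g) a0 (par_eta g) (par_beta g) (\sum_i _) => t t0 a a0 e b u.
by field; rewrite t0 a0.
Qed.

Lemma resid_act g x i : param_space g -> ss11 x != 0 ->
  resid (fun i => act g (x i)) i = scl2 g * resid x i.
Proof.
move=> g0 s0; rewrite /resid slope_act// dev1_act dev2_act scl2E//.
by move: (scl1 g) (par_eta g) (par_beta g) (slope x) (dev1 x i) (dev2 x i) => *; ring.
Qed.

Lemma rss_act g x : param_space g -> ss11 x != 0 ->
  rss (fun i => act g (x i)) = scl2 g ^+ 2 * rss x.
Proof.
move=> g0 s0; rewrite /rss mulr_sumr; apply: eq_bigr => i _.
by rewrite resid_act// exprMn.
Qed.

Lemma nondegenerate_act g x : param_space g ->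
  nondegenerate (fun i => act g (x i)) <-> nondegenerate x.
Proof.
move=> g0; have a0 := scl1_gt0 g0; have d0 := scl2_gt0 g0.
rewrite /nondegenerate ss11_act pmulr_rgt0 ?exprn_gt0//.
by split => -[s0]; rewrite rss_act ?gt_eqF// pmulr_rgt0 ?exprn_gt0.
Qed.

(** The sums of squares [ss11] and [rss] pick up the squares of [scl1 g] and [scl2 g]; the product
    of these scales is [par_theta g] and their ratio [scl2 g / scl1 g] is [par_eta g], which is the
    rule for the last two components. *)
Lemma mle_act g x : param_space g -> nondegenerate x ->
  mle (fun i => act g (x i)) = mulp g (mle x).
Proof.
move=> g0 nx; have [s0 r0] := nx.
have a0 := scl1_gt0 g0; have d0 := scl2_gt0 g0.
rewrite /mle mean1_act mean2_act slope_act ?gt_eqF// ss11_act rss_act ?gt_eqF//.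
rewrite /mulp; do ! congr pair.
- rewrite -(scl1M2 g0) {1}/par_theta/= [RHS]mulrA; congr (_ / _).
  rewrite mulrACA -exprMn sqrtrM ?sqr_ge0// sqrtr_sqr ger0_norm//.
  by rewrite mulr_ge0 ?ltW.
- rewrite {2}/par_eta/=.
  have -> : scl2 g ^+ 2 * rss x / (scl1 g ^+ 2 * ss11 x) =
      par_eta g ^+ 2 * (rss x / ss11 x).
    rewrite scl2E//; move: (rss x) (ss11 x) s0 (scl1 g) a0 (par_eta g) => r t t0 a a1 e.
    by field; rewrite !gt_eqF.
  by rewrite sqrtrM ?sqr_ge0// sqrtr_sqr ger0_norm// ltW//; case: g0.
Qed.

(** Each squared difference is multiplied by the same factor as its denominator: the deviance
    depends only on the relative position of [s] and [w] in the group. *)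
Lemma deviance_mulp g s w : param_space g -> param_space s -> param_space w ->
  deviance (mulp g s) (mulp g w) = deviance s w.
Proof.
move=> g0 [st0 se0] [wt0 we0].
rewrite /deviance.
have m1E v : par_mu1 (mulp g v) = scl1 g * par_mu1 v + par_mu1 g by [].
have m2E v : par_mu2 (mulp g v) =
  scl2 g * par_mu2 v + (par_beta g * scl1 g * par_mu1 v + par_mu2 g) by [].
have bE v : par_beta (mulp g v) = par_eta g * par_beta v + par_beta g by [].
have -> : par_mu2 (mulp g s) - par_mu2 (mulp g w) -
    par_beta (mulp g w) * (par_mu1 (mulp g s) - par_mu1 (mulp g w)) =
    scl2 g * (par_mu2 s - par_mu2 w - par_beta w * (par_mu1 s - par_mu1 w)).
  rewrite !m1E !m2E bE scl2E//.
  by move: (scl1 g) (par_eta g) (par_beta g) (par_mu1 g) (par_mu2 g)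
    (par_beta w) (par_mu1 w) (par_mu2 w) (par_mu1 s) (par_mu2 s) => *; ring.
have -> : par_mu1 (mulp g s) - par_mu1 (mulp g w) =
    scl1 g * (par_mu1 s - par_mu1 w).
  rewrite !m1E.
  by move: (scl1 g) (par_mu1 g) (par_mu1 w) (par_mu1 s) => *; ring.
have -> : par_beta (mulp g w) - par_beta (mulp g s) =
    par_eta g * (par_beta w - par_beta s).
  rewrite !bE.
  by move: (par_eta g) (par_beta g) (par_beta s) (par_beta w) => *; ring.
have tE v : par_theta (mulp g v) = par_theta g * par_theta v by [].
have eE v : par_eta (mulp g v) = par_eta g * par_eta v by [].
rewrite !tE !eE !exprMn sqr_scl1// sqr_scl2//.
case: g0 => gt0 ge0.
move: (par_mu2 s - par_mu2 w - par_beta w * (par_mu1 s - par_mu1 w)) => u.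
move: (par_mu1 s - par_mu1 w) (par_beta w - par_beta s) => v b.
move: (par_theta g) (par_eta g) (par_theta s) (par_eta s) (par_theta w) (par_eta w)
  gt0 ge0 st0 se0 wt0 we0 => t e t1 e1 t2 e2 *.
by field; rewrite !gt_eqF.
Qed.

(** Only the normalizing constant changes, by the inverse Jacobian of [act g] on [n]
    observations. *)
Lemma suff_likelihood_mulp g s w : param_space g -> param_space s -> param_space w ->
  suff_likelihood n (mulp g s) (mulp g w) =
  (par_theta g)^-1 ^+ n * suff_likelihood n s w.
Proof.
move=> g0 s0 w0; rewrite /suff_likelihood deviance_mulp// mulrA -exprMn.
have -> : par_theta (mulp g w) = par_theta g * par_theta w by [].
by congr (_ ^+ _ * _); rewrite -invfM mulrCA.
Qed.

Lemma suff_likelihood_gt0 s w : param_space w -> 0 < suff_likelihood n s w.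
Proof.
move=> [w0 _]; rewrite mulr_gt0 ?expR_gt0// exprn_gt0// invr_gt0.
by rewrite !mulr_gt0 ?pi_gt0.
Qed.

Lemma loglikE x w : nondegenerate x -> param_space w ->
  loglik x w = - n%:R * ln (2 * pi * par_theta w) -
    n%:R / 2 * deviance (mle x) w.
Proof.
move=> nx w0; have [t0 _] := w0.
have p0 : 0 < 2 * pi * par_theta w by rewrite !mulr_gt0 ?pi_gt0.
have q0 : 0 < (2 * pi * par_theta w)^-1 by rewrite invr_gt0.
have qn0 : 0 < (2 * pi * par_theta w)^-1 ^+ n by exact: exprn_gt0.
rewrite /loglik likelihoodE// /suff_likelihood [LHS]lnM ?posrE ?expR_gt0//.
rewrite expRK; congr (_ + _).
by rewrite lnXn// lnV ?posrE// -[LHS]mulr_natl; ring.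
Qed.

End equivariance.

(** * No estimator for degenerate samples *)

Section maximum_likelihood.
Context (R : realType) (n : nat).
Implicit Types (x : 'I_n -> obs R) (w s g : param R).
Hypothesis n0 : (0 < n)%N.

Let nR : (n%:R : R) != 0. Proof. by rewrite pnatr_eq0 -lt0n. Qed.

Let nR0 : 0 < (n%:R : R). Proof. by rewrite ltr0n. Qed.

(** If theta can tend to 0 while the exponent stays equal to [K], the likelihood is unbounded. *)
Lemma no_mle_of_unbounded x (K : R) :
  (forall t : R, 0 < t -> exists2 w, param_space w &
     likelihood x w = (2 * pi * t)^-1 ^+ n * expR K) ->
  ~ exists w, is_mle x w.
Proof.
move=> H [v [v0 vmax]].
(* Chosen so that 2 pi t = exp(- c) gives log-likelihood n c + K, one more than the supposed
   maximum. *)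
pose c := (loglik x v + 1 - K) / n%:R.
have p0 : 0 < (2 * pi : R) by rewrite mulr_gt0// pi_gt0.
have t0 : 0 < expR (- c) / (2 * pi) by rewrite divr_gt0// expR_gt0.
have [w w0 wE] := H _ t0.
have := vmax w w0; rewrite {1}/loglik wE mulrCA divff ?gt_eqF// mulr1.
rewrite -expRN opprK -expRM_natl -expRD expRK /c mulrC divfK//.
rewrite subrK leNgt => /negP; apply; rewrite ltrDl; exact: ltr01.
Qed.

Lemma sumr_sqr_eq0 (u : 'I_n -> R) : ~ (0 < \sum_(i < n) u i ^+ 2) ->
  forall i, u i = 0.
Proof.
move=> /negP; rewrite -leNgt => u0 i; apply/eqP; rewrite -sqrf_eq0 eq_le sqr_ge0 andbT.
apply: le_trans u0; rewrite (bigD1 i)//= lerDl sumr_ge0// => j _.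
exact: sqr_ge0.
Qed.

Lemma nondegenerate_of_mle x : (exists w, is_mle x w) -> nondegenerate x.
Proof.
move=> xmle; apply: contrapT => nx; move: xmle.
have p0 : (pi : R) != 0 by rewrite gt_eqF// pi_gt0.
have [s0|s0] := pselect (0 < ss11 x).
  have r0 : ~ 0 < rss x by move=> r0; apply: nx.
  have ri := sumr_sqr_eq0 r0.
  apply: (@no_mle_of_unbounded x (- 2^-1 * ss11 x)) => t t0.
  (* Collinear data: the residuals vanish, so theta eta = t^2 may shrink while eta / theta stays
     1. *)
  exists (mean1 x, mean2 x, slope x, t, t) => //.
  rewrite /likelihood /density big_split/= prodr_const card_ord -expR_sum.
  rewrite /par_mu1 /par_mu2 /par_beta /par_theta /par_eta /=.
  congr (_ * expR _); rewrite /ss11 mulr_sumr; apply: eq_bigr => i _.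
  congr (_ * _); rewrite -/(dev1 x i) -/(dev2 x i) -/(resid x i) ri.
  by rewrite expr0n/= mul0r add0r mulrAC divff ?mul1r// gt_eqF.
have di := sumr_sqr_eq0 s0.
apply: (@no_mle_of_unbounded x (- 2^-1 * \sum_(i < n) dev2 x i ^+ 2)) => t t0.
(* Equal first coordinates: their deviations vanish, so eta / theta = t^-2 may grow while theta eta
   stays 1. *)
exists (mean1 x, mean2 x, 0, t, t^-1); first by split; rewrite //= invr_gt0.
rewrite /likelihood /density big_split/= prodr_const card_ord -expR_sum.
rewrite /par_mu1 /par_mu2 /par_beta /par_theta /par_eta /=.
congr (_ * expR _); rewrite mulr_sumr; apply: eq_bigr => i _.
congr (_ * _); rewrite -/(dev1 x i) -/(dev2 x i) di.
by rewrite expr0n/= !mulr0 mul0r addr0 subr0 divff ?divr1// gt_eqF.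
Qed.

End maximum_likelihood.

Lemma ln_le_subr1 (R : realType) (t : R) : 0 < t -> ln t <= t - 1.
Proof. by move=> t0; have := expR_ge1Dx (ln t); rewrite lnK// lerBrDl. Qed.

Lemma ln_lt_subr1 (R : realType) (t : R) : 0 < t -> t != 1 -> ln t < t - 1.
Proof.
move=> t0 t1; have := @expR_gt1Dx R (ln t); rewrite ln_eq0// => /(_ t1).
by rewrite lnK// ltrBrDl.
Qed.

(** * Profile likelihoods *)

Section likelihood_ratio.
Context (R : realType) (n : nat).
Implicit Types (x : 'I_n -> obs R) (w s g : param R).
Hypothesis n0 : (0 < n)%N.

Let nR0 : 0 < (n%:R : R). Proof. by rewrite ltr0n. Qed.

Definition suff_loglik s w : R :=
  - n%:R * ln (2 * pi * par_theta w) - n%:R / 2 * deviance s w.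

Let p0 : 0 < (2 * pi : R). Proof. by rewrite mulr_gt0// pi_gt0. Qed.

(** Fixing beta or eta multiplies the maximizing theta by [rel_beta] or [rel_eta], and the
    likelihood ratio statistic is then 2 n times the logarithm of this factor. [rel_eta] is the
    hyperbolic cosine of the logarithm of the ratio of the two eta. *)
Definition rel_beta s w : R :=
  Num.sqrt (1 + ((par_beta w - par_beta s) / par_eta s) ^+ 2).
Definition rel_eta s w : R :=
  (par_eta w / par_eta s + (par_eta w / par_eta s)^-1) / 2.
Definition rel_theta s w : R := par_theta w / par_theta s.

Definition lr_beta s w : R := 2 * n%:R * ln (rel_beta s w).
Definition lr_eta s w : R := 2 * n%:R * ln (rel_eta s w).
Definition lr_theta s w : R :=
  2 * n%:R * (ln (rel_theta s w) + (rel_theta s w)^-1 - 1).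

(** The map from theta to - n ln(2 pi theta) - n r / theta is largest at theta = r, by
    [ln y <= y - 1] at y = r / theta. *)
Lemma suff_loglik_le s w (r : R) : param_space w -> 0 < r ->
  2 * r / par_theta w <= deviance s w ->
  suff_loglik s w <= - n%:R * ln (2 * pi * r) - n%:R.
Proof.
move=> [t0 _] r0 rD; rewrite /suff_loglik.
rewrite !(@lnM _ (2 * pi)) ?posrE//.
have := ln_le_subr1 (divr_gt0 r0 t0); rewrite ln_div ?posrE// => h.
have {}rD : r / par_theta w <= deviance s w / 2.
  by rewrite ler_pdivlMr// mulrC mulrA.
have hn : n%:R * (ln r - ln (par_theta w)) <= n%:R * (deviance s w / 2 - 1).
  by rewrite ler_pM2l//; apply: le_trans h _; rewrite lerD2r.
move: hn; move: (ln r) (ln (par_theta w)) (ln (2 * pi)) (deviance s w) => a b c e hn.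
suff : - n%:R * (c + b) - n%:R / 2 * e <= - n%:R * (c + a) - n%:R by [].
lra.
Qed.

(** The two squares that involve the means are dropped; they vanish when the means of [w] are those
    of [s]. *)
Lemma deviance_ge s w : param_space s -> param_space w ->
  par_theta s / par_theta w *
   ((1 + ((par_beta w - par_beta s) / par_eta s) ^+ 2) /
       (par_eta w / par_eta s) + par_eta w / par_eta s) <= deviance s w.
Proof.
move=> [st0 se0] [wt0 we0]; rewrite /deviance.
set u := _ - _ - _; set v := par_mu1 s - par_mu1 w.
have -> : (u ^+ 2 + par_theta s * par_eta s +
    par_theta s / par_eta s * (par_beta w - par_beta s) ^+ 2) /
   (par_theta w * par_eta w) +
  par_eta w * (v ^+ 2 + par_theta s / par_eta s) / par_theta w =
  par_theta s / par_theta w *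
   ((1 + ((par_beta w - par_beta s) / par_eta s) ^+ 2) /
       (par_eta w / par_eta s) + par_eta w / par_eta s) +
  (u ^+ 2 / (par_theta w * par_eta w) + par_eta w * v ^+ 2 / par_theta w).
  move: u v (par_beta w) (par_beta s) (par_theta s) (par_eta s) (par_theta w)
    (par_eta w) st0 se0 wt0 we0 => u v bw bs ts es tw ew *.
  by field; rewrite !gt_eqF.
rewrite lerDl addr_ge0//.
  by rewrite divr_ge0 ?sqr_ge0// ltW// mulr_gt0.
by rewrite divr_ge0 ?(ltW wt0)// mulr_ge0 ?sqr_ge0 ?(ltW we0).
Qed.

Lemma amgm_div (A y : R) : 0 < A -> 0 < y -> 2 * Num.sqrt A <= A / y + y.
Proof.
move=> A0 y0; rewrite -subr_ge0.
have -> : A / y + y - 2 * Num.sqrt A = (Num.sqrt A - y) ^+ 2 / y.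
  rewrite sqrrB sqr_sqrtr ?ltW//; move: (Num.sqrt A) => a.
  by field; rewrite gt_eqF.
by rewrite divr_ge0 ?sqr_ge0// ltW.
Qed.

Lemma rel_beta_ge1 s w : 1 <= rel_beta s w.
Proof. by rewrite -[leLHS]sqrtr1; apply: ler_wsqrtr; rewrite lerDl sqr_ge0. Qed.

Lemma rel_eta_ge1 s w : param_space s -> param_space w -> 1 <= rel_eta s w.
Proof.
move=> [_ s0] [_ w0]; rewrite /rel_eta ler_pdivlMr// mul1r.
have := amgm_div ltr01 (divr_gt0 w0 s0); rewrite sqrtr1 mulr1 div1r.
by rewrite addrC.
Qed.

Lemma suff_loglikE s w (r : R) : par_theta w = r -> deviance s w = 2 ->
  suff_loglik s w = - n%:R * ln (2 * pi * r) - n%:R.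
Proof. by move=> tE wD; rewrite /suff_loglik tE wD divfK. Qed.

(** With b = (beta_w - beta_s) / eta_s fixed, the arithmetic-geometric inequality bounds (1 + b^2) /
    y + y below by 2 (1 + b^2)^(1/2), attained at y = [rel_beta]. Here y is the ratio of the eta;
    theta is then optimized by [suff_loglik_le]. *)
Lemma suff_loglik_max_beta s w w1 : param_space s -> param_space w ->
  w1 = (par_mu1 s, par_mu2 s, par_beta w, par_theta s * rel_beta s w,
    par_eta s * rel_beta s w) ->
  [/\ param_space w1,
     suff_loglik s w1 = - n%:R * ln (2 * pi * (par_theta s * rel_beta s w)) - n%:R &
     suff_loglik s w <= - n%:R * ln (2 * pi * (par_theta s * rel_beta s w)) - n%:R].
Proof.
move=> s0 w0 w1E; have [st0 se0] := s0; have [wt0 we0] := w0.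
have m1E : par_mu1 w1 = par_mu1 s by rewrite w1E.
have m2E : par_mu2 w1 = par_mu2 s by rewrite w1E.
have bE : par_beta w1 = par_beta w by rewrite w1E.
have tE : par_theta w1 = par_theta s * rel_beta s w by rewrite w1E.
have eE : par_eta w1 = par_eta s * rel_beta s w by rewrite w1E.
have r0 : 0 < rel_beta s w by apply: lt_le_trans (rel_beta_ge1 s w).
split; first by split; rewrite ?tE ?eE mulr_gt0.
- apply: suff_loglikE => //.
  have rE : rel_beta s w ^+ 2 =
      1 + ((par_beta w - par_beta s) / par_eta s) ^+ 2.
    by rewrite sqr_sqrtr// addr_ge0// sqr_ge0.
  rewrite /deviance m1E m2E bE tE eE.
  rewrite !subrr mulr0 subr0 expr0n/= !add0r.
  have -> : (par_beta w - par_beta s) ^+ 2 = (rel_beta s w ^+ 2 - 1) * par_eta s ^+ 2.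
    by rewrite rE addrAC subrr add0r expr_div_n divfK// sqrf_eq0 gt_eqF.
  move: (rel_beta s w) (par_theta s) (par_eta s) r0 st0 se0 => r t e *.
  by field; rewrite !gt_eqF.
- apply: suff_loglik_le => //; first by rewrite mulr_gt0.
  apply: le_trans (deviance_ge s0 w0).
  rewrite [leLHS](_ : _ = par_theta s / par_theta w * (2 * rel_beta s w)); last first.
    by move: (rel_beta s w) (par_theta s) (par_theta w) => *; ring.
  rewrite ler_pM2l ?divr_gt0//; apply: amgm_div; last by rewrite divr_gt0.
  by rewrite ltr_pwDl// sqr_ge0.
Qed.

(** Now y is fixed and b = 0 is best, which leaves 1 / y + y, that is 2 [rel_eta]. *)
Lemma suff_loglik_max_eta s w w1 : param_space s -> param_space w ->
  w1 = (par_mu1 s, par_mu2 s, par_beta s, par_theta s * rel_eta s w,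
    par_eta w) ->
  [/\ param_space w1,
     suff_loglik s w1 = - n%:R * ln (2 * pi * (par_theta s * rel_eta s w)) - n%:R &
     suff_loglik s w <= - n%:R * ln (2 * pi * (par_theta s * rel_eta s w)) - n%:R].
Proof.
move=> s0 w0 w1E; have [st0 se0] := s0; have [wt0 we0] := w0.
have m1E : par_mu1 w1 = par_mu1 s by rewrite w1E.
have m2E : par_mu2 w1 = par_mu2 s by rewrite w1E.
have bE : par_beta w1 = par_beta s by rewrite w1E.
have tE : par_theta w1 = par_theta s * rel_eta s w by rewrite w1E.
have eE : par_eta w1 = par_eta w by rewrite w1E.
have r0 : 0 < rel_eta s w by apply: lt_le_trans (rel_eta_ge1 s0 w0).
split; first by split; [rewrite tE; exact: mulr_gt0|rewrite eE].
- apply: suff_loglikE => //.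
  rewrite /deviance m1E m2E bE tE eE.
  rewrite !subrr mulr0 subr0 expr0n/= !add0r mulr0 addr0.
  move: r0; rewrite /rel_eta.
  move: (par_theta s) (par_eta s) (par_eta w) st0 se0 we0 => t e e' t0 e0 e'0 r0.
  field; rewrite !gt_eqF//=.
  by rewrite addr_gt0// mulr_gt0.
- apply: suff_loglik_le => //; first by rewrite mulr_gt0.
  apply: le_trans (deviance_ge s0 w0).
  rewrite -mulrA -mulrA [leLHS](_ : _ = par_theta s / par_theta w * (2 * rel_eta s w)); last first.
    by move: (rel_eta s w) (par_theta s) (par_theta w) => *; ring.
  rewrite ler_pM2l ?divr_gt0// /rel_eta mulrC divfK// addrC lerD2r.
  by rewrite ler_pdivlMr ?divr_gt0// mulVf ?gt_eqF ?divr_gt0// lerDl sqr_ge0.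
Qed.

(** Here theta is fixed, and b = 0, y = 1 give the least value 2 of (1 + b^2) / y + y. *)
Lemma suff_loglik_max_theta s w w1 : param_space s -> param_space w ->
  w1 = (par_mu1 s, par_mu2 s, par_beta s, par_theta w, par_eta s) ->
  [/\ param_space w1,
     suff_loglik s w1 = - n%:R * ln (2 * pi * par_theta w) -
        n%:R * (par_theta s / par_theta w) &
     suff_loglik s w <= - n%:R * ln (2 * pi * par_theta w) -
        n%:R * (par_theta s / par_theta w)].
Proof.
move=> s0 w0 w1E; have [st0 se0] := s0; have [wt0 we0] := w0.
have m1E : par_mu1 w1 = par_mu1 s by rewrite w1E.
have m2E : par_mu2 w1 = par_mu2 s by rewrite w1E.
have bE : par_beta w1 = par_beta s by rewrite w1E.
have tE : par_theta w1 = par_theta w by rewrite w1E.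
have eE : par_eta w1 = par_eta s by rewrite w1E.
split; first by split; rewrite ?tE ?eE.
- rewrite /suff_loglik tE; congr (_ - _).
  rewrite /deviance m1E m2E bE tE eE.
  rewrite !subrr mulr0 subr0 expr0n/= !add0r mulr0 addr0.
  move: (par_theta s) (par_eta s) (par_theta w) st0 se0 wt0 => t e t' *.
  by field; rewrite !gt_eqF.
- rewrite /suff_loglik lerD2l lerN2 -mulrA ler_pM2l//.
  rewrite ler_pdivlMl//; apply: le_trans (deviance_ge s0 w0).
  rewrite mulrC ler_pM2l ?divr_gt0//.
  have y0 := divr_gt0 we0 se0.
  apply: (le_trans _ (_ : 1 / (par_eta w / par_eta s) + par_eta w / par_eta s <= _)).
    by have := amgm_div ltr01 y0; rewrite sqrtr1 mulr1.
  by rewrite lerD2r ler_pM2r ?invr_gt0// lerDl sqr_ge0.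
Qed.

End likelihood_ratio.

Section lr_spec.
Context (R : realType) (n : nat).
Implicit Types (x : 'I_n -> obs R) (w s g : param R).
Hypothesis n0 : (0 < n)%N.

Let nR0 : 0 < (n%:R : R). Proof. by rewrite ltr0n. Qed.
Let p0 : 0 < (2 * pi : R). Proof. by rewrite mulr_gt0// pi_gt0. Qed.

Definition lr_stat_spec (psi : param R -> R) (M : param R -> param R -> R) :=
  forall x w m, nondegenerate x -> param_space w ->
    is_lr_stat psi (psi w) x m <-> m = M (mle x) w.

Lemma deviance_self s : param_space s -> deviance s s = 2.
Proof.
move=> [st0 se0].
rewrite /deviance !subrr mulr0 subrr expr0n/= !mulr0 !add0r addr0.
move: (par_theta s) (par_eta s) st0 se0 => t e *.
by field; rewrite !gt_eqF.
Qed.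

Lemma is_mle_mle x : nondegenerate x -> is_mle x (mle x).
Proof.
move=> nx; have s0 := param_space_mle n0 nx; split => // w w0.
rewrite !(loglikE n0)// -!/(suff_loglik _ _ _).
(* The maximum at fixed eta decreases with [rel_eta], which is at least 1 and equals 1 at the
   estimator. *)
have [_ _ le1] := suff_loglik_max_eta n0 s0 w0 erefl.
apply: le_trans le1 _.
have [st0 se0] := s0.
rewrite (suff_loglikE n erefl (deviance_self s0)) lerD2r !mulNr lerN2 ler_pM2l//.
have r0 : 0 < rel_eta (mle x) w by apply: lt_le_trans (rel_eta_ge1 s0 w0).
have q1 := mulr_gt0 p0 st0; have q2 := mulr_gt0 p0 (mulr_gt0 st0 r0).
rewrite ler_ln ?posrE//.
by rewrite ler_pM2l// ler_peMr ?(ltW st0)//; exact: rel_eta_ge1.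
Qed.

(** Two maximizers have the same log-likelihood, so the value does not depend on the witnesses in
    [is_lr_stat]. *)
Lemma is_lr_statP psi x w w1 m : nondegenerate x -> param_space w ->
  is_restricted_mle psi (psi w) x w1 ->
  is_lr_stat psi (psi w) x m <-> m = 2 * (loglik x (mle x) - loglik x w1).
Proof.
move=> nx w0 w1P; have mP := is_mle_mle nx; split; last first.
  by move=> ->; exists (mle x), w1.
move=> [v [v1 [vP v1P ->]]]; congr (2 * (_ - _)); apply/eqP; rewrite eq_le.
- by have [? h] := mP; have [? h'] := vP; rewrite h// h'.
- by have [? ? h] := w1P; have [? ? h'] := v1P; rewrite h// h'.
Qed.

Lemma loglik_mle x : nondegenerate x ->
  loglik x (mle x) = - n%:R * ln (2 * pi * par_theta (mle x)) - n%:R.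
Proof.
move=> nx; have s0 := param_space_mle n0 nx; have [st0 se0] := s0.
by rewrite (loglikE n0)//; apply: suff_loglikE => //; exact: deviance_self.
Qed.

Lemma lr_stat_spec_beta : lr_stat_spec (@par_beta R) (@lr_beta R n).
Proof.
move=> x w m nx w0; have s0 := param_space_mle n0 nx; have [st0 se0] := s0.
have r0 : 0 < rel_beta (mle x) w by apply: lt_le_trans (rel_beta_ge1 _ _).
have [w10 w1E _] := suff_loglik_max_beta n0 s0 w0 erefl.
set w1 := (X in param_space X) in w10 w1E.
rewrite (@is_lr_statP _ x w w1)//.
  rewrite loglik_mle// (loglikE n0)// -[X in 2 * (_ - X)]/(suff_loglik n _ _) w1E.
  rewrite [ln (2 * pi * (_ * _))](_ : _ = ln (2 * pi * par_theta (mle x)) + ln (rel_beta (mle x) w)); last first.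
    by rewrite mulrA lnM ?posrE//; exact: mulr_gt0.
  rewrite /lr_beta.
  by move: (ln _) (ln _) => *; split=> ->; ring.
split => // w' w'0 bw'.
rewrite !(loglikE n0)// -[leRHS]/(suff_loglik n _ _) w1E.
have [_ _] := suff_loglik_max_beta n0 s0 w'0 erefl.
by rewrite /rel_beta bw'.
Qed.

Lemma lr_stat_spec_eta : lr_stat_spec (@par_eta R) (@lr_eta R n).
Proof.
move=> x w m nx w0; have s0 := param_space_mle n0 nx; have [st0 se0] := s0.
have r0 : 0 < rel_eta (mle x) w by apply: lt_le_trans (rel_eta_ge1 s0 w0).
have [w10 w1E _] := suff_loglik_max_eta n0 s0 w0 erefl.
set w1 := (X in param_space X) in w10 w1E.
rewrite (@is_lr_statP _ x w w1)//.
  rewrite loglik_mle// (loglikE n0)// -[X in 2 * (_ - X)]/(suff_loglik n _ _) w1E.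
  rewrite [ln (2 * pi * (_ * _))](_ : _ = ln (2 * pi * par_theta (mle x)) + ln (rel_eta (mle x) w)); last first.
    by rewrite mulrA lnM ?posrE//; exact: mulr_gt0.
  rewrite /lr_eta.
  by move: (ln _) (ln _) => *; split=> ->; ring.
split => // w' w'0 bw'.
rewrite !(loglikE n0)// -[leRHS]/(suff_loglik n _ _) w1E.
have [_ _] := suff_loglik_max_eta n0 s0 w'0 erefl.
by rewrite /rel_eta bw'.
Qed.

Lemma lr_stat_spec_theta : lr_stat_spec (@par_theta R) (@lr_theta R n).
Proof.
move=> x w m nx w0; have s0 := param_space_mle n0 nx; have [st0 se0] := s0.
have [wt0 we0] := w0.
have [w10 w1E _] := suff_loglik_max_theta n0 s0 w0 erefl.
set w1 := (X in param_space X) in w10 w1E.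
rewrite (@is_lr_statP _ x w w1)//.
  rewrite loglik_mle// (loglikE n0)// -[X in 2 * (_ - X)]/(suff_loglik n _ _) w1E.
  rewrite !(@lnM _ (2 * pi)) ?posrE//.
  rewrite /lr_theta /rel_theta ln_div ?posrE// invf_div.
  move: (ln (par_theta w)) (ln (par_theta (mle x))) (ln (2 * pi)) (par_theta (mle x) / par_theta w) => *.
  by split=> ->; ring.
split => // w' w'0 bw'.
rewrite !(loglikE n0)// -[leRHS]/(suff_loglik n _ _) w1E.
have [_ _] := suff_loglik_max_theta n0 s0 w'0 erefl.
by rewrite -bw'.
Qed.

End lr_spec.

(** * Reweighted samples *)

Section positive_integral.
Local Open Scope ereal_scope.
Context d (T : measurableType d) (R : realType) (mu : {measure set T -> \bar R}).

Lemma integral_gt0 (D : set T) (f : T -> \bar R) : measurable D ->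
  measurable_fun D f -> (forall x, D x -> 0 < f x) -> 0 < mu D ->
  0 < \int[mu]_(x in D) f x.
Proof.
move=> mD mf f0 muD; rewrite lt0e; apply/andP; split; last first.
  by apply: integral_ge0 => x Dx; exact/ltW/f0.
apply/negP => /eqP If0.
have : \int[mu]_(x in D) `|f x| = 0.
  by rewrite -[RHS]If0; apply: eq_integral => x /set_mem Dx; rewrite gee0_abs// ltW// f0.
move=> /(ae_eq_integral_abs mu mD mf)[B [mB B0 sB]].
move: muD; rewrite lt0e => /andP[/negP + _]; apply; apply/eqP.
apply/eqP; rewrite eq_le measure_ge0 andbT -[leRHS]B0 le_measure ?inE//.
move=> x Dx; apply: sB => /= /(_ Dx) /= fx0.
by have := f0 x Dx; rewrite fx0 ltxx.
Qed.

End positive_integral.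

Ltac mfunH := mfun;
  try (match goal with H : forall _, measurable_fun _ _ |- _ => exact: (H _) end).

Section sample_measurability.
Context (R : realType) (n : nat) d (T : measurableType d).
Variable X : 'I_n -> T -> obs R.
Hypothesis mX : forall i, measurable_fun setT (X i).

Let m1 i : measurable_fun setT (fun t => (X i t).1).
Proof. exact: (measurableT_comp measurable_fst (mX i)). Qed.

Let m2 i : measurable_fun setT (fun t => (X i t).2).
Proof. exact: (measurableT_comp measurable_snd (mX i)). Qed.

Lemma measurable_mean1 : measurable_fun setT (fun t => mean1 (X ^~ t)).
Proof. by rewrite /mean1; mfunH. Qed.

Lemma measurable_mean2 : measurable_fun setT (fun t => mean2 (X ^~ t)).
Proof. by rewrite /mean2; mfunH. Qed.

Lemma measurable_ss11 : measurable_fun setT (fun t => ss11 (X ^~ t)).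
Proof.
have h1 := measurable_mean1; have h2 := measurable_mean2.
by rewrite /ss11 /dev1; mfunH.
Qed.

Lemma measurable_slope : measurable_fun setT (fun t => slope (X ^~ t)).
Proof.
have h1 := measurable_mean1; have h2 := measurable_mean2.
have h3 := measurable_ss11.
by rewrite /slope /dev1 /dev2; mfunH.
Qed.

Lemma measurable_rss : measurable_fun setT (fun t => rss (X ^~ t)).
Proof.
have h1 := measurable_mean1; have h2 := measurable_mean2.
have h3 := measurable_slope.
by rewrite /rss /resid /dev1 /dev2; mfunH.
Qed.

Lemma measurable_mle : measurable_fun setT (fun t => mle (X ^~ t)).
Proof.
have h1 := measurable_mean1; have h2 := measurable_mean2.
have h3 := measurable_slope; have h4 := measurable_ss11.
have h5 := measurable_rss.
by rewrite /mle; mfunH.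
Qed.

Lemma measurable_nondegenerate : measurable [set t | nondegenerate (X ^~ t)].
Proof.
have -> : [set t | nondegenerate (X ^~ t)] =
  [set t | 0 < ss11 (X ^~ t)] `&` [set t | 0 < rss (X ^~ t)] by [].
apply: measurableI; rewrite -[X in measurable X]setTI;
  apply: measurable_fun_ltr => //.
- exact: measurable_ss11.
- exact: measurable_rss.
Qed.

End sample_measurability.

Lemma measurable_indic_comp d d' (T : measurableType d) (U : measurableType d')
    (R : realType) (A : set U) (f : T -> U) : measurable A ->
  measurable_fun setT f -> measurable_fun setT (fun t => \1_A (f t) : R).
Proof.
by move=> mA mf; apply: (@measurableT_comp _ _ _ _ _ _ (\1_A : U -> R)).
Qed.

Section reweighting.
Local Open Scope ereal_scope.
Context (R : realType) d (Omega : measurableType d) (P : probability Omega R).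
Context (n : nat) (Z : 'I_n -> Omega -> obs R).
Hypothesis ZP : std_sample P Z.
Local Notation leb := (@lebesgue_measure R).

Lemma integral_std (i : 'I_n) (f : obs R -> \bar R) : measurable_fun setT f ->
  (forall x, 0 <= f x) ->
  \int[P]_o f (Z i o) = \int[leb2 R]_x (f x * (density (onep R) x)%:E).
Proof.
move=> mf f0; have [mZ lZ _] := ZP.
have md1 : measurable_fun setT (density (onep R)) by apply: measurable_density; mfun.
have d10 z : (0 <= density (onep R) z)%R.
  by rewrite ltW// density_gt0//; exact: param_space1.
rewrite -(integral_image_measure P (mZ i))//.
rewrite -(integral_density_measure (leb2 R) md1 d10)//.
by apply: eq_measure_integral => A mA _; exact: lZ.
Qed.

(** Reweighting by the likelihood ratio. Each observation has its own group element, so that a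
    single one can also be moved. *)
Lemma integral_act_sample (w : 'I_n -> param R) (G : n.-tuple (obs R) -> \bar R) :
  (forall i, param_space (w i)) ->
  measurable_fun setT G -> (forall t, 0 <= G t) ->
  \int[P]_o G [tuple act (w i) (Z i o) | i < n] =
  \int[P]_o (G [tuple Z i o | i < n] *
    (\prod_(i < n) (density (w i) (Z i o) / density (onep R) (Z i o)))%:E).
Proof.
move=> w0 mG G0; have [mZ lZ iZ] := ZP.
have mact i : measurable_fun setT (act (w i)) by apply: measurable_act; mfun.
have md v : measurable_fun setT (density v : obs R -> R).
  by apply: measurable_density; mfun.
have d0 i x : (0 < density (w i) x)%R by exact: density_gt0.
have d1 (x : obs R) : (0 < density (onep R) x)%R.
  by apply: density_gt0; exact: param_space1.
apply: (@integral_reweight _ _ _ _ _ _ _ Z (fun i o => act (w i) (Z i o))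
  (fun i x => density (w i) x / density (onep R) x)%R) => //.
- by move=> i; exact: (measurableT_comp (mact i) (mZ i)).
- exact: (@box_independent_act _ _ _ _ _ _ (fun i => act (w i))).
- move=> i; apply: measurable_funM; first exact: md.
  by apply: measurable_funV; exact: md.
- by move=> i x; rewrite divr_ge0// ltW.
- move=> i A mA; rewrite (act_law i ZP (w0 i) mA).
  rewrite (@integral_std i (fun x => (\1_A x * (density (w i) x / density (onep R) x))%:E)).
  + rewrite (integral_indicM (leb2 R)); apply: eq_integral => x _.
    by rewrite -!EFinM -mulrA divfK// gt_eqF.
  + apply/measurable_EFinP; apply: measurable_funM; first exact: measurable_indic.
    by apply: measurable_funM; [exact: md|apply: measurable_funV; exact: md].
  + by move=> x; rewrite lee_fin mulr_ge0 ?indicE// divr_ge0// ltW.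
Qed.

Lemma act1 (z : obs R) : act (onep R) z = z.
Proof.
case: z => a b; rewrite /act /scl1 /scl2 /par_mu1 /par_mu2 /par_beta /par_theta /par_eta /=.
by rewrite divr1 mulr1 sqrtr1 !mul1r !addr0 !mul0r addr0.
Qed.

Definition shift_param (c1 c2 t : R) : param R := (t * c1, t * c2, 0, 1, 1)%R.

Lemma act_shift c1 c2 t (z : obs R) :
  act (shift_param c1 c2 t) z = (z.1 + t * c1, z.2 + t * c2)%R.
Proof.
rewrite /act /shift_param /scl1 /scl2 /par_mu1 /par_mu2 /par_beta /par_theta /par_eta /=.
by rewrite divr1 mulr1 sqrtr1 !mul1r !mul0r add0r.
Qed.

(** Observation [j] is shifted by [t] times (c1, c2). For each outcome at most one [t] leads into
    [A], so by Tonelli some shift makes [A] null; shifted and unshifted samples have mutually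
    positive densities, so [A] is null without the shift. *)
Lemma std_sample_shift_null (j : 'I_n) (c1 c2 : R) (A : set (n.-tuple (obs R))) :
  measurable A ->
  (forall x : 'I_n -> obs R, exists a : R, forall t : R,
     A [tuple if i == j then ((x i).1 + t * c1, (x i).2 + t * c2)%R else x i
       | i < n] -> t = a) ->
  P [set o | A [tuple Z i o | i < n]] = 0.
Proof.
move=> mA HA; have [mZ lZ iZ] := ZP.
pose w t i := if i == j then shift_param c1 c2 t else onep R.
have w0 t i : param_space (w t i) by rewrite /w; case: ifP => _; split => /=.
pose Y (p : measurableTypeR R * Omega) : n.-tuple (obs R) :=
  [tuple act (w p.1 i) (Z i p.2) | i < n].
have mw i : measurable_fun setT (fun p : measurableTypeR R * Omega => w p.1 i).
  rewrite /w; case: (i == j); last exact: measurable_cst.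
  have m1 : measurable_fun setT (fun p : measurableTypeR R * Omega => p.1).
    exact: measurable_fst.
  by rewrite /shift_param; mfun.
have mY : measurable_fun setT Y.
  apply/measurable_fun_tnthP => i.
  rewrite [X in measurable_fun _ X](_ : _ = fun p => act (w p.1 i) (Z i p.2)).
    by apply: measurable_act => //; exact: (measurableT_comp (mZ i) measurable_snd).
  by apply/funext => p /=; rewrite tnth_mktuple.
have mZt : measurable_fun setT (fun o => [tuple Z i o | i < n]).
  apply/measurable_fun_tnthP => i.
  by rewrite [X in measurable_fun _ X](_ : _ = Z i)//; apply/funext => o /=;
    rewrite tnth_mktuple.
pose f p : \bar R := (\1_A (Y p))%:E.
have mf : measurable_fun setT f by apply/measurable_EFinP; exact: measurable_indic_comp.
have f0 p : 0 <= f p by rewrite lee_fin indicE.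
have If : \int[leb]_t \int[P]_o f (t, o) = 0.
  transitivity (\int[P]_o \int[leb]_t f (t, o)).
    exact: (@fubini_tonelli _ _ _ _ R leb P f mf f0).
  apply: integral0_eq => o _.
  have [a Ha] := HA (fun i => Z i o).
  apply/eqP; rewrite eq_le integral_ge0// andbT.
  apply: (@le_trans _ _ (\int[leb]_t (\1_[set a] t)%:E)).
    apply: ge0_le_integral => //.
    - by apply/measurableT_comp => //; exact: pair2_measurable.
    - by apply/measurable_EFinP; exact: measurable_indic.
    - move=> t _; rewrite lee_fin /f !indicE.
      case: (boolP (Y (t, o) \in A)) => // /set_mem; rewrite /Y /= => h.
      rewrite mem_set//=; apply: Ha; move: h.
      congr A; apply: eq_from_tnth => i; rewrite !tnth_mktuple /w.
      by case: ifP => _; [rewrite act_shift|rewrite act1].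
  rewrite integral_indic// setIT le_eqVlt; apply/orP; left; apply/eqP.
  exact: lebesgue_measure_set1.
(* Otherwise the inner integral would be positive for every [t], and so would be the double
   integral. *)
have [t tE] : exists t, \int[P]_o f (t, o) = 0.
  apply: contrapT => /forallNP h.
  suff : 0 < \int[leb]_t \int[P]_o f (t, o) by rewrite If ltxx.
  apply: integral_gt0 => //.
  - exact: measurable_fun_fubini_tonelli_F.
  - move=> t _; rewrite lt0e integral_ge0// andbT; apply/eqP; exact: h.
  - apply: (@lt_le_trans _ _ (leb `[0%R, 1%R]%classic)).
      by rewrite lebesgue_measure_itv/= lte_fin ltr01 -EFinB lte_fin subr0 ltr01.
    by apply: le_measure; rewrite ?inE//; exact: measurable_itv.
have mB : measurable [set o | A [tuple Z i o | i < n]].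
  by rewrite -[X in measurable X]setTI; exact: mZt.
(* If [A] were charged, the everywhere positive likelihood ratio would have a positive integral over
   it; but that integral is the probability after the shift [t], which is zero. *)
apply/eqP; rewrite -[_ == _]negbK; apply/negP => PB.
have PB0 : 0 < P [set o | A [tuple Z i o | i < n]].
  by rewrite lt0e PB measure_ge0.
have := @integral_gt0 _ _ _ P _ (fun o => (\prod_(i < n)
  (density (w t i) (Z i o) / density (onep R) (Z i o)))%:E) mB _ _ PB0.
have mr : measurable_fun setT (fun o => (\prod_(i < n)
  (density (w t i) (Z i o) / density (onep R) (Z i o)))%R).
  have md v i : measurable_fun setT (fun o => density v (Z i o)).
    by apply: measurable_density; mfun.
  apply: measurable_fun_prod_ord => i; apply: measurable_funM; first exact: md.
  by apply: measurable_funV; exact: md.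
rewrite (integral_indicM P).
have -> : \int[P]_o ((\1_[set o | A [tuple Z i o | i < n]] o)%:E *
   (\prod_(i < n) (density (w t i) (Z i o) / density (onep R) (Z i o)))%:E) = 0.
  rewrite -[RHS]tE /f /Y /=.
  rewrite [RHS](@integral_act_sample (w t) (fun x => (\1_A x)%:E))//.
  by apply/measurable_EFinP; exact: measurable_indic.
rewrite ltxx => H; suff: false by []; apply: H.
  by apply: (measurable_funS measurableT) => //; exact/measurable_EFinP.
move=> o _; rewrite lte_fin prodr_gt0// => i _.
by rewrite divr_gt0// density_gt0//; exact: param_space1.
Qed.

End reweighting.

(** * Almost sure nondegeneracy *)

Section nondegenerate_sample.
Local Open Scope ereal_scope.
Context (R : realType) d (Omega : measurableType d) (P : probability Omega R).
Context (n : nat) (Z : 'I_n -> Omega -> obs R).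
Hypotheses (ZP : std_sample P Z) (n3 : (3 <= n)%N).

Lemma degenerate_collinear (x : 'I_n -> obs R) (i j k : 'I_n) :
  ~ nondegenerate x ->
  (((x j).1 - (x i).1) * ((x k).2 - (x i).2) =
   ((x k).1 - (x i).1) * ((x j).2 - (x i).2))%R \/ (x i).1 = (x j).1.
Proof.
move=> nx; have [s0|s0] := pselect (0 < ss11 x)%R; last first.
  have di := sumr_sqr_eq0 s0; right.
  by apply: (addIr (- mean1 x)%R); rewrite -!/(dev1 x _) !di.
left; have r0 : ~ (0 < rss x)%R by move=> r0; apply: nx.
have ri l : (x l).2 = (mean2 x + slope x * ((x l).1 - mean1 x))%R.
  have /eqP := sumr_sqr_eq0 r0 l; rewrite /resid subr_eq0 => /eqP.
  by rewrite /dev2 /dev1 => <-; rewrite addrC subrK.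
rewrite !ri.
by move: (mean1 x) (mean2 x) (slope x) (x i).1 (x j).1 (x k).1 => *; ring.
Qed.

Lemma std_sample_nondegenerate :
  P [set o | nondegenerate (fun i => Z i o)] = 1.
Proof.
have [mZ _ _] := ZP.
pose i := Ordinal (leq_trans (isT : (0 < 3)%N) n3).
pose j := Ordinal (leq_trans (isT : (1 < 3)%N) n3).
pose k := Ordinal (leq_trans (isT : (2 < 3)%N) n3).
have mt1 l : measurable_fun setT (fun t : n.-tuple (obs R) => (tnth t l).1).
  by apply: (measurableT_comp measurable_fst); exact: measurable_tnth.
have mt2 l : measurable_fun setT (fun t : n.-tuple (obs R) => (tnth t l).2).
  by apply: (measurableT_comp measurable_snd); exact: measurable_tnth.
pose A1 : set (n.-tuple (obs R)) := [set t | (tnth t i).1 == (tnth t j).1].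
pose A2 : set (n.-tuple (obs R)) := [set t | ((tnth t i).1 == (tnth t j).1) == false] `&`
 [set t | ((tnth t j).1 - (tnth t i).1) * ((tnth t k).2 - (tnth t i).2) ==
   ((tnth t k).1 - (tnth t i).1) * ((tnth t j).2 - (tnth t i).2)]%R.
have mA1 : measurable A1.
  by rewrite -[X in measurable X]setTI; apply: measurable_fun_eqr => //; exact: mt1.
have mA2 : measurable A2.
  apply: measurableI.
    have -> : [set t : n.-tuple (obs R) | ((tnth t i).1 == (tnth t j).1) == false] = ~` A1.
      by apply/seteqP; split => t; rewrite /A1 /= eqbF_neg => /negP.
    exact: measurableC.
  rewrite -[X in measurable X]setTI; apply: measurable_fun_eqr => //.
    by apply: measurable_funM; apply: measurable_funB; (exact: mt1 || exact: mt2).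
  by apply: measurable_funM; apply: measurable_funB; (exact: mt1 || exact: mt2).
(* Moved horizontally, observation [j] has the first coordinate of observation [i] at one [t]
   only. *)
have P1 : P [set o | A1 [tuple Z l o | l < n]] = 0.
  apply: (@std_sample_shift_null _ _ _ _ _ _ ZP j 1 0) => // x.
  exists ((x i).1 - (x j).1)%R => t; rewrite /A1 /= !tnth_mktuple eqxx /= => /eqP ->.
  by rewrite mulr1 addrAC subrr add0r.
(* Off [A1] the line through observations [i] and [j] is not vertical, so observation [k], moved
   vertically, meets it at one [t] only. *)
have P2 : P [set o | A2 [tuple Z l o | l < n]] = 0.
  apply: (@std_sample_shift_null _ _ _ _ _ _ ZP k 0 1) => // x.
  exists (((x k).1 - (x i).1) * ((x j).2 - (x i).2) / ((x j).1 - (x i).1) -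
     (x k).2 + (x i).2)%R => t.
  rewrite /A2 /= !tnth_mktuple eqxx /= => -[/eqP/negP/negP ij /eqP].
  have ij' : ((x j).1 - (x i).1 != 0)%R by rewrite subr_eq0 eq_sym.
  rewrite mulr0 addr0 mulr1 => <-.
  rewrite [(((x j).1 - (x i).1) * _)%R]mulrC mulfK//.
  by move: (x k).2 (x i).2 => *; ring.
have mZt : measurable_fun setT (fun o => [tuple Z l o | l < n]).
  apply/measurable_fun_tnthP => l.
  by rewrite [X in measurable_fun _ X](_ : _ = Z l)//; apply/funext => o /=;
    rewrite tnth_mktuple.
have mB A : measurable A -> measurable [set o | A [tuple Z l o | l < n]].
  by move=> mA; rewrite -[X in measurable X]setTI; exact: mZt.
have mN : measurable [set o | nondegenerate (fun i => Z i o)].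
  exact: measurable_nondegenerate.
have N0 : P (~` [set o | nondegenerate (fun i => Z i o)]) = 0.
  apply/eqP; rewrite eq_le measure_ge0 andbT.
  apply: (@le_trans _ _ (P ([set o | A1 [tuple Z l o | l < n]] `|`
     [set o | A2 [tuple Z l o | l < n]]))).
    apply: le_measure; rewrite ?inE.
    - exact: measurableC.
    - by apply: measurableU; exact: mB.
    - move=> o /= nN; rewrite /A1 /A2 /= !tnth_mktuple.
      have [|h] := degenerate_collinear i j k nN; last by left; apply/eqP.
      by case: eqP => [_ _|_ h]; [left|right; split => //; apply/eqP].
  apply: (le_trans (measureU2 P (mB _ mA1) (mB _ mA2))).
  by rewrite [X in X + _]P1 [X in _ + X]P2 adde0.
have := probability_setC P mN; rewrite N0 => /esym.
move/eqP; rewrite sube_eq ?add0e//.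
  by move=> /eqP.
Qed.

End nondegenerate_sample.

(** * Posterior law and sampling law *)

Section posterior_mass.
Local Open Scope ereal_scope.
Context (R : realType) (n : nat).
Implicit Types (s w u g : param R) (A : set (param R * param R)).
Local Notation leb := (@lebesgue_measure R).

Lemma measurable_suff_likelihood d (T : measurableType d) (f g : T -> param R) :
  measurable_fun setT f -> measurable_fun setT g ->
  measurable_fun setT (fun t => suff_likelihood n (f t) (g t)).
Proof.
move=> /measurable_par[f1 f2 f3 f4 f5] /measurable_par[g1 g2 g3 g4 g5].
by rewrite /suff_likelihood /deviance; mfun.
Qed.

Lemma measurable_matching_prior d (T : measurableType d) (f : T -> param R) :
  measurable_fun setT f -> measurable_fun setT (fun t => matching_prior (f t)).
Proof.
move=> /measurable_par[f1 f2 f3 f4 f5].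
by rewrite /matching_prior; mfun.
Qed.

Definition posterior_weight s u : R :=
  \1_(@param_space R) u * (suff_likelihood n s u * matching_prior u).

Lemma matching_prior_gt0 u : param_space u -> (0 < matching_prior u)%R.
Proof. by move=> [? ?]; rewrite invr_gt0 mulr_gt0. Qed.

Lemma posterior_weight_ge0 s u : (0 <= posterior_weight s u)%R.
Proof.
rewrite /posterior_weight indicE; case: (boolP (u \in _)) => [/set_mem u0|_].
  rewrite mul1r mulr_ge0// ltW ?matching_prior_gt0//.
  exact: suff_likelihood_gt0.
by rewrite mul0r.
Qed.

Lemma measurable_posterior_weight d (T : measurableType d) (f g : T -> param R) :
  measurable_fun setT f -> measurable_fun setT g ->
  measurable_fun setT (fun t => posterior_weight (f t) (g t)).
Proof.
move=> mf mg; rewrite /posterior_weight; apply: measurable_funM.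
  by apply: measurable_indic_comp => //; exact: measurable_param_space.
apply: measurable_funM; first exact: measurable_suff_likelihood.
exact: measurable_matching_prior.
Qed.

(** Events about the relative position of estimator and parameter; invariance is asked on
    [param_space], where [mulp] is the group law. *)
Definition left_invariant A := forall g s w, param_space g -> param_space s ->
  param_space w -> (A (mulp g s, mulp g w) <-> A (s, w)).

Definition posterior_mass s A : \bar R :=
  \int[leb5 R]_u (\1_A (s, u) * posterior_weight s u)%:E.

Lemma matching_prior_mulp g u : matching_prior (mulp g u) =
  (matching_prior g * matching_prior u)%R.
Proof.
rewrite /matching_prior.
have -> : par_theta (mulp g u) = (par_theta g * par_theta u)%R by [].
have -> : par_eta (mulp g u) = (par_eta g * par_eta u)%R by [].
by rewrite mulrACA invfM.
Qed.

Lemma measurable_posterior_integrand s A : measurable A ->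
  measurable_fun setT (fun u => (\1_A (s, u) * posterior_weight s u)%:E).
Proof.
move=> mA; apply/measurable_EFinP; apply: measurable_funM.
  apply: (@measurable_indic_comp _ _ _ _ R A (fun u => (s, u))) => //.
  exact: pair1_measurable.
by apply: measurable_posterior_weight; mfun.
Qed.

(** The Jacobian (theta eta)^2 of the left translation, times the prior 1 / (theta eta) and the
    factor theta^-n of the likelihood. *)
Definition posterior_scale s : R :=
  (par_theta s * par_eta s * (par_theta s)^-1 ^+ n)%R.

Lemma posterior_scale_gt0 s : param_space s -> (0 < posterior_scale s)%R.
Proof. by move=> [? ?]; rewrite !mulr_gt0// exprn_gt0// invr_gt0. Qed.

(** Substituting [mulp s u] for [u] carries the estimate [s] to the identity. The factor does not
    depend on [A], so it cancels in the normalized posterior. *)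
Lemma posterior_mass_scale s A : param_space s -> measurable A ->
  left_invariant A ->
  posterior_mass s A = (posterior_scale s)%:E * posterior_mass (onep R) A.
Proof.
move=> s0 mA iA; have [t0 e0] := s0.
have [_ H] := scales_mulpl s0.
rewrite /posterior_mass -[LHS]H; last 2 first.
- exact: measurable_posterior_integrand.
- by move=> u; rewrite lee_fin mulr_ge0 ?posterior_weight_ge0// indicE.
have -> : (posterior_scale s)%:E =
    ((par_theta s * par_eta s) ^+ 2)%:E *
    ((par_theta s)^-1 ^+ n * matching_prior s)%:E.
  rewrite -EFinM; congr EFin; rewrite /posterior_scale /matching_prior.
  move: (_ ^+ n)%R => a; move: (par_theta s) (par_eta s) t0 e0 => t e *.
  by field; rewrite !gt_eqF.
rewrite -muleA; congr (_ * _).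
rewrite -ge0_integralZl//; last 3 first.
- by apply: measurable_posterior_integrand.
- by move=> u _; rewrite lee_fin mulr_ge0 ?posterior_weight_ge0// indicE.
- rewrite lee_fin; apply: mulr_ge0; last exact/ltW/matching_prior_gt0.
  by apply: exprn_ge0; rewrite invr_ge0 ltW.
apply: eq_integral => u _; rewrite -EFinM; congr EFin.
rewrite /posterior_weight.
have [u0|u0] := pselect (param_space u); last first.
  have su0 : ~ param_space (mulp s u) by move=> /(param_space_mulpl s0).
  by rewrite ![\1_(@param_space R) _]indicE !memNset// !mul0r !mulr0.
have su0 := param_space_mulp s0 u0.
rewrite ![\1_(@param_space R) _]indicE !mem_set// !mul1r.
rewrite matching_prior_mulp.
have -> : suff_likelihood n s (mulp s u) =
    ((par_theta s)^-1 ^+ n * suff_likelihood n (onep R) u)%R.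
  rewrite -{1}(mulp1 s0) suff_likelihood_mulp//; exact: param_space1.
have -> : \1_A (s, mulp s u) = \1_A (onep R, u) :> R.
  rewrite !indicE; congr (nat_of_bool _)%:R.
  have := iA s (onep R) u s0 (param_space1 R) u0; rewrite mulp1// => -[h1 h2].
  by apply/idP/idP => /set_mem h; apply/mem_set; [exact: h1|exact: h2].
move: (\1_A _) (matching_prior s) (matching_prior u) => a b c.
by move: (suff_likelihood _ _ _) => f; move: (_ ^+ n)%R => h; ring.
Qed.

Lemma prior_mulpr s (B : set (param R)) : param_space s -> measurable B ->
  \int[leb5 R]_w (\1_(@param_space R) w * matching_prior w * \1_B (mulp w s))%:E =
  \int[leb5 R]_w (\1_(@param_space R) w * matching_prior w * \1_B w)%:E.
Proof.
move=> s0 mB; have [t0 e0] := s0.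
have [mm H] := scales_mulpr s0.
have mF : measurable_fun setT (fun w : param R =>
   (\1_(@param_space R) w * matching_prior w * \1_B w)%:E).
  apply/measurable_EFinP; apply: measurable_funM; last exact: measurable_indic.
  apply: measurable_funM; first by apply: measurable_indic; exact: measurable_param_space.
  by apply: measurable_matching_prior; mfun.
have F0 w : 0 <= (\1_(@param_space R) w * matching_prior w * \1_B w)%:E.
  rewrite lee_fin mulr_ge0 ?indicE//; case: (boolP (w \in _)) => [/set_mem w0|_].
    by rewrite mul1r ltW// matching_prior_gt0.
  by rewrite mul0r.
rewrite -[RHS]H//.
rewrite -ge0_integralZl//; last 2 first.
- exact: (measurableT_comp mF mm).
- by rewrite lee_fin mulr_ge0 ?ltW.
apply: eq_integral => w _; rewrite -EFinM; congr EFin.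
have [w0|w0] := pselect (param_space w); last first.
  have ws0 : ~ param_space (mulp w s) by move=> /(param_space_mulpr s0).
  by rewrite ![\1_(@param_space R) _]indicE !memNset// !mul0r !mulr0.
have ws0 := param_space_mulp w0 s0.
rewrite ![\1_(@param_space R) _]indicE !mem_set// !mul1r.
rewrite matching_prior_mulp /matching_prior.
have t1 := lt0r_neq0 t0; have e1 := lt0r_neq0 e0.
case: w0 => /lt0r_neq0 wt1 /lt0r_neq0 we1.
move: (\1_B _) => b.
move: (par_theta s) (par_eta s) (par_theta w) (par_eta w) t1 e1 wt1 we1 => t e t' e' *.
by field; apply/and4P.
Qed.

End posterior_mass.

(** * A box of finite positive prior mass *)

Section box.
Local Open Scope ereal_scope.
Context (R : realType).
Local Notation leb := (@lebesgue_measure R).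
Local Notation mR := (measurableTypeR R).

Lemma leb5_box (A1 A2 A3 A4 A5 : set mR) :
  measurable A1 -> measurable A2 -> measurable A3 -> measurable A4 ->
  measurable A5 ->
  leb5 R (A1 `*` A2 `*` A3 `*` A4 `*` A5) =
  leb A1 * leb A2 * leb A3 * leb A4 * leb A5.
Proof.
move=> m1 m2 m3 m4 m5.
have m12 := measurableX m1 m2; have m13 := measurableX m12 m3.
have m14 := measurableX m13 m4.
transitivity (product_sfm (product_sfm (product_sfm leb leb) leb) leb
   (A1 `*` A2 `*` A3 `*` A4) * leb A5); first exact: product_measure1E.
congr (_ * _).
transitivity (product_sfm (product_sfm leb leb) leb
   (A1 `*` A2 `*` A3) * leb A4); first exact: product_measure1E.
congr (_ * _).
transitivity (product_sfm leb leb (A1 `*` A2) * leb A3).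
  exact: product_measure1E.
by congr (_ * _); exact: product_measure1E.
Qed.

(** Theta and eta stay in [[1, 2]], where the prior is positive and at most 1; with Lebesgue volume
    1 this makes the prior mass positive and finite. *)
Definition unit_box : set (param R) :=
  `[0%R, 1%R] `*` `[0%R, 1%R] `*` `[0%R, 1%R] `*` `[1%R, 2%R] `*` `[1%R, 2%R].

Lemma measurable_unit_box : measurable unit_box.
Proof. by do 4 (apply: measurableX => //). Qed.

Lemma leb5_unit_box : leb5 R unit_box = 1.
Proof.
rewrite [LHS]leb5_box//.
have -> : leb `[0%R, 1%R] = 1.
  by rewrite lebesgue_measure_itv/= lte_fin ltr01 -EFinB subr0.
have -> : leb `[1%R, 2%R] = 1.
  rewrite lebesgue_measure_itv/= lte_fin ltr1n/= -EFinB.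
  by congr EFin; lra.
by rewrite !mule1.
Qed.

Lemma unit_box_ge1 w : unit_box w -> (1 <= par_theta w)%R /\ (1 <= par_eta w)%R.
Proof.
by move=> [[_] /=]; rewrite !in_itv/= => /andP[? _] /andP[? _].
Qed.

Lemma param_space_unit_box w : unit_box w -> param_space w.
Proof.
by move=> /unit_box_ge1[t1 e1]; split; exact: lt_le_trans ltr01 _.
Qed.

Definition box_mass : \bar R := \int[leb5 R]_w
  (\1_(@param_space R) w * matching_prior w * \1_unit_box w)%:E.

Lemma box_massE : box_mass = \int[leb5 R]_(w in unit_box) (matching_prior w)%:E.
Proof.
rewrite [RHS]integral_mkcond; apply: eq_integral => w _.
rewrite /patch !indicE; case: (boolP (w \in unit_box)) => [/set_mem wB|_].
  by rewrite mem_set ?mul1r ?mulr1//; exact: param_space_unit_box.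
by rewrite mulr0.
Qed.

Lemma measurable_prior_fun (D : set (param R)) :
  measurable_fun D (fun w => (matching_prior w)%:E : \bar R).
Proof.
apply: (measurable_funS measurableT) => //; apply/measurable_EFinP.
by apply: measurable_matching_prior; mfun.
Qed.

Lemma box_mass_gt0 : 0 < box_mass.
Proof.
rewrite box_massE; apply: integral_gt0.
- exact: measurable_unit_box.
- exact: measurable_prior_fun.
- by move=> w wB; rewrite lte_fin matching_prior_gt0//; exact: param_space_unit_box.
- by rewrite [X in _ < X]leb5_unit_box.
Qed.

Lemma box_mass_fin : box_mass \is a fin_num.
Proof.
rewrite ge0_fin_numE; last exact/ltW/box_mass_gt0.
rewrite box_massE; apply: (@le_lt_trans _ _ (\int[leb5 R]_(w in unit_box) 1%:E)).
  apply: ge0_le_integral => //.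
  - exact: measurable_unit_box.
  - by move=> w wB; rewrite lee_fin ltW// matching_prior_gt0//; exact: param_space_unit_box.
  - exact: measurable_prior_fun.
  - move=> w /unit_box_ge1[t1 e1]; rewrite lee_fin /matching_prior.
    have te1 : (1 <= par_theta w * par_eta w)%R by rewrite -[leLHS]mulr1 ler_pM.
    by rewrite invf_le1// (lt_le_trans ltr01).
rewrite integral_cst; last exact: measurable_unit_box.
by rewrite [X in _ * X]leb5_unit_box mule1 ltry.
Qed.

End box.

(** * The double integral over parameter and sample *)

Section key_identity.
Local Open Scope ereal_scope.
Context (R : realType) d (Omega : measurableType d) (P : probability Omega R).
Context (n : nat) (Z : 'I_n -> Omega -> obs R).
Hypotheses (ZP : std_sample P Z) (n3 : (3 <= n)%N).

Let n0 : (0 < n)%N. Proof. exact: leq_trans n3. Qed.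

Local Notation onep := (onep R).
Local Notation S := (fun o => mle (fun i => Z i o)).
Local Notation N := [set o | nondegenerate (fun i => Z i o)].
Local Notation Theta := (@param_space R).

Let L1 o : R := likelihood (fun i => Z i o) onep.

Let mZ i : measurable_fun setT (Z i). Proof. by have [] := ZP. Qed.

Let mS : measurable_fun setT S. Proof. exact: measurable_mle. Qed.

Let mN : measurable N. Proof. exact: measurable_nondegenerate. Qed.

Let mL1 : measurable_fun setT L1.
Proof.
apply: measurable_fun_prod_ord => i; apply: measurable_density => //; mfun.
Qed.

Let L10 o : (0 < L1 o)%R.
Proof.
by apply: prodr_gt0 => i _; apply: density_gt0; exact: param_space1.
Qed.

Let weight o : R := (\1_N o * \1_(@unit_box R) (S o) / L1 o)%R.

Let weight0 o : (0 <= weight o)%R.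
Proof. by rewrite /weight !indicE divr_ge0// ltW. Qed.

Let mweight : measurable_fun setT weight.
Proof.
apply: measurable_funM; last by mfun.
apply: measurable_funM; first exact: measurable_indic.
by apply: measurable_indic_comp => //; exact: measurable_unit_box.
Qed.

(** Its value is never computed; the identity below for the sure event shows that it is finite and
    positive. *)
Definition normalizer : \bar R :=
  \int[P]_o (weight o * (\1_N o * posterior_scale n (S o)))%:E.

Let scale0 o : (0 <= \1_N o * posterior_scale n (S o))%R.
Proof.
rewrite indicE; case: (boolP (o \in _)) => [/set_mem No|_]; last by rewrite mul0r.
by rewrite mul1r ltW// posterior_scale_gt0//; exact: param_space_mle.
Qed.

Let mscale' : measurable_fun setT (fun o => \1_N o * posterior_scale n (S o))%R.
Proof.
have [_ _ _ s4 s5] := measurable_par mS.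
by apply: measurable_funM; [exact: measurable_indic|rewrite /posterior_scale; mfun].
Qed.

Lemma key_identity (A : set (param R * param R)) :
  measurable A -> left_invariant A ->
  box_mass R * P [set o | nondegenerate (fun i => Z i o) /\ A (S o, onep)] =
  normalizer * posterior_mass n onep A.
Proof.
move=> mA iA.
have mA1 : measurable_fun setT (fun o => \1_A (S o, onep) : R).
  by apply: (@measurable_indic_comp _ _ _ _ R A (fun o => (S o, onep))) => //; mfun.
have mSp : measurable_fun setT (fun p : param R * Omega => S p.2).
  exact: (measurableT_comp mS measurable_snd).
have mp1 : measurable_fun setT (fun p : param R * Omega => p.1).
  exact: measurable_fst.
have mNp : measurable_fun setT (fun p : param R * Omega => \1_N p.2 : R).
  exact: measurable_indic_comp.
have mTp : measurable_fun setT (fun p : param R * Omega => \1_Theta p.1 : R).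
  by apply: measurable_indic_comp => //; exact: measurable_param_space.
pose E o : R := (\1_N o * \1_A (S o, onep))%R.
have mE : measurable_fun setT E.
  by apply: measurable_funM => //; exact: measurable_indic.
have E0 o : (0 <= E o)%R by rewrite /E !indicE mulr_ge0.
(* The box is imposed on [mulp w S], the estimator of the sample moved by [w], while the event keeps
   the unmoved sample. *)
pose f1 (p : param R * Omega) : \bar R :=
  (\1_Theta p.1 * matching_prior p.1 * \1_(@unit_box R) (mulp p.1 (S p.2)) * E p.2)%:E.
have prior0 w : (0 <= \1_Theta w * matching_prior w)%R.
  rewrite indicE; case: (boolP (w \in _)) => [/set_mem w0|_]; last by rewrite mul0r.
  by rewrite mul1r ltW// matching_prior_gt0.
have f10 p : 0 <= f1 p.
  by rewrite lee_fin mulr_ge0// mulr_ge0// indicE.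
have mf1 : measurable_fun setT f1.
  apply/measurable_EFinP; apply: measurable_funM; last first.
    exact: (measurableT_comp mE measurable_snd).
  apply: measurable_funM.
    by apply: measurable_funM => //; exact: measurable_matching_prior.
  apply: measurable_indic_comp; first exact: measurable_unit_box.
  exact: measurable_mulp.
(* The integrand after the change of law: the moved sample is now [Z], the box bears on its
   estimator and the event compares the latter with [w]. *)
pose f2 (p : param R * Omega) : \bar R :=
  (weight p.2 * (\1_A (S p.2, p.1) * posterior_weight n (S p.2) p.1))%:E.
have f20 p : 0 <= f2 p.
  by rewrite lee_fin mulr_ge0// mulr_ge0 ?posterior_weight_ge0// indicE.
have mf2 : measurable_fun setT f2.
  apply/measurable_EFinP; apply: measurable_funM.
    exact: (measurableT_comp mweight measurable_snd).
  apply: measurable_funM; last exact: measurable_posterior_weight.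
  apply: (@measurable_indic_comp _ _ _ _ R A (fun p => (S p.2, p.1))) => //.
  by mfun.
transitivity (\int[P]_o \int[leb5 R]_w f1 (w, o)).
  transitivity (\int[P]_o (box_mass R * (E o)%:E)).
    rewrite ge0_integralZl//; last 3 first.
    - exact/measurable_EFinP.
    - by move=> o _; rewrite lee_fin.
    - exact/ltW/box_mass_gt0.
    congr (_ * _).
    have mEA : measurable [set o | nondegenerate (fun i => Z i o) /\ A (S o, onep)].
      apply: measurableI => //.
      have mS1 : measurable_fun setT (fun o => (S o, onep)) by mfun.
      by rewrite -[X in measurable X]setTI; exact: mS1.
    rewrite -[X in P X]setIT -integral_indic//; apply: eq_integral => o _.
    rewrite /E !indicE; congr EFin.
    case: (boolP (o \in N)) => [/set_mem No|No]; last first.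
      rewrite mul0r memNset// => -[No' _].
      by move/negP: No; apply; apply/mem_set.
    rewrite mul1r; congr (nat_of_bool _)%:R.
    by apply/idP/idP => /set_mem h; apply/mem_set; [case: h|split].
  apply: eq_integral => o _; rewrite /f1 /=.
  have [No|No] := pselect (nondegenerate (fun i => Z i o)); last first.
    rewrite /E indicE memNset// mul0r mule0.
    by under eq_integral do rewrite mulr0; rewrite integral0.
  (* Right translation by the estimator removes it from the box, whatever the outcome. *)
  rewrite /box_mass -(prior_mulpr (param_space_mle n0 No) (@measurable_unit_box R)).
  under [RHS]eq_integral do rewrite EFinM.
  rewrite ge0_integralZr//.
  - apply/measurable_EFinP; apply: measurable_funM.
      apply: measurable_funM; last by apply: measurable_matching_prior; mfun.
      by apply: measurable_indic; exact: measurable_param_space.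
    apply: measurable_indic_comp; first exact: measurable_unit_box.
    by apply: measurable_mulp; mfun.
  - by move=> w _; rewrite lee_fin mulr_ge0// indicE.
  - by rewrite lee_fin.
transitivity (\int[leb5 R]_w \int[P]_o f1 (w, o)).
  exact: (esym (@fubini_tonelli _ _ _ _ R (leb5 R) P f1 mf1 f10)).
transitivity (\int[P]_o \int[leb5 R]_w f2 (w, o)); last first.
  transitivity (\int[P]_o ((weight o * (\1_N o * posterior_scale n (S o)))%:E *
      posterior_mass n onep A)); last first.
    rewrite ge0_integralZr//.
    - by apply/measurable_EFinP; exact: measurable_funM.
    - by move=> o _; rewrite lee_fin mulr_ge0.
    - apply: integral_ge0 => u _.
      by rewrite lee_fin mulr_ge0 ?posterior_weight_ge0// indicE.
  apply: eq_integral => o _; rewrite /f2 /=.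
  have [No|No] := pselect (nondegenerate (fun i => Z i o)); last first.
    have -> : weight o = 0%R by rewrite /weight indicE memNset// !mul0r.
    rewrite mul0r mul0e; under eq_integral do rewrite mul0r.
    by rewrite integral0.
  under eq_integral do rewrite EFinM.
  rewrite ge0_integralZl//; last 3 first.
  - by apply: measurable_posterior_integrand.
  - by move=> w _; rewrite lee_fin mulr_ge0 ?posterior_weight_ge0// indicE.
  - by rewrite lee_fin.
  rewrite -/(posterior_mass n (S o) A) (posterior_mass_scale n (param_space_mle n0 No))//.
  by rewrite muleA -EFinM; congr ((_ * _)%:E * _); rewrite indicE mem_set// mul1r.
transitivity (\int[leb5 R]_w \int[P]_o f2 (w, o)); last first.
  exact: (@fubini_tonelli _ _ _ _ R (leb5 R) P f2 mf2 f20).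
apply: eq_integral => w _.
have [w0|w0] := pselect (param_space w); last first.
  rewrite [LHS]integral0_eq ?[RHS]integral0_eq// => o _.
    by rewrite /f2 /= /posterior_weight [\1_Theta w]indicE memNset// mul0r !mulr0.
  by rewrite /f1 /= [\1_Theta w]indicE memNset// !mul0r.
pose mt (t : n.-tuple (obs R)) := mle (fun i => tnth t i).
pose ND : set (n.-tuple (obs R)) := [set t | nondegenerate (fun i => tnth t i)].
pose G (t : n.-tuple (obs R)) : \bar R :=
  (matching_prior w * (\1_(@unit_box R) (mt t) * (\1_ND t * \1_A (mt t, w))))%:E.
have mt' : measurable_fun setT mt.
  by apply: (@measurable_mle R n _ _ (fun i t => tnth t i)) => i; exact: measurable_tnth.
have mND : measurable ND.
  by apply: (@measurable_nondegenerate R n _ _ (fun i t => tnth t i)) => i; exact: measurable_tnth.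
have mG : measurable_fun setT G.
  apply/measurable_EFinP; apply: measurable_funM => //.
  apply: measurable_funM; first by apply: measurable_indic_comp => //; exact: measurable_unit_box.
  apply: measurable_funM; first exact: measurable_indic.
  apply: (@measurable_indic_comp _ _ _ _ R A (fun t => (mt t, w))) => //.
  by mfun.
have G0 t : 0 <= G t.
  by rewrite lee_fin mulr_ge0// ?ltW ?matching_prior_gt0// !indicE !mulr_ge0.
have tE (x : 'I_n -> obs R) : (fun i => tnth [tuple x i | i < n] i) = x.
  by apply/funext => i; rewrite tnth_mktuple.
(* For fixed [w] the integrand is a function of the moved sample: its estimator is [mulp w S], and
   by invariance [A (S, onep)] is [A (mulp w S, w)]. *)
transitivity (\int[P]_o G [tuple act w (Z i o) | i < n]).
  apply: eq_integral => o _; rewrite /f1 /G /mt /E /= [\1_Theta w]indicE mem_set// mul1r tE.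
  congr EFin; rewrite -[LHS]mulrA; congr (_ * _)%R.
  have [No|No] := pselect (nondegenerate (fun i => Z i o)).
    have -> : \1_N o = 1%R :> R by rewrite indicE mem_set.
    have -> : \1_ND [tuple act w (Z i o) | i < n] = 1%R :> R.
      by rewrite indicE mem_set//= /ND /= tE; apply/(nondegenerate_act n0 _ w0).
    rewrite mle_act// !mul1r; congr (_ * _)%R; rewrite !indicE; congr (nat_of_bool _)%:R.
    have := iA w (S o) onep w0 (param_space_mle n0 No) (param_space1 R).
    rewrite mulp1// => -[h1 h2].
    by apply/idP/idP => /set_mem h; apply/mem_set; [exact: h2|exact: h1].
  have -> : \1_N o = 0%R :> R by rewrite indicE memNset.
  have -> : \1_ND [tuple act w (Z i o) | i < n] = 0%R :> R.
    by rewrite indicE memNset//= /ND /= tE => /(nondegenerate_act n0 _ w0).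
  by rewrite !mul0r !mulr0.
(* In the likelihood ratio, the numerator becomes part of the posterior weight and the denominator
   is the [L1] in [weight]. *)
rewrite (integral_act_sample ZP (fun=> w0) mG G0).
apply: eq_integral => o _; rewrite /f2 /G /mt /weight /= -EFinM tE; congr EFin.
have [No|No] := pselect (nondegenerate (fun i => Z i o)); last first.
  have -> : \1_N o = 0%R :> R by rewrite indicE memNset.
  have -> : \1_ND [tuple Z i o | i < n] = 0%R :> R.
    by rewrite indicE memNset//= /ND /= tE.
  by rewrite !mul0r !mulr0 mul0r.
have -> : \1_N o = 1%R :> R by rewrite indicE mem_set.
have -> : \1_ND [tuple Z i o | i < n] = 1%R :> R.
  by rewrite indicE mem_set//= /ND /= tE.
rewrite /posterior_weight [\1_Theta w]indicE mem_set// !mul1r.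
rewrite prodf_div -/(likelihood (fun i => Z i o) w) -/(L1 o) (likelihoodE n0)//.
by move: (\1_A _) (\1_(@unit_box R) _) (matching_prior w) (suff_likelihood _ _ _) (L1 o)^-1%R => *; ring.
Qed.

End key_identity.

(** * Quantiles of an atomless law *)

Section quantile.
Local Open Scope ereal_scope.
Context d (T : measurableType d) (R : realType) (P : probability T R).

Lemma probability_bigcup_le (F : (set T)^nat) (c : \bar R) :
  (forall i, measurable (F i)) -> {homo F : i j / (i <= j)%N >-> i `<=` j} ->
  (forall i, P (F i) <= c) -> P (\bigcup_i F i) <= c.
Proof.
move=> mF ndF Fc.
have cF : P \o F @ \oo --> P (\bigcup_i F i).
  apply: nondecreasing_cvg_mu => //; first exact: bigcup_measurable.
  by move=> i j ij; apply/subsetPset/ndF.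
rewrite -(cvg_lim _ cF)//; apply: lime_le.
  by apply/cvg_ex; exists (P (\bigcup_i F i)).
by apply: nearW.
Qed.

(** The quantile is the supremum k0 of the levels where the distribution function is at most [p].
    Continuity along increasing unions gives P(Y < k0) <= p and P(Y > k0) <= 1 - p, and the absence
    of an atom at k0 closes the gap. *)
Lemma quantile_exists (Y : T -> R) (p : R) : measurable_fun setT Y ->
  (forall k, P [set t | Y t = k] = 0) -> (0 < p < 1)%R ->
  exists k, P [set t | (Y t <= k)%R] = p%:E.
Proof.
move=> mY Y0 /andP[p0 p1].
have mle k : measurable [set t | (Y t <= k)%R].
  by rewrite -[X in measurable X]setTI; apply: measurable_fun_ler.
have mge k : measurable [set t | (k <= Y t)%R].
  by rewrite -[X in measurable X]setTI; apply: measurable_fun_ler.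
have mgt k : measurable [set t | (k < Y t)%R].
  by rewrite -[X in measurable X]setTI; apply: measurable_fun_ltr.
have mlt k : measurable [set t | (Y t < k)%R].
  by rewrite -[X in measurable X]setTI; apply: measurable_fun_ltr.
have leP' k l : (k <= l)%R -> P [set t | (Y t <= k)%R] <= P [set t | (Y t <= l)%R].
  by move=> kl; apply: le_measure; rewrite ?inE// => t /= /le_trans; exact.
pose E : set R := [set k | P [set t | (Y t <= k)%R] <= p%:E].
have invn0 i : (0 < (i.+1%:R : R)^-1)%R by rewrite invr_gt0 ltr0n.
have setC k : P [set t | (k < Y t)%R] = 1 - P [set t | (Y t <= k)%R].
  rewrite -probability_setC//; congr (P _); apply/seteqP; split => t /=.
    by move=> h; apply/negP; rewrite -ltNge.
  by move=> /negP; rewrite -ltNge.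
have E0 : E !=set0.
  apply: contrapT => /forallNP nE.
  have : P (\bigcup_i [set t | (- i%:R < Y t)%R]) <= (1 - p)%:E.
    apply: probability_bigcup_le => // [i j ij t /=|i].
      by apply: le_lt_trans; rewrite lerN2 ler_nat.
    rewrite setC; have /negP := nE (- i%:R)%R; rewrite -ltNge => /ltW h.
    by rewrite EFinB; apply: leeB.
  have -> : \bigcup_i [set t | (- i%:R < Y t)%R] = setT.
    apply/seteqP; split => // t _; exists (Num.truncn `|Y t|).+1 => //=.
    rewrite ltrNl; apply: le_lt_trans (truncnS_gt _).
    by rewrite -normrN ler_norm.
  by rewrite probability_setT lee_fin; lra.
have Eub : has_ubound E.
  apply: contrapT => nub.
  have : P (\bigcup_i [set t | (Y t <= i%:R)%R]) <= p%:E.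
    apply: probability_bigcup_le => // [i j ij t /= h|i].
      by apply: (le_trans h); rewrite ler_nat.
    have [k Ek ik] : exists2 k, E k & (i%:R <= k)%R.
      apply: contrapT => h; apply: nub; exists i%:R => k Ek.
      by rewrite leNgt; apply/negP => ki; apply: h; exists k => //; exact: ltW.
    by apply: le_trans Ek; exact: leP'.
  have -> : \bigcup_i [set t | (Y t <= i%:R)%R] = setT.
    apply/seteqP; split => // t _; exists (Num.truncn `|Y t|).+1 => //=.
    by apply: le_trans (ltW (truncnS_gt _)); exact: ler_norm.
  by rewrite probability_setT lee_fin; lra.
have supE : has_sup E by split.
pose k0 := sup E.
exists k0; apply/eqP; rewrite eq_le; apply/andP; split.
  have -> : [set t | (Y t <= k0)%R] = [set t | (Y t < k0)%R] `|` [set t | Y t = k0].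
    apply/seteqP; split => t /=; first by rewrite le_eqVlt => /orP[/eqP|]; [right|left].
    by move=> [/ltW|->].
  have mE : measurable [set t | Y t = k0].
    have -> : [set t | Y t = k0] = [set t | (Y t <= k0)%R] `&` [set t | (k0 <= Y t)%R].
      apply/seteqP; split => t /=; first by move=> ->.
      by move=> [h1 h2]; apply/eqP; rewrite eq_le h1.
    exact: measurableI.
  apply: (le_trans (measureU2 P (mlt k0) mE)).
  rewrite [X in _ + X]Y0 adde0.
  have -> : [set t | (Y t < k0)%R] = \bigcup_i [set t | (Y t <= k0 - i.+1%:R^-1)%R].
    apply/seteqP; split => t /=; last first.
      move=> [i _ /=] h; apply: (le_lt_trans h).
      by rewrite ltrBlDr ltrDl.
    move=> h; have h' : (0 < k0 - Y t)%R by rewrite subr_gt0.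
    have [i ih] := ltr_add_invr h; exists i => //=.
    by rewrite lerBrDr ltW.
  apply: probability_bigcup_le => // [i j ij t /= h|i].
    apply: (le_trans h); rewrite lerD2l lerN2 lef_pV2 ?posrE ?ltr0n//.
    by rewrite ler_nat ltnS.
  have [|k Ek kk] := @sup_adherent _ E (i.+1%:R^-1) _ supE; first exact: invn0.
  by apply: le_trans Ek; apply: leP'; exact: ltW.
have : P [set t | (k0 < Y t)%R] <= (1 - p)%:E.
  have -> : [set t | (k0 < Y t)%R] = \bigcup_i [set t | (k0 + i.+1%:R^-1 < Y t)%R].
    apply/seteqP; split => t /=; last first.
      move=> [i _ /=]; apply: lt_trans; by rewrite ltrDl.
    move=> h; have [i ih] := ltr_add_invr h.
    by exists i.
  apply: probability_bigcup_le => // [i j ij t /=|i].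
    apply: le_lt_trans; rewrite lerD2l lef_pV2 ?posrE ?ltr0n//.
    by rewrite ler_nat ltnS.
  rewrite setC EFinB; apply: leeB => //; apply/ltW; rewrite ltNge; apply/negP => h.
  have : (k0 + i.+1%:R^-1 <= k0)%R by apply: sup_ubound.
  by rewrite gerDl leNgt invn0.
rewrite setC -(fineK (fin_num_measure P _ (mle k0))) -EFinB !lee_fin.
by move: (fine _) => f; lra.
Qed.

End quantile.

Section posterior_law.
Local Open Scope ereal_scope.
Context (R : realType) d (Omega : measurableType d) (P : probability Omega R).
Context (n : nat) (Z : 'I_n -> Omega -> obs R).
Hypotheses (ZP : std_sample P Z) (n3 : (3 <= n)%N).

Let n0 : (0 < n)%N. Proof. exact: leq_trans n3. Qed.

Local Notation onep := (onep R).
Local Notation S := (fun o => mle (fun i => Z i o)).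

Lemma posterior_mass_ge0 s (A : set (param R * param R)) :
  0 <= posterior_mass n s A.
Proof.
apply: integral_ge0 => u _.
by rewrite lee_fin mulr_ge0 ?posterior_weight_ge0// indicE.
Qed.

Let left_invariantT : left_invariant (@setT (param R * param R)).
Proof. by []. Qed.

Let normalizer_mass :
  box_mass R = normalizer P Z * posterior_mass n onep setT.
Proof.
rewrite -(key_identity ZP n3 measurableT left_invariantT).
have -> : [set o | nondegenerate (fun i => Z i o) /\ [set: param R * param R] (S o, onep)] =
    [set o | nondegenerate (fun i => Z i o)].
  by apply/seteqP; split => o //= -[].
by rewrite [X in _ * X](std_sample_nondegenerate ZP n3) mule1.
Qed.

Let normalizer_ge0 : 0 <= normalizer P Z.
Proof.
apply: integral_ge0 => o _; rewrite lee_fin mulr_ge0//.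
  rewrite !indicE divr_ge0//; apply: prodr_ge0 => i _; apply/ltW/density_gt0.
  exact: param_space1.
rewrite indicE; case: (boolP (o \in _)) => [/set_mem No|_]; last by rewrite mul0r.
by rewrite mul1r ltW// posterior_scale_gt0//; exact: param_space_mle.
Qed.

(** The finite positive [box_mass] is the product of this mass and [normalizer], both nonnegative;
    so neither factor is 0 or infinite, and the posterior is proper. *)
Lemma posterior_massT : exists2 m : R, (0 < m)%R & posterior_mass n onep setT = m%:E.
Proof.
have := normalizer_mass; have := posterior_mass_ge0 onep setT.
have := normalizer_ge0; have := box_mass_gt0 R; have := box_mass_fin R.
case: (posterior_mass n onep setT) => [m| |] //; case: (normalizer P Z) => [k| |] //.
- move=> _ b0 _ m0 bE; exists m => //; rewrite lt_neqAle -lee_fin m0 andbT.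
  by apply/eqP => m00; move: b0; rewrite bE -m00 mule0 ltxx.
- move=> bf b0 _ m0 bE; exists m => //; rewrite lt_neqAle -lee_fin m0 andbT.
  by apply/eqP => m00; move: b0; rewrite bE -m00 mule0 ltxx.
- move=> bf b0; rewrite lee_fin le_eqVlt => /orP[/eqP <-|k0] _ bE.
    by move: b0; rewrite bE mul0e ltxx.
  by move: bf; rewrite bE gt0_muley ?lte_fin.
- by move=> bf _ _ _ bE; move: bf; rewrite bE mulyy.
Qed.

(** [key_identity] for [A] is divided by the same identity for the sure event, which eliminates
    [box_mass] and [normalizer]. *)
Lemma sample_law (A : set (param R * param R)) :
  measurable A -> left_invariant A ->
  posterior_mass n onep A =
  P [set o | nondegenerate (fun i => Z i o) /\ A (S o, onep)] *
  posterior_mass n onep setT.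
Proof.
move=> mA iA; have [m m0 mE] := posterior_massT.
have bE := normalizer_mass; have := key_identity ZP n3 mA iA.
have [k k0 kE] : exists2 k : R, (0 < k)%R & normalizer P Z = k%:E.
  move: bE normalizer_ge0; rewrite mE; have := box_mass_gt0 R; have := box_mass_fin R.
  case: (normalizer P Z) => [k| |]//.
  - move=> _ b0 bE k0; exists k => //; rewrite lt_neqAle -lee_fin k0 andbT.
    by apply/eqP => k00; move: b0; rewrite bE -k00 mul0e ltxx.
  - by move=> bf _ bE; move: bf; rewrite bE gt0_mulye ?lte_fin.
have mS : measurable_fun setT S by apply: measurable_mle => i; have [] := ZP.
have mEA : measurable [set o | nondegenerate (fun i => Z i o) /\ A (S o, onep)].
  apply: measurableI; first by apply: measurable_nondegenerate => i; have [] := ZP.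
  have mS1 : measurable_fun setT (fun o => (S o, onep)) by mfun.
  by rewrite -[X in measurable X]setTI; exact: mS1.
rewrite bE mE kE -[P _](fineK (fin_num_measure P _ mEA)) => E.
have mAE : (k^-1)%:E * (k%:E * posterior_mass n onep A) = posterior_mass n onep A.
  by rewrite muleA -EFinM mulVf ?gt_eqF// mul1e.
rewrite -mAE -E -!EFinM; congr EFin.
by move: (fine _) => f; field; rewrite gt_eqF.
Qed.

Lemma posterior_sample_law (x : 'I_n -> obs R) (A : set (param R * param R))
    (B : set (param R)) :
  nondegenerate x -> measurable A -> left_invariant A ->
  (forall w, param_space w -> (B w <-> A (mle x, w))) ->
  posterior (@matching_prior R) x B =
  P [set o | nondegenerate (fun i => Z i o) /\ A (S o, onep)].
Proof.
move=> nx mA iA BA.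
have s0 := param_space_mle n0 nx.
have intE (C : set (param R * param R)) (D : set (param R)) :
    (forall w, param_space w -> (D w <-> C (mle x, w))) ->
    \int[@lebesgue5 R]_(w in @param_space R `&` D)
      (likelihood x w * matching_prior w)%:E = posterior_mass n (mle x) C.
  move=> DC; rewrite [LHS]integral_mkcond; apply: eq_integral => w _.
  rewrite /patch /posterior_weight !indicE.
  case: ifPn => [/set_mem[w0 /(DC _ w0) Cw]|wn].
    by rewrite !mem_set// !mul1r likelihoodE.
  have [w0|w0] := pselect (param_space w); last by rewrite [w \in _]memNset// mul0r mulr0.
  rewrite [(_, w) \in C]memNset ?mul0r// => /(DC _ w0) Dw.
  by move/negP: wn; apply; apply/mem_set.
rewrite /posterior (intE A B BA).
have -> : \int[@lebesgue5 R]_(w in @param_space R) (likelihood x w * matching_prior w)%:E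
    = posterior_mass n (mle x) setT.
  by rewrite -(intE setT setT)// setIT.
rewrite (posterior_mass_scale n s0 mA iA) (posterior_mass_scale n s0 measurableT left_invariantT).
rewrite sample_law//; have [m m0 ->] := posterior_massT.
have c0 := posterior_scale_gt0 n s0.
have mS : measurable_fun setT S by apply: measurable_mle => i; have [] := ZP.
have mEA : measurable [set o | nondegenerate (fun i => Z i o) /\ A (S o, onep)].
  apply: measurableI; first by apply: measurable_nondegenerate => i; have [] := ZP.
  have mS1 : measurable_fun setT (fun o => (S o, onep)) by mfun.
  by rewrite -[X in measurable X]setTI; exact: mS1.
rewrite -[P _](fineK (fin_num_measure P _ mEA)).
rewrite -!EFinM inver mulf_eq0 !gt_eqF//= -EFinM; congr EFin.
by move: (fine _) (posterior_scale n _) c0 => f c c0; field; rewrite !gt_eqF.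
Qed.

End posterior_law.

(** * The three likelihood ratio statistics *)

Section one_dimension.
Context (R : realType).
Implicit Types (m : R -> R).

(** The intermediate value theorem provides a point where [m] is midway between [k1] and [k2], and
    continuity an interval around it. *)
Lemma crossing m (c k1 k2 dd : R) : 0 <= c ->
  (forall v, c <= v -> {for v, continuous m}) -> m c <= k1 -> k1 < k2 ->
  c <= dd -> k2 <= m dd ->
  exists a b, [/\ 0 < a, a < b & forall v, a < v < b -> k1 < m v <= k2].
Proof.
move=> c0 mc mck1 k12 cd mdk2.
have mcont : {within `[c, dd], continuous m}.
  apply: continuous_in_subspaceT => v; rewrite inE/= in_itv/= => /andP[cv _].
  exact: mc.
have [v0 v0cd mv0] : exists2 v, v \in `[c, dd] & m v = (k1 + k2) / 2.
  apply: IVT => //; apply/andP; split.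
    rewrite ge_min; apply/orP; left; lra.
  rewrite le_max; apply/orP; right; lra.
have /andP[cv0 _] : c <= v0 <= dd by move: v0cd; rewrite in_itv.
have v0c : c < v0.
  rewrite lt_neqAle cv0 andbT; apply/eqP => cE.
  by move: mv0 mck1; rewrite -cE; lra.
have e0 : 0 < (k2 - k1) / 2 by lra.
have /cvgrPdist_lt/(_ _ e0) := mc v0 cv0.
move=> /nbhs_ballP[e /= e1 H].
(* The bound v0 / 2 keeps the interval among the positive reals, as theta and eta require. *)
pose del := Num.min e (v0 / 2).
have del0 : 0 < del by rewrite lt_min e1/=; lra.
have dele : del <= e by rewrite ge_min lexx.
have delv : del <= v0 / 2 by rewrite ge_min lexx orbT.
exists (v0 - del), (v0 + del); split; [lra|lra|] => v /andP[va vb].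
have : ball v0 e v.
  by rewrite /ball/= ltr_distlC; apply/andP; split; lra.
move=> /H; rewrite /= mv0 ltr_distlC => /andP[h1 h2].
by apply/andP; split; lra.
Qed.

Variable n : nat.
Hypothesis n0 : (0 < n)%N.

Let n2 : 0 < (2 * n%:R : R). Proof. by rewrite mulr_gt0// ltr0n. Qed.

(** The three statistics when the estimate is the identity, as functions of the interest parameter
    alone. *)
Definition prof_beta (v : R) : R := 2 * n%:R * ln (Num.sqrt (1 + v ^+ 2)).
Definition prof_eta (v : R) : R := 2 * n%:R * ln ((v + v^-1) / 2).
Definition prof_theta (v : R) : R := 2 * n%:R * (ln v + v^-1 - 1).

Lemma prof_beta_crossing k1 k2 : 0 <= k1 -> k1 < k2 ->
  exists a b, [/\ 0 < a, a < b & forall v, a < v < b -> k1 < prof_beta v <= k2].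
Proof.
(* The profile exceeds [k2] at [E] because (1 + E^2)^(1/2) >= E. *)
move=> k10 k12; pose E := expR (k2 / (2 * n%:R)).
apply: (@crossing prof_beta 0 k1 k2 E) => //.
- move=> v _; apply: continuousM; first exact: cst_continuous.
  have s0 : 0 < Num.sqrt (1 + v ^+ 2) by rewrite sqrtr_gt0 ltr_pwDl// sqr_ge0.
  apply: continuous_comp; last exact: continuous_ln.
  apply: continuous_comp; last exact: sqrt_continuous.
  by apply: continuousD; [exact: cst_continuous|exact: exprn_continuous].
- by rewrite /prof_beta expr0n/= addr0 sqrtr1 ln1 mulr0.
- exact: expR_ge0.
- rewrite /prof_beta mulrC -ler_pdivrMr//.
  rewrite -[leLHS]expRK -/E ler_ln ?posrE ?expR_gt0//; last first.
    by rewrite sqrtr_gt0 ltr_pwDl// sqr_ge0.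
  rewrite -[leLHS](ger0_norm (expR_ge0 _)) -sqrtr_sqr.
  by apply: ler_wsqrtr; rewrite lerDr.
Qed.

Lemma prof_eta_crossing k1 k2 : 0 <= k1 -> k1 < k2 ->
  exists a b, [/\ 0 < a, a < b & forall v, a < v < b -> k1 < prof_eta v <= k2].
Proof.
(* Half the sum of 2 E and its inverse exceeds E, so the profile exceeds [k2] at 2 E. *)
move=> k10 k12; pose E := expR (k2 / (2 * n%:R)).
have E1 : 1 <= E by rewrite -[leLHS]expR0 ler_expR divr_ge0 ?(ltW n2)// (le_trans k10)// ltW.
apply: (@crossing prof_eta 1 k1 k2 (2 * E)) => //.
- move=> v v1; apply: continuousM; first exact: cst_continuous.
  have v0 : 0 < v by exact: lt_le_trans v1.
  have s0 : 0 < (v + v^-1) / 2 by rewrite divr_gt0// addr_gt0// invr_gt0.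
  apply: continuous_comp; last exact: continuous_ln.
  apply: continuousM; last exact: cst_continuous.
  apply: continuousD; first exact: cvg_id.
  by apply: continuousV; [rewrite gt_eqF|exact: cvg_id].
- by rewrite /prof_eta invr1 -[X in X / _]/(2%:R : R) divff// ln1 mulr0.
- lra.
- rewrite /prof_eta mulrC -ler_pdivrMr//.
  have EV : 0 < (2 * E)^-1 by rewrite invr_gt0; lra.
  rewrite -[leLHS]expRK -/E ler_ln ?posrE ?expR_gt0//; lra.
Qed.

Lemma prof_theta_crossing k1 k2 : 0 <= k1 -> k1 < k2 ->
  exists a b, [/\ 0 < a, a < b & forall v, a < v < b -> k1 < prof_theta v <= k2].
Proof.
(* The added 1 offsets the constant -1 of the profile; the inverse of [E] is positive. *)
move=> k10 k12; pose E := expR (k2 / (2 * n%:R) + 1).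
have q0 : 0 <= k2 / (2 * n%:R) by rewrite divr_ge0 ?(ltW n2)// (le_trans k10)// ltW.
apply: (@crossing prof_theta 1 k1 k2 E) => //.
- move=> v v1; apply: continuousM; first exact: cst_continuous.
  have v0 : 0 < v by exact: lt_le_trans v1.
  apply: continuousB; last exact: cst_continuous.
  apply: continuousD; first exact: continuous_ln.
  by apply: continuousV; [rewrite gt_eqF|exact: cvg_id].
- by rewrite /prof_theta invr1 ln1 add0r subrr mulr0.
- by rewrite -[leLHS]expR0 ler_expR; lra.
- rewrite /prof_theta mulrC -ler_pdivrMr// expRK.
  have : 0 < E^-1 by rewrite invr_gt0 expR_gt0.
  by lra.
Qed.

Lemma prof_beta_level k : exists a b, forall v, prof_beta v = k -> v = a \/ v = b.
Proof.
pose E := expR (k / (2 * n%:R)); pose a := Num.sqrt (E ^+ 2 - 1).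
exists a, (- a) => v vk.
have s0 : 0 < 1 + v ^+ 2 by rewrite ltr_pwDl// sqr_ge0.
have lnE : ln (Num.sqrt (1 + v ^+ 2)) = k / (2 * n%:R).
  by rewrite -vk /prof_beta [RHS]mulrC mulKf// gt_eqF.
have v2 : v ^+ 2 = E ^+ 2 - 1.
  by rewrite /E -lnE lnK ?posrE ?sqrtr_gt0// sqr_sqrtr ?ltW//; ring.
have : v ^+ 2 = a ^+ 2 by rewrite sqr_sqrtr -v2// sqr_ge0.
by move/eqP; rewrite eqf_sqr => /orP[/eqP|/eqP]; [left|right].
Qed.

Lemma prof_eta_level k : exists a b, forall v, 0 < v ->
  prof_eta v = k -> v = a \/ v = b.
Proof.
(* The level set is given by v^2 - 2 E v + 1 = 0, whose roots are E + a and E - a. *)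
pose E := expR (k / (2 * n%:R)); pose a := Num.sqrt (E ^+ 2 - 1).
exists (E + a), (E - a) => v v0 vk.
have s0 : 0 < (v + v^-1) / 2 by rewrite divr_gt0// addr_gt0// invr_gt0.
have lnE : ln ((v + v^-1) / 2) = k / (2 * n%:R).
  by rewrite -vk /prof_eta [RHS]mulrC mulKf// gt_eqF.
have vE : (v + v^-1) / 2 = E by rewrite /E -lnE lnK ?posrE.
have v2 : (v - E) ^+ 2 = E ^+ 2 - 1 by rewrite -vE; field; rewrite gt_eqF.
have : (v - E) ^+ 2 = a ^+ 2 by rewrite sqr_sqrtr -v2// sqr_ge0.
move/eqP; rewrite eqf_sqr => /orP[/eqP|/eqP] h; [left|right].
  by rewrite -h addrC subrK.
by rewrite -h addrC subrK.
Qed.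

(** Injectivity on each side of 1, without derivatives. Equal values give ln v - ln u = (v - u) / (u
    v), whereas [ln y < y - 1] at u / v and v / u puts ln v - ln u strictly between (v - u) / v and
    (v - u) / u. This forces u < 1 < v. *)
Lemma prof_theta_inj u v : 0 < u -> u < v -> 1 <= u \/ v <= 1 ->
  prof_theta u != prof_theta v.
Proof.
move=> u0 uv H; have v0 := lt_trans u0 uv.
apply/eqP => /(mulfI (lt0r_neq0 n2)) /addIr E.
have q0 : 0 < v / u by rewrite divr_gt0.
have r0 : 0 < u / v by rewrite divr_gt0.
have q1 : v / u != 1.
  apply/eqP => h; move: uv.
  by rewrite -[X in _ < X](divfK (lt0r_neq0 u0)) h mul1r ltxx.
have r1 : u / v != 1.
  apply/eqP => h; move: uv.
  by rewrite -[X in X < _](divfK (lt0r_neq0 v0)) h mul1r ltxx.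
have := ln_lt_subr1 q0 q1; have := ln_lt_subr1 r0 r1.
rewrite !ln_div ?posrE// => h1 h2.
have dE : ln v - ln u = (v - u) / (u * v).
  have -> : ln v - ln u = u^-1 - v^-1 by lra.
  by field; rewrite !gt_eqF.
have d0 : 0 < v - u by rewrite subr_gt0.
case: H => H.
- have : (v - u) / v < (v - u) / (u * v).
    have -> : (v - u) / v = 1 - u / v by field; rewrite gt_eqF.
    by rewrite -dE; lra.
  rewrite ltr_pM2l// ltf_pV2 ?posrE ?mulr_gt0// => h.
  by move: h; rewrite ltNge -[leLHS]mul1r ler_pM2r// H.
- have : (v - u) / (u * v) < (v - u) / u.
    have -> : (v - u) / u = v / u - 1 by field; rewrite gt_eqF.
    by rewrite -dE.
  rewrite ltr_pM2l// ltf_pV2 ?posrE ?mulr_gt0// => h.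
  by move: h; rewrite ltNge -[leRHS]mulr1 ler_pM2l// H.
Qed.

(** This level set has no elementary formula, but it has at most one point on each side of 1. *)
Lemma prof_theta_level k : exists a b, forall v, 0 < v ->
  prof_theta v = k -> v = a \/ v = b.
Proof.
have [[a [a1 ak]]|na] := pselect (exists v, 1 <= v /\ prof_theta v = k);
have [[b [b0 b1 bk]]|nb] := pselect (exists v, [/\ 0 < v, v <= 1 & prof_theta v = k]).
- exists a, b => v v0 vk; have [v1|v1] := leP 1 v; [left|right].
    apply: contrapT => /eqP; rewrite neq_lt => /orP[h|h].
      by have := prof_theta_inj v0 h (or_introl v1); rewrite vk ak eqxx.
    by have := prof_theta_inj (lt_le_trans ltr01 a1) h (or_introl a1); rewrite vk ak eqxx.
  apply: contrapT => /eqP; rewrite neq_lt => /orP[h|h].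
    by have := prof_theta_inj v0 h (or_intror b1); rewrite vk bk eqxx.
  by have := prof_theta_inj b0 h (or_intror (ltW v1)); rewrite vk bk eqxx.
- exists a, a => v v0 vk; have [v1|v1] := leP 1 v; last first.
    by exfalso; apply: nb; exists v; split => //; exact: ltW.
  left; apply: contrapT => /eqP; rewrite neq_lt => /orP[h|h].
    by have := prof_theta_inj v0 h (or_introl v1); rewrite vk ak eqxx.
  by have := prof_theta_inj (lt_le_trans ltr01 a1) h (or_introl a1); rewrite vk ak eqxx.
- exists b, b => v v0 vk; have [v1|v1] := leP 1 v.
    by exfalso; apply: na; exists v.
  left; apply: contrapT => /eqP; rewrite neq_lt => /orP[h|h].
    by have := prof_theta_inj v0 h (or_intror b1); rewrite vk bk eqxx.
  by have := prof_theta_inj b0 h (or_intror (ltW v1)); rewrite vk bk eqxx.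
- exists 0, 0 => v v0 vk; exfalso; have [v1|v1] := leP 1 v.
    by apply: na; exists v.
  by apply: nb; exists v; split => //; exact: ltW.
Qed.

End one_dimension.

(* What the argument uses of an interest parameter [psi] with likelihood ratio
   statistic [M (mle x) w]: the statistic is invariant, and under any law with a
   positive density it has no atom and charges every nondegenerate interval of nonnegative reals. *)
Record invariant_lr (R : realType) (n : nat) (psi : param R -> R)
    (M : param R -> param R -> R) : Prop := InvariantLr {
  inv_lr_spec : lr_stat_spec n psi M;
  inv_lr_mulp : forall g s w, param_space g -> param_space s -> param_space w ->
    M (mulp g s) (mulp g w) = M s w;
  inv_lr_measurable : measurable_fun setT (fun p : param R * param R => M p.1 p.2);
  inv_lr_ge0 : forall s w, param_space s -> param_space w -> 0 <= M s w;
  inv_lr_null : forall k, exists D : set (param R), [/\ measurable D,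
    leb5 R D = 0%E & forall u, param_space u -> M (onep R) u = k -> D u];
  inv_lr_pos : forall k1 k2, 0 <= k1 -> k1 < k2 -> exists D : set (param R),
    [/\ measurable D, (0 < leb5 R D)%E &
      forall u, D u -> param_space u /\ k1 < M (onep R) u <= k2] }.

(** * Verification for beta, theta and eta *)

Section invariant_lr_instances.
Context (R : realType) (n : nat).
Hypothesis n0 : (0 < n)%N.
Implicit Types (g s w u : param R).
Local Notation mR := (measurableTypeR R).
Local Notation leb := (@lebesgue_measure R).

Lemma lebesgue_measure_oo_gt0 (a b : R) : a < b -> (0 < leb `]a, b[%classic)%E.
Proof. by move=> ab; rewrite lebesgue_measure_itv/= lte_fin ab -EFinB lte_fin subr_gt0. Qed.

Let l01 : (0 < leb `]0%R, 1%R[%classic)%E.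
Proof. exact: lebesgue_measure_oo_gt0. Qed.

Let lset1 (a : R) : leb [set a] = 0%E. Proof. exact: lebesgue_measure_set1. Qed.

Let mset1 (a : R) : measurable ([set a] : set mR). Proof. exact: measurable_set1. Qed.

Let slab_null (psi : param R -> R) (a b : R) :
  (forall c, measurable [set u | psi u = c] /\ leb5 R [set u | psi u = c] = 0%E) ->
  exists D : set (param R), [/\ measurable D, leb5 R D = 0%E &
    forall u, psi u = a \/ psi u = b -> D u].
Proof.
move=> H; have [ma a0] := H a; have [mb b0] := H b.
exists ([set u | psi u = a] `|` [set u | psi u = b]); split => //.
- exact: measurableU.
- apply/eqP; rewrite eq_le measure_ge0 andbT.
  apply: (le_trans (measureU2 _ ma mb)).
  by rewrite [X in (X + _)%E]a0 [X in (_ + X)%E]b0 adde0.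
Qed.

Let box_eq (A1 A2 A3 A4 A5 : set mR) (B : set (param R)) :
  B = A1 `*` A2 `*` A3 `*` A4 `*` A5 ->
  measurable A1 -> measurable A2 -> measurable A3 -> measurable A4 ->
  measurable A5 -> measurable B /\
  leb5 R B = (leb A1 * leb A2 * leb A3 * leb A4 * leb A5)%E.
Proof.
move=> -> m1 m2 m3 m4 m5; split; last exact: leb5_box.
by do 4 (apply: measurableX => //).
Qed.

Let null_beta (c : R) : measurable [set u | par_beta u = c] /\
  leb5 R [set u | par_beta u = c] = 0%E.
Proof.
have [|//|//|//|//|//|mB BE] := @box_eq setT setT [set c] setT setT [set u | par_beta u = c].
  by apply/seteqP; split => [[[[[a1 a2] a3] a4] a5]|[[[[a1 a2] a3] a4] a5] [[[]]]].
by split => //; rewrite BE [leb [set c]]lset1 mule0 !mul0e.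
Qed.

Let null_theta (c : R) : measurable [set u | par_theta u = c] /\
  leb5 R [set u | par_theta u = c] = 0%E.
Proof.
have [|//|//|//|//|//|mB BE] := @box_eq setT setT setT [set c] setT [set u | par_theta u = c].
  by apply/seteqP; split => [[[[[a1 a2] a3] a4] a5]|[[[[a1 a2] a3] a4] a5] [[[]]]].
by split => //; rewrite BE [leb [set c]]lset1 mule0 !mul0e.
Qed.

Let null_eta (c : R) : measurable [set u | par_eta u = c] /\
  leb5 R [set u | par_eta u = c] = 0%E.
Proof.
have [|//|//|//|//|//|mB BE] := @box_eq setT setT setT setT [set c] [set u | par_eta u = c].
  by apply/seteqP; split => [[[[[a1 a2] a3] a4] a5]|[[[[a1 a2] a3] a4] a5] [[[]]]].
by split => //; rewrite BE [leb [set c]]lset1 mule0.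
Qed.

Let box_pos (I3 I4 I5 : set mR) : measurable I3 -> measurable I4 -> measurable I5 ->
  (0 < leb I3)%E -> (0 < leb I4)%E -> (0 < leb I5)%E ->
  let D : set (param R) := `]0%R, 1%R[%classic `*` `]0%R, 1%R[%classic `*` I3 `*` I4 `*` I5 in
  measurable D /\ (0 < leb5 R D)%E.
Proof.
move=> m3 m4 m5 p3 p4 p5 D.
have [//|//|//|//|//|//|mD DE] := @box_eq `]0%R, 1%R[%classic `]0%R, 1%R[%classic I3 I4 I5 D.
by split => //; rewrite DE; do ! (apply: mule_gt0 => //).
Qed.

Let measurable_lr d (T : measurableType d) (f g : T -> param R) :
  measurable_fun setT f -> measurable_fun setT g ->
  [/\ measurable_fun setT (fun t => lr_beta n (f t) (g t)),
     measurable_fun setT (fun t => lr_theta n (f t) (g t)) &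
     measurable_fun setT (fun t => lr_eta n (f t) (g t))].
Proof.
move=> /measurable_par[f1 f2 f3 f4 f5] /measurable_par[g1 g2 g3 g4 g5].
by rewrite /lr_beta /lr_theta /lr_eta /rel_beta /rel_theta /rel_eta; split; mfun.
Qed.

Lemma invariant_lr_beta : invariant_lr n (@par_beta R) (@lr_beta R n).
Proof.
have profE u : lr_beta n (onep R) u = prof_beta n (par_beta u).
  by rewrite /lr_beta /rel_beta /prof_beta /= subr0 divr1.
split.
- exact: lr_stat_spec_beta.
- move=> g s w [_ g0] [_ s0] _; rewrite /lr_beta /rel_beta.
  have -> : par_eta (mulp g s) = par_eta g * par_eta s by [].
  have bE v : par_beta (mulp g v) = par_eta g * par_beta v + par_beta g by [].
  rewrite !bE opprD addrACA subrr addr0 -mulrBr -mulf_div divff ?gt_eqF//.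
  by rewrite mul1r.
- by have [] := measurable_lr (@measurable_fst _ _ (param R) (param R)) measurable_snd.
- move=> s w _ _; rewrite /lr_beta mulr_ge0// ?mulr_ge0//.
  by apply: ln_ge0; exact: rel_beta_ge1.
- move=> k; have [a [b ab]] := prof_beta_level n0 k.
  have [D [mD D0 HD]] := slab_null a b null_beta.
  by exists D; split => // u _; rewrite profE => /ab/HD.
- move=> k1 k2 k10 k12; have [a [b [a0 ab H]]] := prof_beta_crossing n0 k10 k12.
  have [mD D0] := @box_pos `]a, b[%classic `]0%R, 1%R[%classic `]0%R, 1%R[%classic
    (measurable_itv _) (measurable_itv _) (measurable_itv _)
    (lebesgue_measure_oo_gt0 ab) l01 l01.
  exists (`]0%R, 1%R[%classic `*` `]0%R, 1%R[%classic `*` `]a, b[%classic `*`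
    `]0%R, 1%R[%classic `*` `]0%R, 1%R[%classic); split => // u [[[_ h3] h4] h5].
  move: h3 h4 h5; rewrite /= !in_itv/= => h3 /andP[h4 _] /andP[h5 _].
  by split; [split|rewrite profE; exact: H].
Qed.

Lemma invariant_lr_theta : invariant_lr n (@par_theta R) (@lr_theta R n).
Proof.
have profE u : lr_theta n (onep R) u = prof_theta n (par_theta u).
  by rewrite /lr_theta /rel_theta /prof_theta /= divr1.
split.
- exact: lr_stat_spec_theta.
- move=> g s w [g0 _] [s0 _] _; rewrite /lr_theta /rel_theta.
  have tE v : par_theta (mulp g v) = par_theta g * par_theta v by [].
  by rewrite !tE -mulf_div divff ?gt_eqF// mul1r.
- by have [] := measurable_lr (@measurable_fst _ _ (param R) (param R)) measurable_snd.
- move=> s w [s0 _] [w0 _]; rewrite /lr_theta mulr_ge0// ?mulr_ge0//.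
  have t0 : 0 < rel_theta s w by exact: divr_gt0.
  have := ln_le_subr1 (_ : 0 < (rel_theta s w)^-1); rewrite invr_gt0 => /(_ t0).
  by rewrite lnV ?posrE//; lra.
- move=> k; have [a [b ab]] := prof_theta_level n0 k.
  have [D [mD D0 HD]] := slab_null a b null_theta.
  by exists D; split => // u [t0 _]; rewrite profE => /(ab _ t0)/HD.
- move=> k1 k2 k10 k12; have [a [b [a0 ab H]]] := prof_theta_crossing n0 k10 k12.
  have [mD D0] := @box_pos `]0%R, 1%R[%classic `]a, b[%classic `]0%R, 1%R[%classic
    (measurable_itv _) (measurable_itv _) (measurable_itv _)
    l01 (lebesgue_measure_oo_gt0 ab) l01.
  exists (`]0%R, 1%R[%classic `*` `]0%R, 1%R[%classic `*` `]0%R, 1%R[%classic `*`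
    `]a, b[%classic `*` `]0%R, 1%R[%classic); split => // u [[[_ h3] h4] h5].
  move: h3 h4 h5; rewrite /= !in_itv/= => h3 h4 /andP[h5 _].
  split; last by rewrite profE; exact: H.
  by split => //; apply: lt_trans a0 _; case/andP: h4.
Qed.

Lemma invariant_lr_eta : invariant_lr n (@par_eta R) (@lr_eta R n).
Proof.
have profE u : lr_eta n (onep R) u = prof_eta n (par_eta u).
  by rewrite /lr_eta /rel_eta /prof_eta /= divr1.
split.
- exact: lr_stat_spec_eta.
- move=> g s w [_ g0] [_ s0] _; rewrite /lr_eta /rel_eta.
  have tE v : par_eta (mulp g v) = par_eta g * par_eta v by [].
  by rewrite !tE -mulf_div divff ?gt_eqF// mul1r.
- by have [] := measurable_lr (@measurable_fst _ _ (param R) (param R)) measurable_snd.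
- move=> s w s0 w0; rewrite /lr_eta mulr_ge0// ?mulr_ge0//.
  by apply: ln_ge0; exact: rel_eta_ge1.
- move=> k; have [a [b ab]] := prof_eta_level n0 k.
  have [D [mD D0 HD]] := slab_null a b null_eta.
  by exists D; split => // u [_ e0]; rewrite profE => /(ab _ e0)/HD.
- move=> k1 k2 k10 k12; have [a [b [a0 ab H]]] := prof_eta_crossing n0 k10 k12.
  have [mD D0] := @box_pos `]0%R, 1%R[%classic `]0%R, 1%R[%classic `]a, b[%classic
    (measurable_itv _) (measurable_itv _) (measurable_itv _)
    l01 l01 (lebesgue_measure_oo_gt0 ab).
  exists (`]0%R, 1%R[%classic `*` `]0%R, 1%R[%classic `*` `]0%R, 1%R[%classic `*`
    `]0%R, 1%R[%classic `*` `]a, b[%classic); split => // u [[[_ h3] h4] h5].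
  move: h3 h4 h5; rewrite /= !in_itv/= => h3 /andP[h4 _] h5.
  split; last by rewrite profE; exact: H.
  by split => //; apply: lt_trans a0 _; case/andP: h5.
Qed.

End invariant_lr_instances.

(** * Coverage of the likelihood ratio regions *)

Section matching.
Local Open Scope ereal_scope.
Context (R : realType) (n : nat) (psi : param R -> R) (M : param R -> param R -> R).
Hypotheses (MP : invariant_lr n psi M) (n3 : (3 <= n)%N).

Let n0 : (0 < n)%N. Proof. exact: leq_trans n3. Qed.

Local Notation onep := (onep R).

Let mM : measurable_fun setT (fun p : param R * param R => M p.1 p.2).
Proof. by case: MP. Qed.

Let invariant_event (B : set R) : measurable B ->
  measurable [set p : param R * param R | B (M p.1 p.2)] /\
  left_invariant [set p : param R * param R | B (M p.1 p.2)].
Proof.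
move=> mB; split.
  rewrite -[X in measurable X]setTI.
  by apply: (mM measurableT).
by move=> g s w g0 s0 w0 /=; rewrite (inv_lr_mulp MP).
Qed.

Section sample.
Context d (Omega : measurableType d) (P : probability Omega R).
Context (Z : 'I_n -> Omega -> obs R).
Hypothesis ZP : std_sample P Z.
Local Notation S := (fun o => mle (fun i => Z i o)).
Local Notation N := [set o | nondegenerate (fun i => Z i o)].

Definition pivot_prob (B : set R) : \bar R :=
  P [set o | nondegenerate (fun i => Z i o) /\ B (M (S o) onep)].

Let mS : measurable_fun setT S.
Proof. by apply: measurable_mle => i; have [] := ZP. Qed.

Let mN : measurable N.
Proof. by apply: measurable_nondegenerate => i; have [] := ZP. Qed.

Let mMS : measurable_fun setT (fun o => M (S o) onep).
Proof.
apply: (measurableT_comp (f := fun p : param R * param R => M p.1 p.2)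
   (g := fun o => (S o, onep))) => //.
by mfun.
Qed.

Lemma measurable_pivot_event (B : set R) : measurable B ->
  measurable [set o | nondegenerate (fun i => Z i o) /\ B (M (S o) onep)].
Proof.
move=> mB; apply: measurableI => //.
by rewrite -[X in measurable X]setTI; exact: mMS.
Qed.

Let mass_pivot (B : set R) : measurable B ->
  posterior_mass n onep [set p : param R * param R | B (M p.1 p.2)] =
  pivot_prob B * posterior_mass n onep setT.
Proof. by move=> /invariant_event[mA iA]; exact: (sample_law ZP n3 mA iA). Qed.

(** Read through the posterior law, an atom would be a level set of the statistic with positive
    mass; but on [param_space] this set lies in a Lebesgue null set. *)
Lemma pivot_prob_set1 k : pivot_prob [set k] = 0.
Proof.
have [D [mD D0 HD]] := inv_lr_null MP k.
have mk : measurable ([set k] : set R) by exact: measurable_set1.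
have [mA _] := invariant_event mk.
have m0 : posterior_mass n onep [set p : param R * param R | [set k] (M p.1 p.2)] = 0.
  have mf := measurable_posterior_integrand n onep mA.
  transitivity (\int[leb5 R]_(u in D)
    (\1_[set p : param R * param R | [set k] (M p.1 p.2)] (onep, u) *
      posterior_weight n onep u)%:E); last first.
    by apply: null_set_integral => //; exact: measurable_funS mf.
  rewrite [RHS]integral_mkcond; apply: eq_integral => u _.
  rewrite /patch; case: ifPn => // uD.
  rewrite /posterior_weight ![\1_(param_space (R:=R)) u]indicE.
  have [u0|u0] := pselect (param_space u); last by rewrite [u \in _]memNset// mul0r mulr0.
  rewrite indicE memNset ?mul0r// => /= Mk.
  by move/negP: uD; apply; apply/mem_set; exact: HD.
have := mass_pivot mk; rewrite m0.
have [m m00 ->] := posterior_massT ZP n3.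
by move=> /esym/eqP; rewrite mule_eq0 [m%:E == 0]eqe (gt_eqF m00) orbF => /eqP.
Qed.

(** Read through the posterior law, whose density is positive on a set of positive Lebesgue measure
    where the statistic falls in the interval. *)
Lemma pivot_prob_itv_gt0 k1 k2 : (0 <= k1)%R -> (k1 < k2)%R ->
  0 < pivot_prob [set k | (k1 < k <= k2)%R].
Proof.
move=> k10 k12; have [D [mD D0 HD]] := inv_lr_pos MP k10 k12.
have mk : measurable ([set k | (k1 < k <= k2)%R] : set R).
  have -> : [set k | (k1 < k <= k2)%R] = `]k1, k2]%classic.
    by apply/seteqP; split => x /=; rewrite in_itv.
  exact: measurable_itv.
have [mA _] := invariant_event mk.
have m0 : 0 < posterior_mass n onep
    [set p : param R * param R | [set k | (k1 < k <= k2)%R] (M p.1 p.2)].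
  have mf := measurable_posterior_integrand n onep mA.
  apply: (@lt_le_trans _ _ (\int[leb5 R]_(u in D)
    (\1_[set p : param R * param R | [set k | (k1 < k <= k2)%R] (M p.1 p.2)] (onep, u) *
      posterior_weight n onep u)%:E)).
    apply: integral_gt0 => //; first exact: measurable_funS mf.
    move=> u /HD[u0 Mu]; rewrite indicE mem_set// mul1r lte_fin.
    rewrite /posterior_weight indicE mem_set// mul1r.
    by rewrite mulr_gt0 ?matching_prior_gt0//; exact: suff_likelihood_gt0.
  apply: ge0_subset_integral => // u _.
  by rewrite lee_fin mulr_ge0 ?posterior_weight_ge0// indicE.
rewrite lt0e measure_ge0 andbT; apply/eqP => p0.
by move: m0; rewrite mass_pivot// p0 mul0e ltxx.
Qed.

Let mle_set k : measurable ([set l | (l <= k)%R] : set R).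
Proof.
have -> : [set l | (l <= k)%R] = `]-oo, k]%classic.
  by apply/seteqP; split => x /=; rewrite in_itv.
exact: measurable_itv.
Qed.

(** As [p] is positive and the statistic nonnegative, the smaller cutoff is nonnegative; the
    interval between two distinct cutoffs would then be charged. *)
Lemma pivot_prob_cutoff_unique (p k k' : R) : (0 < p)%R ->
  pivot_prob [set l | (l <= k)%R] = p%:E ->
  pivot_prob [set l | (l <= k')%R] = p%:E -> k = k'.
Proof.
move=> p0.
wlog kk : k k' / (k < k')%R.
  move=> H kp k'p; have [h|h|//] := ltgtP k k'; first exact: H.
  by apply/esym; exact: H.
move=> kp k'p; exfalso.
have k0 : (0 <= k)%R.
  rewrite leNgt; apply/negP => kneg; have := kp; rewrite /pivot_prob.
  have -> : [set o | nondegenerate (fun i => Z i o) /\ [set l | (l <= k)%R] (M (S o) onep)] = set0.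
    apply/seteqP; split => // o [No /= Mk].
    have s0 := param_space_mle n0 No.
    have := inv_lr_ge0 MP s0 (param_space1 R).
    by rewrite leNgt (le_lt_trans Mk kneg).
  by rewrite measure0 => -[] p00; move: p0; rewrite -p00 ltxx.
have := pivot_prob_itv_gt0 k0 kk.
have : pivot_prob [set l | (l <= k')%R] =
    pivot_prob [set l | (l <= k)%R] + pivot_prob [set l | (k < l <= k')%R].
  rewrite /pivot_prob -measureU.
  - congr (P _); apply/seteqP; split => o /=.
      by move=> [No Mk']; case: (leP (M (S o) onep) k) => h; [left|right].
    by move=> [[No Mk]|[No /andP[_ ?]]]; split => //; exact: le_trans (ltW kk).
  - exact: measurable_pivot_event.
  - apply: measurable_pivot_event.
    have -> : [set l | (k < l <= k')%R] = `]k, k']%classic.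
      by apply/seteqP; split => x /=; rewrite in_itv.
    exact: measurable_itv.
  - apply/seteqP; split => // o [[_ /= h1] [_ /andP[h2 _]]].
    by move: h1; rewrite leNgt h2.
rewrite kp k'p; case: (pivot_prob _) => [r| |]//.
rewrite -EFinD => -[] pr; rewrite lte_fin.
by rewrite -(ltrD2l p) -pr addr0 ltxx.
Qed.

Lemma pivot_prob_cutoff_exists (p : R) : (0 < p < 1)%R ->
  exists k, pivot_prob [set l | (l <= k)%R] = p%:E.
Proof.
move=> p01.
(* Nondegeneracy has probability 1, so it may be dropped from the event and the quantile lemma
   applies to the statistic itself. *)
have aeN B : measurable B -> pivot_prob B = P [set o | B (M (S o) onep)].
  move=> mB; have mE : measurable [set o | B (M (S o) onep)].
    by rewrite -[X in measurable X]setTI; exact: mMS.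
  apply/eqP; rewrite eq_le; apply/andP; split.
    apply: le_measure; rewrite ?inE//; first exact: measurable_pivot_event.
    by move=> o [].
  apply: (@le_trans _ _ (P ([set o | nondegenerate (fun i => Z i o) /\ B (M (S o) onep)] `|` ~` N))).
    apply: le_measure; rewrite ?inE//.
      by apply: measurableU; [exact: measurable_pivot_event|exact: measurableC].
    by move=> o /= Bo; have [No|No] := pselect (nondegenerate (fun i => Z i o)); [left|right].
  apply: (le_trans (measureU2 P (measurable_pivot_event mB) (measurableC mN))).
  have N0 : P (~` N) = 0.
    by rewrite probability_setC// [X in 1 - X](std_sample_nondegenerate ZP n3) subee.
  by rewrite [X in _ + X]N0 adde0.
have [k kp] : exists k, P [set o | (M (S o) onep <= k)%R] = p%:E.
  apply: quantile_exists => // k.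
  by rewrite -(pivot_prob_set1 k) aeN.
by exists k; rewrite aeN.
Qed.

Lemma lr_regionP (x : 'I_n -> obs R) w k : nondegenerate x -> param_space w ->
  lr_region psi k x (psi w) <-> (M (mle x) w <= k)%R.
Proof.
move=> nx w0; split; last first.
  by move=> Mk; exists (M (mle x) w) => //; apply/(inv_lr_spec MP _ nx w0).
by move=> [m /(inv_lr_spec MP _ nx w0) ->].
Qed.

Lemma lr_region_nondegenerate (x : 'I_n -> obs R) k v :
  lr_region psi k x v -> nondegenerate x.
Proof.
by move=> [m [w [w' [mw _ _]]] _]; apply: (nondegenerate_of_mle n0); exists w.
Qed.

(** The right-hand side does not mention [x]: every nondegenerate data set has the same cutoffs. *)
Lemma is_cutoffP (x : 'I_n -> obs R) (alpha k : R) : nondegenerate x ->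
  is_cutoff (@matching_prior R) psi alpha x k <->
  pivot_prob [set l | (l <= k)%R] = (1 - alpha)%:E.
Proof.
move=> nx; rewrite /is_cutoff.
have [mA iA] := invariant_event (mle_set k).
by rewrite (posterior_sample_law ZP n3 nx mA iA)// => w w0; exact: lr_regionP.
Qed.

End sample.

(** The cutoff is the constant [k0] on nondegenerate data, and the statistic at the true [w] is the
    statistic at the identity of the sample pulled back by [actV w]. The two events are therefore
    equal, not only equally likely: a degenerate outcome belongs to neither. *)
Lemma coverage d (Omega : measurableType d) (P : probability Omega R)
    (X : 'I_n -> Omega -> obs R) (w : param R) (alpha : R)
    (k : ('I_n -> obs R) -> R) : param_space w -> iid_sample w P X ->
  (0 < alpha < 1)%R ->
  (forall x : 'I_n -> obs R, nondegenerate x ->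
    is_cutoff (@matching_prior R) psi alpha x (k x)) ->
  P [set o | lr_region psi (k (X ^~ o)) (X ^~ o) (psi w)] = (1 - alpha)%:E.
Proof.
move=> w0 XP alpha01 kP; have ZP := iid_sample_std w0 XP.
have p01 : (0 < 1 - alpha < 1)%R by lra.
have [k0 k0P] := pivot_prob_cutoff_exists ZP p01.
rewrite -k0P /pivot_prob; congr (P _).
have p0 : (0 < 1 - alpha)%R by case/andP: p01.
have XE o : (X ^~ o) = (fun i => act w (actV w (X i o))).
  by apply/funext => i; rewrite actVK.
have kE x : nondegenerate x -> k x = k0.
  move=> nx; have /(is_cutoffP ZP) := kP x nx => /(_ nx) kxP.
  exact: (pivot_prob_cutoff_unique ZP p0 kxP k0P).
have ME o : nondegenerate (fun i => actV w (X i o)) ->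
    M (mle (X ^~ o)) w = M (mle (fun i => actV w (X i o))) onep.
  move=> nz; rewrite XE mle_act//.
  have := inv_lr_mulp MP w0 (param_space_mle n0 nz) (param_space1 R).
  by rewrite mulp1.
have NE o : nondegenerate (X ^~ o) <-> nondegenerate (fun i => actV w (X i o)).
  by rewrite XE; exact: nondegenerate_act.
apply/seteqP; split => o /= h.
  have nx := lr_region_nondegenerate h; have nz := (NE o).1 nx.
  by split => //; rewrite -ME//; move: h; rewrite kE// => /(lr_regionP _ nx w0).
case: h => nz Mk; have nx := (NE o).2 nz.
by apply/(lr_regionP _ nx w0); rewrite kE// ME.
Qed.

Lemma cutoff_exists (x : 'I_n -> obs R) (alpha : R) : (0 < alpha < 1)%R ->
  nondegenerate x -> exists k, is_cutoff (@matching_prior R) psi alpha x k.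
Proof.
move=> alpha01 nx; have [d H1] := std_sample_exists R n.
case: H1 => Omega; case=> P; case=> Z ZP.
have p01 : (0 < 1 - alpha < 1)%R by lra.
have [k kP] := pivot_prob_cutoff_exists ZP p01.
by exists k; apply/(is_cutoffP ZP).
Qed.

End matching.

Lemma lr_matching_of_invariant (R : realType) (psi : param R -> R)
    (M : nat -> param R -> param R -> R) :
  (forall n, (0 < n)%N -> invariant_lr n psi (M n)) ->
  lr_matching (@matching_prior R) psi.
Proof.
move=> MP alpha alpha01; split.
  move=> n x n3 xmle; have n0 : (0 < n)%N by exact: leq_trans n3.
  apply: (cutoff_exists (MP n n0) n3 alpha01).
  exact: nondegenerate_of_mle.
move=> k kP w w0 d Omega P X XP.
apply/eqoP => eps eps0; near=> n.
(* From size 3 on the difference is exactly 0, which any multiple of 1 / n dominates. *)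
have n3 : (3 <= n)%N by near: n; exists 3.
have n0 : (0 < n)%N by exact: leq_trans n3.
rewrite (coverage (MP n n0) n3 w0 (XP n n3) alpha01 (k := k n)); last first.
  move=> x nx; apply: kP => //; exists (mle x).
  exact: is_mle_mle.
by rewrite /= subrr normr0 mulr_ge0// ltW.
Unshelve. all: by end_near.
Qed.

Theorem mainTheorem4 (R : realType) :
  [/\ lr_matching (@matching_prior R) (@par_beta R),
      lr_matching (@matching_prior R) (@par_theta R) &
      lr_matching (@matching_prior R) (@par_eta R)].
Proof.
split.
- apply: (lr_matching_of_invariant (M := @lr_beta R)) => n n0.
  exact: invariant_lr_beta.
- apply: (lr_matching_of_invariant (M := @lr_theta R)) => n n0.
  exact: invariant_lr_theta.
- apply: (lr_matching_of_invariant (M := @lr_eta R)) => n n0.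
  exact: invariant_lr_eta.
Qed.
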